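(* If $\delta\in\mathcal{I}(L)$ is not locally $F$-analytic, then $H^1(\delta)=0$. Consequently every extension of $\mathcal{R}_L$ by $\mathcal{R}_L(\delta)$ in the category of $(\varphi_q,\Gamma)$-modules over $\mathcal{R}_L$ splits.
   Context: Let $F$ be a finite extension of $\mathbb{Q}_p$ with ring of integers $\mathcal{O}_F$ and uniformizer $\pi$. Let $\mathcal{F}$ be a Lubin–Tate formal group over $\mathcal{O}_F$ attached to $\pi$, with endomorphisms $[a]_{\mathcal{F}}(X)$. Let $F_\infty$ be generated over $F$ by the torsion points of $\mathcal F$, $\Gamma=\mathrm{Gal}(F_\infty/F)$, $\chi_{\mathcal{F}}:\Gamma\xrightarrow{\sim}\mathcal{O}_F^\times$ the Lubin–Tate character, $\sigma_a=\chi_{\mathcal F}^{-1}(a)$. Let $L$ be a finite extension of $F$, $\mathcal{R}_L$ the Robba ring of Laurent series $\sum_{i\in\mathbb Z}a_iu^i$ ($a_i\in L$) converging on some annulus $0<v_p(u)\le r$, with endomorphisms $\varphi_q(f)(u)=f([\pi]_{\mathcal F}(u))$, $\sigma_a(f)(u)=f([a]_{\mathcal F}(u))$. A $(\varphi_q,\Gamma)$-module over $\mathcal R_L$ is a free finite rank $\mathcal R_L$-module with continuous semilinear commuting actions of $\varphi_q$ and $\Gamma$, $\varphi_q$ sending a basis to a basis. $\mathcal{I}(L)$ is the set of continuous characters $F^\times\to L^\times$. For $\delta\in\mathcal I(L)$, $\mathcal{R}_L(\delta)=\mathcal{R}_Le_\delta$ with $\varphi_q(fe_\delta)=\delta(\pi)\varphi_q(f)e_\delta$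 and $\sigma_a(fe_\delta)=\delta(a)\sigma_a(f)e_\delta$; $H^1(\delta)$ is the first cohomology of the semigroup $\varphi_q^{\mathbb N}\times\Gamma$ acting on $\mathcal R_L(\delta)$, computed with continuous inhomogeneous cochains. *)

(* Defs.v *)
From HB Require Import structures.
From mathcomp Require Import all_boot all_order all_algebra all_field.
From mathcomp Require Import finmap all_classical all_reals topology ring lra zify.

Set Implicit Arguments.
Unset Strict Implicit.
Unset Printing Implicit Defensive.

Import Order.TTheory GRing.Theory Num.Theory.
Local Open Scope classical_set_scope.
Local Open Scope ring_scope.

Record nonarch_abs (R : realType) (K : fieldType) := NonarchAbs {
  nabs :> K -> R;
  nabs_ge0 : forall x, 0 <= nabs x;
  nabs_eq0 : forall x, (nabs x == 0) = (x == 0);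
  nabsM : {morph nabs : x y / x * y};
  nabs_ultra : forall x y, nabs (x + y) <= Num.max (nabs x) (nabs y) }.

Definition nabs_cvg (R : realType) (K : fieldType) (v : nonarch_abs R K)
    (s : nat -> K) (l : K) :=
  forall eps : R, 0 < eps ->
    exists N, forall n, (N <= n)%N -> v (s n - l) < eps.

Definition nabs_cauchy (R : realType) (K : fieldType) (v : nonarch_abs R K)
    (s : nat -> K) :=
  forall eps : R, 0 < eps ->
    exists N, forall m n, (N <= m)%N -> (N <= n)%N -> v (s m - s n) < eps.

Record complete_abs (R : realType) (K : fieldType) := CompleteAbs {
  cabs_abs :> nonarch_abs R K;
  cabs_complete : forall s, nabs_cauchy cabs_abs s ->
    exists l, nabs_cvg cabs_abs s l }.

Section NonarchSums.
Variables (R : realType) (K : fieldType).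

Definition nullfam (I : choiceType) (u : I -> R) :=
  forall eps, 0 < eps -> exists A : {fset I}, forall i, i \notin A -> u i < eps.

(* Unconditional summation; over nat, in the complete nonarchimedean case, this
   is the same as convergence of the partial sums. *)
Definition has_sum (v : nonarch_abs R K) (I : choiceType) (f : I -> K) (l : K) :=
  forall eps : R, 0 < eps -> exists A : {fset I}, forall B : {fset I},
    (A `<=` B)%fset -> v (\sum_(i <- B) f i - l) < eps.

Definition nsum (v : nonarch_abs R K) (I : choiceType) (f : I -> K) : K :=
  xget 0 [set l | has_sum v f l].

Lemma nullfam_comp (I J : choiceType) (h : J -> I) (u : I -> R) :
  injective h -> nullfam u -> nullfam (u \o h).
Proof.
move=> hinj hu eps e0; have [A hA] := hu eps e0.
have : finite_set (h @^-1` [set` A]).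
  by apply: finite_preimage => //; move=> x y _ _; exact: hinj.
move=> /finite_fsetP [B BE]; exists B => j jB /=; apply: hA.
apply: contraNN jB => jA; suff : [set` B] j by [].
by rewrite -BE.
Qed.

Lemma nullfam_le (I : choiceType) (u w : I -> R) :
  (forall i, w i <= u i) -> nullfam u -> nullfam w.
Proof.
move=> h hu eps e0; have [A hA] := hu _ e0.
by exists A => i /hA; apply: le_lt_trans.
Qed.

Lemma nullfam_scale (I : choiceType) (u : I -> R) c : 0 <= c ->
  nullfam u -> nullfam (fun i => c * u i).
Proof.
move=> c0 hu eps e0.
have [A hA] := hu (eps / (c + 1)) ltac:(apply: divr_gt0 => //; lra).
exists A => i /hA; rewrite ltr_pdivlMr; last by lra.
case: (leP 0 (u i)) => ui h; nra.
Qed.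

Lemma nullfam_bounded (I : choiceType) (u : I -> R) :
  nullfam u -> exists2 M, 0 < M & forall i, u i <= M.
Proof.
move=> hu; have [A hA] := hu 1 ltr01.
exists (1 + \sum_(i <- A) `|u i|).
  by apply: ltr_pwDl => //; apply: sumr_ge0.
move=> i; case: (boolP (i \in A)) => iA; last first.
  by apply: ltW; apply: lt_le_trans (hA _ iA) _; rewrite lerDl; apply: sumr_ge0.
rewrite (big_fsetD1 i) //=; have := ler_norm (u i).
have : 0 <= \sum_(j <- (A `\ i)%fset) `|u j| by apply: sumr_ge0.
lra.
Qed.

Lemma nullfam_prod (I J : choiceType) (u : I -> R) (w : J -> R) :
  (forall i, 0 <= u i) -> (forall j, 0 <= w j) ->
  nullfam u -> nullfam w -> nullfam (fun p : I * J => u p.1 * w p.2).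
Proof.
move=> u0 w0 hu hw eps e0.
have [M M0 uM] := nullfam_bounded hu; have [N N0 wN] := nullfam_bounded hw.
have [A hA] := hu (eps / N) ltac:(exact: divr_gt0).
have [B hB] := hw (eps / M) ltac:(exact: divr_gt0).
exists (A `*` B)%fset => -[i j]; rewrite inE /= negb_and => /orP[] h.
  have := hA _ h; rewrite ltr_pdivlMr // => h1.
  by apply: le_lt_trans h1; apply: ler_wpM2l.
have := hB _ h; rewrite ltr_pdivlMr // mulrC => h1.
by apply: le_lt_trans h1; apply: ler_wpM2r.
Qed.

Section Abs.
Variable v : nonarch_abs R K.

Lemma nabs0 : v 0 = 0.
Proof. by apply/eqP; rewrite nabs_eq0. Qed.

Lemma nabs1 : v 1 = 1.
Proof.
have n0 : v 1 != 0 by rewrite nabs_eq0 oner_eq0.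
by apply: (mulfI n0); rewrite -nabsM !mulr1.
Qed.

Lemma nabsN x : v (- x) = v x.
Proof.
have hN : v (-1) = 1.
  apply/eqP; rewrite -(@eqrXn2 _ 2) ?nabs_ge0 //.
  by rewrite !expr2 -nabsM mulrNN !mulr1 nabs1.
by rewrite -mulN1r nabsM hN mul1r.
Qed.

Lemma nabs_ltD x y eps : v x < eps -> v y < eps -> v (x + y) < eps.
Proof. by move=> hx hy; apply: le_lt_trans (nabs_ultra _ _ _) _; rewrite gt_max hx. Qed.

Lemma nabs_ltB x y eps : v x < eps -> v y < eps -> v (x - y) < eps.
Proof. by move=> hx hy; apply: nabs_ltD; rewrite ?nabsN. Qed.

Lemma nabs_leD x y eps : v x <= eps -> v y <= eps -> v (x + y) <= eps.
Proof. by move=> hx hy; apply: le_trans (nabs_ultra _ _ _) _; rewrite ge_max hx. Qed.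

Lemma nabs_sum_lt (I : Type) (s : seq I) (P : pred I) f eps : 0 < eps ->
  (forall i, P i -> v (f i) < eps) -> v (\sum_(i <- s | P i) f i) < eps.
Proof.
move=> e0 h; elim/big_rec: _ => [|i x Pi hx]; first by rewrite nabs0.
by apply: nabs_ltD => //; exact: h.
Qed.

Lemma nabs_sum_le (I : Type) (s : seq I) (P : pred I) f eps : 0 <= eps ->
  (forall i, P i -> v (f i) <= eps) -> v (\sum_(i <- s | P i) f i) <= eps.
Proof.
move=> e0 h; elim/big_rec: _ => [|i x Pi hx]; first by rewrite nabs0.
by apply: nabs_leD => //; exact: h.
Qed.

Lemma nabs_small x : (forall eps, 0 < eps -> v x < eps) -> x = 0.
Proof.
move=> h; apply/eqP; rewrite -(nabs_eq0 v); apply/negPn/negP => n0.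
by have := h (v x); rewrite ltxx lt_neqAle eq_sym n0 nabs_ge0 => /(_ isT).
Qed.

Variables (I : choiceType).
Implicit Types (f g : I -> K).

Lemma has_sum_unique f l l' : has_sum v f l -> has_sum v f l' -> l = l'.
Proof.
move=> h h'; apply/eqP; rewrite -subr_eq0; apply/eqP/nabs_small => eps e0.
have [A hA] := h _ e0; have [B hB] := h' _ e0.
have {hA} := hA (A `|` B)%fset (fsubsetUl _ _).
have {hB} := hB (A `|` B)%fset (fsubsetUr _ _).
set S := \sum_(i <- _) _ => h1 h2.
have -> : l - l' = (S - l') - (S - l) by ring.
exact: nabs_ltB.
Qed.

Lemma nsumE f l : has_sum v f l -> nsum v f = l.
Proof.
move=> h; rewrite /nsum; case: xgetP => [x -> hx|/(_ l)//].
exact: has_sum_unique hx h.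
Qed.

Lemma has_sumD f g l m : has_sum v f l -> has_sum v g m ->
  has_sum v (fun i => f i + g i) (l + m).
Proof.
move=> hf hg eps e0; have [A hA] := hf _ e0; have [B hB] := hg _ e0.
exists (A `|` B)%fset => C; rewrite fsubUset => /andP[AC BC].
by rewrite big_split /= opprD addrACA; apply: nabs_ltD; [exact: hA|exact: hB].
Qed.

Lemma has_sumZ c f l : has_sum v f l -> has_sum v (fun i => c * f i) (c * l).
Proof.
move=> hf eps e0.
have vc := nabs_ge0 v c.
have [A hA] := hf (eps / (v c + 1)) ltac:(apply: divr_gt0 => //; lra).
exists A => B /hA; rewrite -mulr_sumr -mulrBr nabsM ltr_pdivlMr; last by lra.
have := nabs_ge0 v (\sum_(i <- B) f i - l); nra.
Qed.

Lemma has_sum_le f l e : 0 <= e -> (forall i, v (f i) <= e) ->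
  has_sum v f l -> v l <= e.
Proof.
move=> e0 fe h; rewrite leNgt; apply/negP => el.
have [A hA] := h (v l) (le_lt_trans e0 el).
have {hA} := hA A (fsubset_refl _).
set S := \sum_(i <- _) _ => h1.
have : v S <= e by apply: nabs_sum_le => // i _.
move=> /le_lt_trans /(_ el) h2.
have := nabs_ltB h2 h1; rewrite opprB addrC subrK.
by rewrite ltxx.
Qed.

Lemma has_sum_fin (A : {fset I}) f : (forall i, i \notin A -> f i = 0) ->
  has_sum v f (\sum_(i <- A) f i).
Proof.
move=> h eps e0; exists A => B AB.
suff -> : \sum_(i <- B) f i = \sum_(i <- A) f i by rewrite subrr nabs0.
symmetry; apply: big_fset_incl => // i _; exact: h.
Qed.

Lemma has_sum1 i0 f : (forall i, i != i0 -> f i = 0) -> has_sum v f (f i0).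
Proof.
move=> h; rewrite -[f i0](big_seq_fset1 (GRing.add : Monoid.law 0)).
by apply: has_sum_fin => i; rewrite inE; apply: h.
Qed.

End Abs.

Lemma has_sum_reindex (v : nonarch_abs R K) (I J : choiceType) (h : J -> I)
    (f : I -> K) l :
  bijective h -> has_sum v f l -> has_sum v (f \o h) l.
Proof.
move=> [k hk kh] hf eps e0; have [A hA] := hf _ e0.
exists (k @` A)%fset => B AB.
have := hA (h @` B)%fset.
rewrite big_imfset /=; last by move=> x y _ _; exact: (can_inj hk).
apply; apply/fsubsetP => i iA; apply/imfsetP; exists (k i) => /=.
  by apply: (fsubsetP AB); apply/imfsetP; exists i.
by rewrite kh.
Qed.

Lemma has_sum_fubini (v : nonarch_abs R K) (I J : choiceType)
    (f : I * J -> K) (g : I -> K) l :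
  nullfam (v \o f) -> (forall i, has_sum v (fun j => f (i, j)) (g i)) ->
  has_sum v f l -> has_sum v g l.
Proof.
move=> fn fg fl eps e0.
have [S hS] := fn _ e0; have [A hA] := fl _ e0.
exists [fset p.1 | p in (S `|` A)%fset]%fset => B IB.
pose J0 := [fset p.2 | p in (S `|` A)%fset]%fset.
have sub : (S `|` A `<=` B `*` J0)%fset.
  apply/fsubsetP => p pSA; rewrite in_fsetM; apply/andP; split.
    by apply: (fsubsetP IB); apply/imfsetP; exists p.
  by apply/imfsetP; exists p.
have := hA _ (fsubset_trans (fsubsetUr _ _) sub).
have -> : \sum_(p <- (B `*` J0)%fset) f p =
    \sum_(i <- B) \sum_(j <- J0) f (i, j).
  transitivity (\sum_(p <- [seq (i, j) | i <- B, j <- J0]) f p); last first.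
    by rewrite big_allpairs.
  apply: perm_big; apply: uniq_perm.
  - exact: fset_uniq.
  - by apply: allpairs_uniq => [||[? ?] [? ?]//]; exact: fset_uniq.
  - move=> [i j]; rewrite in_fsetM /=.
    apply/idP/idP => [/andP[/= iB jJ]|/allpairsP[[a b] [/= aB bJ [-> ->]]]].
      by apply/allpairsP; exists (i, j).
    by rewrite aB.
move=> h1.
have h2 : v (\sum_(i <- B) (g i - \sum_(j <- J0) f (i, j))) < eps.
  apply: nabs_sum_lt => // i _.
  have [C hC] := fg i _ e0.
  have := hC (C `|` J0)%fset (fsubsetUl _ _).
  have -> : \sum_(j <- (C `|` J0)%fset) f (i, j) =
     \sum_(j <- J0) f (i, j) + \sum_(j <- (C `\` J0)%fset) f (i, j).
    rewrite (big_fsetID _ (mem J0)) /=; congr (_ + _); apply: eq_fbigl => j;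
      rewrite !inE /=; case: (j \in J0); case: (j \in C) => //.
  set a := \sum_(j <- J0) _; set b := \sum_(j <- _) _ => h3.
  have hb : v b < eps.
    rewrite /b big_seq; apply: nabs_sum_lt => // j.
    rewrite !inE => /andP[jJ _]; apply: (hS (i, j)).
    apply: contraNN jJ => ijS; apply/imfsetP; exists (i, j) => //=.
    by rewrite inE ijS.
  have -> : g i - a = b - (a + b - g i).
    by ring.
  exact: nabs_ltB.
rewrite big_split /= sumrN in h2.
have := nabs_ltD h2 h1; by rewrite addrA subrK.
Qed.

Lemma has_sum_ex (v : complete_abs R K) (I : choiceType) (f : I -> K) :
  nullfam (v \o f) -> exists l, has_sum v f l.
Proof.
move=> fn.
have /choice [S hS] : forall n : nat, exists A : {fset I},
    forall i, i \notin A -> v (f i) < n.+1%:R^-1.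
  by move=> n; apply: fn; rewrite invr_gt0 ltr0n.
pose T (n : nat) : {fset I} := (\bigcup_(k <- iota 0 n.+1) S k)%fset.
have TS n k : (k <= n)%N -> (S k `<=` T n)%fset.
  by move=> kn; apply: bigfcup_sup => //; rewrite mem_iota ltnS kn.
have key n (B : {fset I}) : (S n `<=` B)%fset -> forall C : {fset I},
    (S n `<=` C)%fset -> v (\sum_(i <- B) f i - \sum_(i <- C) f i) < n.+1%:R^-1.
  have aux (D : {fset I}) : (S n `<=` D)%fset ->
      v (\sum_(i <- D) f i - \sum_(i <- S n) f i) < n.+1%:R^-1.
    move=> sD; have -> : \sum_(i <- D) f i =
        \sum_(i <- S n) f i + \sum_(i <- (D `\` S n)%fset) f i.
      rewrite (big_fsetID _ (mem (S n))) /=; congr (_ + _); apply: eq_fbigl => j;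
        rewrite !inE /= ; last by rewrite andbC.
      by rewrite andb_idl // => /(fsubsetP sD).
    rewrite addrC addKr big_seq; apply: nabs_sum_lt; first by rewrite invr_gt0 ltr0n.
    by move=> i; rewrite !inE => /andP[iS _]; exact: hS.
  move=> sB C sC; have := nabs_ltB (aux _ sB) (aux _ sC).
  by rewrite opprB addrA subrK.
have arch (eps : R) : 0 < eps -> exists n : nat, n.+1%:R^-1 < eps.
  move=> e0; exists (Num.truncn eps^-1).
  rewrite invf_plt ?posrE ?ltr0n //; exact: truncnS_gt.
have [l hl] : exists l, nabs_cvg v (fun n => \sum_(i <- T n) f i) l.
  apply: cabs_complete => eps /arch[N hN]; exists N => m n Nm Nn.
  by apply: lt_trans hN; apply: key; apply: TS.
exists l => eps /[dup] e0 /arch[n hn].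
have [N hN] := hl _ e0.
exists (S n) => B sB.
have h1 := lt_trans (key n B sB (T (maxn n N)) (TS _ _ (leq_maxl _ _))) hn.
have h2 := hN (maxn n N) (leq_maxr _ _).
by have := nabs_ltD h1 h2; rewrite addrA subrK.
Qed.

Lemma has_nsum (v : complete_abs R K) (I : choiceType) (f : I -> K) :
  nullfam (v \o f) -> has_sum v f (nsum v f).
Proof. by move=> /has_sum_ex [l hl]; rewrite (nsumE hl). Qed.

End NonarchSums.

Section RobbaRing.
Variables (R : realType) (K : fieldType) (v : complete_abs R K).

(* With v = p^(-v_p), the circle of radius s is v_p(u) = -log_p s, so that
   [conv_from rho] is convergence on 0 < v_p(u) <= r for rho = p^(-r). *)
Definition conv_from (rho : R) (a : int -> K) :=
  forall s, rho <= s -> s < 1 -> nullfam (fun i : int => v (a i) * s ^ i).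

Definition robba_pred : {pred int -> K} :=
  fun a => `[< exists rho, [/\ 0 < rho, rho < 1 & conv_from rho a] >].

Record robba := Robba {
  robba_coef :> int -> K; robba_coefP : robba_coef \in robba_pred }.

HB.instance Definition _ := [isSub for robba_coef].
HB.instance Definition _ := [Choice of robba by <:].

Lemma robbaP (a : int -> K) :
  reflect (exists rho, [/\ 0 < rho, rho < 1 & conv_from rho a]) (a \in robba_pred).
Proof. exact: asboolP. Qed.

Lemma conv_from_le rho rho' a : rho <= rho' -> conv_from rho a -> conv_from rho' a.
Proof. by move=> h ha s hs; apply: ha; exact: le_trans hs. Qed.

Lemma conv_fromD rho a b : 0 < rho -> conv_from rho a -> conv_from rho b ->
  conv_from rho (fun i => a i + b i).
Proof.
move=> rho0 ha hb s hs s1 eps e0.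
have [A hA] := ha s hs s1 _ e0; have [B hB] := hb s hs s1 _ e0.
exists (A `|` B)%fset => i; rewrite inE negb_or => /andP[/hA h1 /hB h2].
have s0 : 0 < s ^ i by apply: exprz_gt0; exact: lt_le_trans hs.
rewrite -ltr_pdivlMr //; apply: nabs_ltD; rewrite ltr_pdivlMr //.
Qed.

Lemma conv_fromZ rho c a : conv_from rho a -> conv_from rho (fun i => c * a i).
Proof.
move=> ha s hs s1; have := nullfam_scale (nabs_ge0 v c) (ha s hs s1).
by congr nullfam; apply: funext => i; rewrite nabsM mulrA.
Qed.

Lemma robba2P (a b : robba) : exists rho,
  [/\ 0 < rho, rho < 1, conv_from rho a & conv_from rho b].
Proof.
have /robbaP [r [r0 r1 ha]] := robba_coefP a.
have /robbaP [t [t0 t1 hb]] := robba_coefP b.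
exists (Num.max r t); split.
- by rewrite lt_max r0.
- by rewrite gt_max r1.
- by apply: conv_from_le ha; rewrite le_max lexx.
- by apply: conv_from_le hb; rewrite le_max lexx orbT.
Qed.

Lemma robba_zmod_closed : zmod_closed robba_pred.
Proof.
split.
  apply/robbaP; exists (1/2); split; rewrite ?divr_gt0 ?ltr_pdivrMr ?mul1r ?ltr1n ?ltr0n //.
  move=> s _ _ eps e0; exists fset0 => i _.
  by rewrite /= nabs0 mul0r.
move=> a b aR bR.
have [r [r0 r1 ha hb]] := robba2P (Robba aR) (Robba bR).
apply/robbaP; exists r; split => //.
have := conv_fromD r0 ha (conv_fromZ (-1) hb).
by congr conv_from; apply: funext => i /=; rewrite mulN1r.
Qed.

HB.instance Definition _ :=
  GRing.isZmodClosed.Build (int -> K) robba_pred robba_zmod_closed.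
HB.instance Definition _ := [SubChoice_isSubZmodule of robba by <:].

Lemma robbaD (a b : robba) i : (a + b) i = a i + b i. Proof. by []. Qed.
Lemma robba0 i : (0 : robba) i = 0. Proof. by []. Qed.

Lemma robba_eqP (a b : robba) : (forall i, a i = b i) -> a = b.
Proof. by move=> h; apply: val_inj; apply: funext. Qed.

Definition laurent_mul (a b : int -> K) : int -> K :=
  fun n => nsum v (fun i : int => a i * b (n - i)).

Lemma int_subK (n : int) : involutive (fun i : int => n - i).
Proof. by move=> i; rewrite opprB addrC subrK. Qed.

Definition diag2 (n i : int) : int * int := (i, n - i).
Lemma diag2_inj n : injective (diag2 n).
Proof. by move=> i j []. Qed.

Definition diag3 (n : int) (p : int * int) : int * (int * int) :=
  (p.1, (p.2, n - p.1 - p.2)).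
Lemma diag3_inj n : injective (diag3 n).
Proof.
move=> [i j] [k l] h.
by have := congr1 fst h; have := congr1 (fst \o snd) h; rewrite /= => -> ->.
Qed.

Lemma abs_conv (a b : int -> K) s n i : 0 < s ->
  v (a i * b (n - i)) = s ^ (- n) * (v (a i) * s ^ i * (v (b (n - i)) * s ^ (n - i))).
Proof.
move=> s0; have s1 : s != 0 by rewrite gt_eqF.
have e : s ^ (- n) * (s ^ i * s ^ (n - i)) = 1.
  rewrite -!expfzDr //; have -> : - n + (i + (n - i)) = 0 by ring.
  by rewrite expr0z.
rewrite nabsM; set X := v _; set Y := v _.
have -> : s ^ (- n) * (X * s ^ i * (Y * s ^ (n - i))) =
  X * Y * (s ^ (- n) * (s ^ i * s ^ (n - i))) by ring.
by rewrite e mulr1.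
Qed.

Lemma wt_ge0 (a : int -> K) (s : R) i : 0 < s -> 0 <= v (a i) * s ^ i.
Proof. by move=> s0; rewrite mulr_ge0 ?nabs_ge0 // exprz_ge0 // ltW. Qed.

Lemma null_conv rho a b n : 0 < rho -> rho < 1 -> conv_from rho a -> conv_from rho b ->
  nullfam (v \o (fun i => a i * b (n - i))).
Proof.
move=> r0 r1 ha hb.
have /nullfam_comp := nullfam_prod (fun i => wt_ge0 a i r0) (fun i => wt_ge0 b i r0)
  (ha _ (lexx _) r1) (hb _ (lexx _) r1).
move=> /(_ _ _ (@diag2_inj n)) /(nullfam_scale (c := rho ^ (- n))).
have -> : 0 <= rho ^ (- n) by apply: exprz_ge0; exact: ltW.
move=> /(_ isT); apply: nullfam_le => i /=.
by rewrite (abs_conv a b n i r0).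
Qed.

Lemma has_laurent_mul (a b : robba) n :
  has_sum v (fun i : int => a i * b (n - i)) (laurent_mul a b n).
Proof.
have [r [r0 r1 ha hb]] := robba2P a b.
by apply: has_nsum; apply: null_conv r0 r1 ha hb.
Qed.

Lemma laurent_mul_robba (a b : robba) : laurent_mul a b \in robba_pred.
Proof.
have [r [r0 r1 ha hb]] := robba2P a b.
apply/robbaP; exists r; split => // s rs s1 eps e0.
have s0 : 0 < s by exact: lt_le_trans rs.
have e2 : 0 < eps / 2 by lra.
have [S hS] := nullfam_prod (fun i => wt_ge0 a i s0) (fun i => wt_ge0 b i s0)
  (ha _ rs s1) (hb _ rs s1) e2.
exists [fset (p.1 + p.2)%R | p in S]%fset => n nS.
have sn0 : 0 < s ^ n by apply: exprz_gt0.
apply: le_lt_trans (_ : _ <= eps / 2) _; last by lra.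
rewrite -ler_pdivlMr //; apply: has_sum_le (has_laurent_mul a b n).
  by apply: divr_ge0; apply: ltW.
move=> i; rewrite (abs_conv a b n i s0) -invr_expz [leRHS]mulrC.
apply: ler_wpM2l; first by rewrite invr_ge0 ltW.
apply: ltW; apply: (hS (i, n - i)); apply: contraNN nS => iS.
by apply/imfsetP; exists (i, n - i) => //=; ring.
Qed.

Definition robba_mul (a b : robba) : robba := Robba (laurent_mul_robba a b).

Lemma robba_mulP (a b c : robba) :
  (forall n, has_sum v (fun i : int => a i * b (n - i)) (c n)) -> robba_mul a b = c.
Proof. by move=> h; apply: robba_eqP => n; apply: nsumE. Qed.

Lemma robba_one_subproof : (fun i : int => ((i == 0)%:R : K)) \in robba_pred.
Proof.
apply/robbaP; exists (1/2); split; rewrite ?divr_gt0 ?ltr_pdivrMr ?mul1r ?ltr1n ?ltr0n //.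
move=> s _ _ eps e0; exists [fset 0%R]%fset => i.
by rewrite inE => /negbTE -> /=; rewrite nabs0 mul0r.
Qed.
Definition robba_one : robba := Robba robba_one_subproof.

Lemma robba_mulC : commutative robba_mul.
Proof.
move=> a b; apply: robba_mulP => n.
have := has_sum_reindex (Bijective (int_subK n) (int_subK n)) (has_laurent_mul b a n).
by congr has_sum; apply: funext => i /=; rewrite int_subK mulrC.
Qed.

Lemma robba_mul1 : left_id robba_one robba_mul.
Proof.
move=> a; apply: robba_mulP => n.
have := @has_sum1 _ _ v _ (0 : int) (fun i => robba_one i * a (n - i)).
rewrite [robba_one 0]/= mul1r subr0; apply => i /negbTE i0.
by rewrite [robba_one i]/= i0 mul0r.
Qed.

Lemma robba_mulDl : left_distributive robba_mul +%R.
Proof.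
move=> a b c; apply: robba_mulP => n; rewrite robbaD.
have := has_sumD (has_laurent_mul a c n) (has_laurent_mul b c n).
by congr has_sum; apply: funext => i; rewrite robbaD mulrDl.
Qed.

Lemma robba_mulA : associative robba_mul.
Proof.
move=> a b c; apply: robba_mulP => n.
have [r [r0 r1 ha]] : exists rho, [/\ 0 < rho, rho < 1,
    conv_from rho a /\ conv_from rho b & conv_from rho c].
  have [r [r0 r1 ha hb]] := robba2P a b; have [t [t0 t1 hc _]] := robba2P c c.
  exists (Num.max r t); split; rewrite ?lt_max ?gt_max ?r0 ?r1 //.
    by split; [apply: conv_from_le ha|apply: conv_from_le hb];
       rewrite le_max lexx.
  by apply: conv_from_le hc; rewrite le_max lexx orbT.
case: ha => ha hb hc.
pose T (p : int * int) := a p.1 * (b p.2 * c (n - p.1 - p.2)).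
have nT : nullfam (v \o T).
  have /nullfam_comp := nullfam_prod (fun i => wt_ge0 a i r0)
     (fun p : int * int => mulr_ge0 (wt_ge0 b p.1 r0) (wt_ge0 c p.2 r0))
     (ha _ (lexx _) r1)
     (nullfam_prod (fun i => wt_ge0 b i r0) (fun i => wt_ge0 c i r0)
        (hb _ (lexx _) r1) (hc _ (lexx _) r1)).
  move=> /(_ _ _ (@diag3_inj n)) /(nullfam_scale (c := r ^ (- n))).
  have -> : 0 <= r ^ (- n) by apply: exprz_ge0; exact: ltW.
  move=> /(_ isT); apply: nullfam_le => -[i j] /=.
  rewrite /T /= !nabsM.
  have rn : r != 0 by rewrite gt_eqF.
  have e : r ^ (- n) * (r ^ i * (r ^ j * r ^ (n - i - j))) = 1.
    rewrite -!expfzDr //; have -> : - n + (i + (j + (n - i - j))) = 0 by ring.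
    by rewrite expr0z.
  set X := v _; set Y := v _; set Z := v _.
  have -> : r ^ (- n) * (X * r ^ i * (Y * r ^ j * (Z * r ^ (n - i - j)))) =
    (X * (Y * Z)) * (r ^ (- n) * (r ^ i * (r ^ j * r ^ (n - i - j)))) by ring.
  by rewrite e mulr1.
have hT := has_nsum nT; set l := nsum v T in hT.
have h1 : has_sum v (fun i => a i * robba_mul b c (n - i)) l.
  apply: has_sum_fubini nT _ hT => i.
  have h := has_sumZ (a i) (has_laurent_mul b c (n - i)).
  by rewrite /T /=; exact: h.
have h2 : has_sum v (fun k => robba_mul a b k * c (n - k)) l.
  pose h (p : int * int) : int * int := (p.2, p.1 - p.2).
  have hinj : injective h.
    by move=> [i j] [k m] [-> /eqP]; rewrite (inj_eq (addIr _)) => /eqP ->.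
  have hb' : bijective h.
    exists (fun p => (p.1 + p.2, p.1)) => -[i j] /=; rewrite /h /=.
      by rewrite addrC subrK.
    by rewrite addrC addKr.
  apply: has_sum_fubini (nullfam_comp hinj nT) _ (has_sum_reindex hb' hT) => k.
  rewrite mulrC; have := has_sumZ (c (n - k)) (has_laurent_mul a b k).
  congr has_sum; apply: funext => i; rewrite /T /h /=.
  have -> : n - i - (k - i) = n - k by ring.
  by ring.
have -> : robba_mul (robba_mul a b) c n = l by apply: nsumE.
exact: h1.
Qed.

Lemma robba_one_neq0 : robba_one != 0.
Proof.
apply/eqP => h.
have : (1 : K) = 0 by exact: (congr1 (fun f : robba => f 0) h).
by move/eqP; rewrite oner_eq0.
Qed.

HB.instance Definition _ := GRing.Zmodule_isComNzRing.Build robba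
  robba_mulA robba_mulC robba_mul1 robba_mulDl robba_one_neq0.

Definition robba_unit : {pred robba} := fun f => `[< exists g : robba, g * f = 1 >].
Definition robba_inv (f : robba) : robba :=
  if f \in robba_unit then xget f [set g | g * f = 1] else f.

Lemma robba_mulVx : {in robba_unit, left_inverse 1 robba_inv *%R}.
Proof.
move=> f fu; rewrite /robba_inv fu; case: xgetP => // /(_ _) h.
by move: fu => /asboolP [g hg]; case: (h g).
Qed.
Lemma robba_unitPl (f g : robba) : g * f = 1 -> robba_unit f.
Proof. by move=> h; apply/asboolP; exists g. Qed.
Lemma robba_inv_out : {in [predC robba_unit], robba_inv =1 id}.
Proof. by move=> f; rewrite /robba_inv inE => /negbTE ->. Qed.

HB.instance Definition _ := GRing.ComNzRing_hasMulInverse.Build robba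
  robba_mulVx robba_unitPl robba_inv_out.

Lemma robba_scale_subproof c (a : robba) : (fun i => c * a i) \in robba_pred.
Proof.
have /robbaP [r [r0 r1 ha]] := robba_coefP a.
by apply/robbaP; exists r; split => //; apply: conv_fromZ.
Qed.
Definition robba_scale c (a : robba) : robba := Robba (robba_scale_subproof c a).

Lemma robba_scaleA c d a : robba_scale c (robba_scale d a) = robba_scale (c * d) a.
Proof. by apply: robba_eqP => i /=; rewrite mulrA. Qed.
Lemma robba_scale1 : left_id 1 robba_scale.
Proof. by move=> a; apply: robba_eqP => i /=; rewrite mul1r. Qed.
Lemma robba_scaleDr : right_distributive robba_scale +%R.
Proof. by move=> c a b; apply: robba_eqP => i; exact: mulrDr. Qed.
Lemma robba_scaleDl a : {morph robba_scale^~ a : c d / c + d}.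
Proof. by move=> c d; apply: robba_eqP => i; exact: mulrDl. Qed.

HB.instance Definition _ := GRing.Zmodule_isLmodule.Build K robba
  robba_scaleA robba_scale1 robba_scaleDr robba_scaleDl.

(* The locally convex inductive limit topology: an O_K-submodule U is open iff
   its trace on each Frechet space E^(0,r] is a neighbourhood of 0, the topology
   of E^(0,r] being given by the norms sup |a_i| s^i over rho <= s <= rho',
   where rho = p^(-r) and rho <= rho' < 1. *)
Record open_lattice (U : set robba) : Prop := OpenLattice {
  ol0 : U 0;
  olD : forall f g, U f -> U g -> U (f + g);
  olZ : forall (c : K) f, v c <= 1 -> U f -> U (c *: f);
  ol_nbhs : forall rho, 0 < rho -> rho < 1 -> exists rho' eps,
    [/\ rho <= rho', rho' < 1, 0 < eps &
      forall f : robba, conv_from rho f ->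
        (forall s (i : int), rho <= s -> s <= rho' -> v (f i) * s ^ i <= eps) ->
        U f] }.

Definition robba_nbhs (f : robba) : set_system robba :=
  [set A | exists2 U, open_lattice U & forall g, U g -> A (f + g)].

Lemma open_lattice_setT : open_lattice setT.
Proof.
by split=> // rho r0 r1; exists rho, 1; split.
Qed.

Lemma open_latticeI U V : open_lattice U -> open_lattice V -> open_lattice (U `&` V).
Proof.
move=> hU hV; split.
- by split; apply: ol0.
- by move=> f g [uf vf] [ug vg]; split; apply: olD.
- by move=> c f hc [uf vf]; split; apply: olZ.
- move=> rho r0 r1.
  have [t [e [rt t1 e0 h]]] := ol_nbhs hU r0 r1.
  have [t' [e' [rt' t1' e0' h']]] := ol_nbhs hV r0 r1.
  exists (Num.max t t'), (Num.min e e'); split.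
  + by rewrite le_max rt.
  + by rewrite gt_max t1.
  + by rewrite lt_min e0.
  + move=> f hf hn; split; [apply: h => // s i rs st|apply: h' => // s i rs st].
      by apply: le_trans (hn s i rs _) _; rewrite ?le_max ?st // ge_min lexx.
    by apply: le_trans (hn s i rs _) _; rewrite ?le_max ?st ?orbT // ge_min lexx orbT.
Qed.

Lemma robba_nbhs_filter f : ProperFilter (robba_nbhs f).
Proof.
split; first by move=> [U hU]; apply; exact: ol0.
split.
- by exists setT => //; exact: open_lattice_setT.
- move=> A B [U hU UA] [V hV VB]; exists (U `&` V); first exact: open_latticeI.
  by move=> g [? ?]; split; [apply: UA|apply: VB].
- by move=> A B AB [U hU UA]; exists U => // g Ug; apply: AB; exact: UA.
Qed.

Lemma robba_nbhs_singleton f A : robba_nbhs f A -> A f.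
Proof. by move=> [U hU UA]; rewrite -[f]addr0; apply: UA; exact: ol0. Qed.

Lemma robba_nbhs_nbhs f A : robba_nbhs f A -> robba_nbhs f (robba_nbhs^~ A).
Proof.
move=> [U hU UA]; exists U => // g Ug; exists U => // h Uh.
by rewrite -addrA; apply: UA; apply: olD.
Qed.

HB.instance Definition _ := hasNbhs.Build robba robba_nbhs.
HB.instance Definition _ := Nbhs_isNbhsTopological.Build robba
  robba_nbhs_filter robba_nbhs_singleton robba_nbhs_nbhs.

(* Laurent series outside the Robba ring are sent to 0; this is never used on
   such series below. *)
Definition robba_of (a : int -> K) : robba := insubd 0 a.

(* f(g(u)) = sum_i a_i g(u)^i, summed coefficient by coefficient. *)
Definition robba_subst (g f : robba) : robba :=
  robba_of (fun n => nsum v (fun i : int => f i * (g ^ i) n)).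

End RobbaRing.

(* Formal power series in k variables, indexed by exponent vectors. *)
Section PowerSeries.
Variable A : fieldType.

Definition mps (k : nat) := {ffun 'I_k -> nat} -> A.

Definition mdeg k (m : {ffun 'I_k -> nat}) : nat := (\sum_i m i)%N.

Definition mps1 k : mps k := fun m => (m == [ffun=> 0%N])%:R.

Definition mpsX k (i : 'I_k) : mps k := fun m => (m == [ffun j => (j == i) : nat])%:R.

Definition mps_mul k (f g : mps k) : mps k := fun m =>
  \sum_(e : {ffun 'I_k -> 'I_(mdeg m).+1} | [forall i, e i <= m i]%N)
    f [ffun i => e i : nat] * g [ffun i => (m i - e i)%N].

Definition mps_exp k (f : mps k) (n : nat) : mps k := iter n (mps_mul f) (@mps1 k).

(* h(g_1, ..., g_n), for series g_i without constant term: then only the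
   monomials of h with all exponents at most |m| contribute to the coefficient
   at m. *)
Definition mps_comp n k (h : mps n) (g : 'I_n -> mps k) : mps k := fun m =>
  \sum_(e : {ffun 'I_n -> 'I_(mdeg m).+1})
    h [ffun i => e i : nat] *
    (\big[@mps_mul k/@mps1 k]_(i < n) mps_exp (g i) (e i)) m.

Definition mps_comp1 k (h : mps 1) (f : mps k) : mps k := mps_comp h (fun=> f).

Definition mps_comp2 k (h : mps 2) (f g : mps k) : mps k :=
  mps_comp h (fun i => if i == ord0 then f else g).

Definition coef1 (f : mps 1) (n : nat) : A := f [ffun=> n].

End PowerSeries.

Section LubinTate.
Variables (R : realType) (F : fieldType) (v : nonarch_abs R F).

Definition uniformizer (pi : F) :=
  [/\ pi != 0, v pi < 1 & forall x, v x < 1 -> v x <= v pi].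

Definition residue_card (q : nat) := exists s : 'I_q -> F,
  [/\ forall i, v (s i) <= 1,
      forall i j, v (s i - s j) < 1 -> i = j &
      forall x, v x <= 1 -> exists i, v (x - s i) < 1].

Definition integral_mps k (f : mps F k) := forall m, v (f m) <= 1.

Record formal_group_law (G : mps F 2) : Prop := FormalGroupLaw {
  fgl_integral : integral_mps G;
  fgl_0r : mps_comp2 G (mpsX F (ord0 : 'I_1)) (fun=> 0) = mpsX F ord0;
  fgl_0l : mps_comp2 G (fun=> 0) (mpsX F (ord0 : 'I_1)) = mpsX F ord0;
  fgl_C : mps_comp2 G (mpsX F (lift ord0 ord0)) (mpsX F ord0) = G;
  fgl_A : let X i := mpsX F (inord i : 'I_3) in
    mps_comp2 G (mps_comp2 G (X 0%N) (X 1%N)) (X 2%N) =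
    mps_comp2 G (X 0%N) (mps_comp2 G (X 1%N) (X 2%N)) }.

(* [br a] is the endomorphism [a] of the formal group G; only its values at
   a in O_F are relevant. *)
Record lubin_tate_group (pi : F) (q : nat) (G : mps F 2) (br : F -> mps F 1) : Prop :=
  LubinTateGroup {
    lt_fgl : formal_group_law G;
    lt_integral : forall a, v a <= 1 -> integral_mps (br a);
    lt_coef0 : forall a, v a <= 1 -> coef1 (br a) 0 = 0;
    lt_coef1 : forall a, v a <= 1 -> coef1 (br a) 1 = a;
    lt_endo : forall a, v a <= 1 ->
      mps_comp1 (br a) G =
      mps_comp2 G (mps_comp1 (br a) (mpsX F ord0))
                  (mps_comp1 (br a) (mpsX F (lift ord0 ord0)));
    lt_1 : br 1 = mpsX F ord0;
    lt_D : forall a b, v a <= 1 -> v b <= 1 ->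
      br (a + b) = mps_comp2 G (br a) (br b);
    lt_M : forall a b, v a <= 1 -> v b <= 1 ->
      br (a * b) = mps_comp1 (br a) (br b);
    lt_frob : forall n, v (coef1 (br pi) n - (n == q)%:R) <= v pi }.

End LubinTate.

Section Adjoin.
Variables (F O : fieldType) (j : {rmorphism F -> O}) (T : set O).

Definition adjoin_pred : {pred O} := fun x => `[< forall S : {pred O},
  divring_closed S -> (forall a, j a \in S) -> (forall t, T t -> t \in S) ->
  x \in S >].

(* F(T), the subfield of O generated by the image of F and T. *)
Record adjoin := Adjoin { adjoin_val :> O; adjoin_valP : adjoin_val \in adjoin_pred }.

Lemma adjoin_closed : divring_closed adjoin_pred.
Proof.
split.
- by apply/asboolP => S [].
- move=> x y /asboolP hx /asboolP hy; apply/asboolP => S cS jS TS.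
  by have [_ SB _] := cS; apply: SB; [exact: hx|exact: hy].
- move=> x y /asboolP hx /asboolP hy; apply/asboolP => S cS jS TS.
  by have [_ _ SV] := cS; apply: SV; [exact: hx|exact: hy].
Qed.

HB.instance Definition _ := [isSub for adjoin_val].
HB.instance Definition _ := [Choice of adjoin by <:].
HB.instance Definition _ := GRing.isDivringClosed.Build O adjoin_pred adjoin_closed.
HB.instance Definition _ := [SubChoice_isSubIntegralDomain of adjoin by <:].
HB.instance Definition _ := [SubIntegralDomain_isSubField of adjoin by <:].

Lemma adjoin_base_subproof a : j a \in adjoin_pred.
Proof. by apply/asboolP => S _ jS _; exact: jS. Qed.
Definition adjoin_base (a : F) : adjoin := Adjoin (adjoin_base_subproof a).

End Adjoin.

Section Galois.
Variables (F E : fieldType) (k : F -> E).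

Definition gal_pred : {pred E -> E} := fun s =>
  `[< [/\ bijective s, {morph s : x y / x + y}, {morph s : x y / x * y} &
          forall a, s (k a) = k a] >].

Record gal := Gal { gal_fun :> E -> E; gal_funP : gal_fun \in gal_pred }.

HB.instance Definition _ := [isSub for gal_fun].
HB.instance Definition _ := [Choice of gal by <:].

Lemma galP (s : gal) : [/\ bijective s, {morph s : x y / x + y},
  {morph s : x y / x * y} & forall a, s (k a) = k a].
Proof. by have /asboolP := gal_funP s. Qed.

Lemma gal_eqP (s t : gal) : (forall x, s x = t x) -> s = t.
Proof. by move=> h; apply: val_inj; apply: funext => x; exact: h. Qed.

Lemma gal_one_subproof : id \in gal_pred.
Proof. by apply/asboolP; split => //; exists id. Qed.
Definition gal_one : gal := Gal gal_one_subproof.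

Lemma gal_mul_subproof (s t : gal) : s \o t \in gal_pred.
Proof.
have [bs sD sM sk] := galP s; have [bt tD tM tk] := galP t.
apply/asboolP; split => /=.
- exact: bij_comp.
- by move=> x y /=; rewrite tD sD.
- by move=> x y /=; rewrite tM sM.
- by move=> a; rewrite tk sk.
Qed.
Definition gal_mul (s t : gal) : gal := Gal (gal_mul_subproof s t).

Definition gal_inv_fun (s : gal) (y : E) : E := xget 0 [set x | s x = y].

Lemma gal_inv_funK (s : gal) : cancel s (gal_inv_fun s).
Proof.
move=> x; have [[g sg _] _ _ _] := galP s; rewrite /gal_inv_fun.
by case: xgetP => [z _ /(can_inj sg)//|h]; case: (h x).
Qed.

Lemma gal_inv_funKV (s : gal) : cancel (gal_inv_fun s) s.
Proof.
move=> y; have [[g _ gs] _ _ _] := galP s; rewrite /gal_inv_fun.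
by case: xgetP => [z _ //|h]; case: (h (g y)); rewrite /= gs.
Qed.

Lemma gal_inv_subproof (s : gal) : gal_inv_fun s \in gal_pred.
Proof.
have [bs sD sM sk] := galP s.
have K := gal_inv_funK s; have KV := gal_inv_funKV s.
apply/asboolP; split.
- by exists s.
- by move=> x y; apply: (can_inj K); rewrite sD !KV.
- by move=> x y; apply: (can_inj K); rewrite sM !KV.
- by move=> a; rewrite -{1}(sk a) K.
Qed.
Definition gal_inv (s : gal) : gal := Gal (gal_inv_subproof s).

Lemma gal_mulA : associative gal_mul.
Proof. by move=> s t u; apply: gal_eqP. Qed.
Lemma gal_mul1 : left_id gal_one gal_mul.
Proof. by move=> s; apply: gal_eqP. Qed.
Lemma gal_mulr1 : right_id gal_one gal_mul.
Proof. by move=> s; apply: gal_eqP. Qed.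
Lemma gal_mulV : left_inverse gal_one gal_inv gal_mul.
Proof. by move=> s; apply: gal_eqP => x /=; rewrite gal_inv_funK. Qed.
Lemma gal_mulrV : right_inverse gal_one gal_inv gal_mul.
Proof. by move=> s; apply: gal_eqP => x /=; rewrite gal_inv_funKV. Qed.

HB.instance Definition _ := isGroup.Build gal
  gal_mulA gal_mul1 gal_mulr1 gal_mulV gal_mulrV.

(* The Krull topology. *)
Definition krull_nbhs (s : gal) : set_system gal :=
  [set A | exists S : {fset E}, forall t : gal, (forall x, x \in S -> t x = s x) -> A t].

Lemma krull_nbhs_filter s : ProperFilter (krull_nbhs s).
Proof.
split; first by move=> [S]; apply.
split.
- by exists fset0.
- move=> A B [S hS] [T hT]; exists (S `|` T)%fset => t h; split.
    by apply: hS => x xS; apply: h; rewrite inE xS.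
  by apply: hT => x xT; apply: h; rewrite inE xT orbT.
- by move=> A B AB [S hS]; exists S => t /hS; exact: AB.
Qed.

Lemma krull_nbhs_singleton s A : krull_nbhs s A -> A s.
Proof. by move=> [S]; apply. Qed.

Lemma krull_nbhs_nbhs s A : krull_nbhs s A -> krull_nbhs s (krull_nbhs^~ A).
Proof.
move=> [S hS]; exists S => t ht; exists S => u hu; apply: hS => x xS.
by rewrite hu // ht.
Qed.

HB.instance Definition _ := hasNbhs.Build gal krull_nbhs.
HB.instance Definition _ := Nbhs_isNbhsTopological.Build gal
  krull_nbhs_filter krull_nbhs_singleton krull_nbhs_nbhs.

End Galois.

Section Torsion.
Variables (R : realType) (F O : fieldType) (v : nonarch_abs R F).
Variables (w : nonarch_abs R O) (j : {rmorphism F -> O}).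
Variables (pi : F) (br : F -> mps F 1).

(* f(x) = y *)
Definition mps_value (f : mps F 1) (x y : O) :=
  has_sum w (fun n : nat => j (coef1 f n) * x ^+ n) y.

Definition torsion : set O :=
  [set x | w x < 1 /\ exists n, mps_value (br (pi ^+ n)) x 0].

Definition Finfty := adjoin j torsion.
Definition Gamma := gal (@adjoin_base F O j torsion).

(* [ltc_act] characterizes chi; the other fields say that it is an isomorphism of
   topological groups from Gamma onto O_F^*. *)
Record lubin_tate_char (chi : Gamma -> F) : Prop := LubinTateChar {
  ltc_unit : forall s, v (chi s) = 1;
  ltc_act : forall s (t : Finfty), torsion t -> mps_value (br (chi s)) t (s t);
  ltc_mul : forall s t, chi (s * t)%g = chi s * chi t;
  ltc_inj : injective chi;
  ltc_surj : forall a, v a = 1 -> exists s, chi s = a;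
  ltc_cont : forall s eps, 0 < eps -> \forall t \near s, v (chi t - chi s) < eps;
  ltc_open : forall s (A : set Gamma), nbhs s A ->
    exists2 eps : R, 0 < eps & forall t, v (chi t - chi s) < eps -> A t }.

End Torsion.

Section Characters.
Variables (R : realType) (Qp : fieldType) (F : fieldExtType Qp) (L : fieldExtType F).
Variables (vF : nonarch_abs R F) (vL : nonarch_abs R L).

(* A character of F^* is a function on F whose value at 0 is irrelevant. *)
Record continuous_char (delta : F -> L) : Prop := ContinuousChar {
  char_neq0 : forall x, x != 0 -> delta x != 0;
  char_mul : forall x y, x != 0 -> y != 0 -> delta (x * y) = delta x * delta y;
  char_cont : forall x, x != 0 -> forall eps, 0 < eps ->
    exists2 d, 0 < d & forall y, y != 0 -> vF (y - x) < d ->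
      vL (delta y - delta x) < eps }.

Definition locally_analytic (delta : F -> L) := forall x, x != 0 ->
  exists2 d, 0 < d & exists a : nat -> L, forall y, y != 0 -> vF (y - x) < d ->
    has_sum vL (fun n : nat => a n * ((y - x)%:A) ^+ n) (delta y).

End Characters.

Section PhiGamma.
Variables (R : realType) (L : fieldType) (vL : complete_abs R L).
Variables (F E : fieldType) (k : F -> E).
Variables (phiR : robba vL -> robba vL) (actR : gal k -> robba vL -> robba vL).

Record pg_data := PgData {
  pg_mod :> lmodType (robba vL);
  pg_phi : pg_mod -> pg_mod;
  pg_act : gal k -> pg_mod -> pg_mod }.

Definition lin_comb (D : lmodType (robba vL)) (d : nat) (e : 'I_d -> D)
  (x : 'rV[robba vL]_d) : D := \sum_i x ord0 i *: e i.

(* [pg_free]: the module has a basis e_1, ..., e_d, sent to a basis by phi, and,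
   in the coordinates given by it, phi and the action map Gamma x D -> D are
   continuous. *)
Record phi_gamma_module (D : pg_data) : Prop := PhiGammaModule {
  pg_phiD : {morph @pg_phi D : x y / x + y};
  pg_phiZ : forall f x, @pg_phi D (f *: x) = phiR f *: pg_phi x;
  pg_actD : forall s, {morph @pg_act D s : x y / x + y};
  pg_actZ : forall s f x, @pg_act D s (f *: x) = actR s f *: pg_act s x;
  pg_act1 : forall x, @pg_act D 1%g x = x;
  pg_actM : forall s t x, @pg_act D (s * t)%g x = pg_act s (pg_act t x);
  pg_comm : forall s x, @pg_act D s (pg_phi x) = pg_phi (pg_act s x);
  pg_free : exists d (e : 'I_d -> D) (co : D -> 'rV[robba vL]_d),
    [/\ cancel (lin_comb e) co, cancel co (lin_comb e),
        bijective (lin_comb (fun i => pg_phi (e i))),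
        continuous (fun x => co (pg_phi (lin_comb e x))) &
        continuous (fun z : gal k * 'rV[robba vL]_d =>
          co (pg_act z.1 (lin_comb e z.2)))] }.

Definition pg_morphism (D D' : pg_data) (f : {linear D -> D'}) :=
  (forall x, f (pg_phi x) = pg_phi (f x)) /\
  (forall s x, f (pg_act s x) = pg_act s (f x)).

(* R_L(delta) = R_L e_delta for delta(pi) = c and delta o chi = d; an element
   f e_delta is represented by f. *)
Definition pg_twist (c : L) (d : gal k -> L) : pg_data :=
  @PgData (robba vL)^o (fun f : robba vL => c *: phiR f)
          (fun s (f : robba vL) => d s *: actR s f).

Definition pg_unit : pg_data := @PgData (robba vL)^o phiR actR.

(* 0 -> D' -> D -> D'' -> 0 is exact. *)
Definition pg_exact (D' D D'' : pg_data)
    (i : {linear D' -> D}) (q : {linear D -> D''}) :=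
  [/\ injective i, (forall y, exists x, q x = y) &
      forall x, q x = 0 <-> exists y, i y = x].

Definition pg_extension (D' D D'' : pg_data)
    (i : {linear D' -> D}) (q : {linear D -> D''}) :=
  [/\ phi_gamma_module D, pg_morphism i, pg_morphism q & pg_exact i q].

Definition pg_split (D D'' : pg_data) (q : {linear D -> D''}) :=
  exists s : {linear D'' -> D}, pg_morphism s /\ cancel s q.

(* The semigroup phi^N x Gamma, (m, s) standing for phi^m s, and its action. *)
Definition sg_mul (g h : nat * gal k) : nat * gal k :=
  ((g.1 + h.1)%N, (g.2 * h.2)%g).

Definition sg_act (D : pg_data) (g : nat * gal k) (x : D) : D :=
  iter g.1 (@pg_phi D) (pg_act g.2 x).

Section Cohomology.
Variables (c : L) (d : gal k -> L).

Let act (g : nat * gal k) (f : robba vL) : robba vL := @sg_act (pg_twist c d) g f.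

(* Continuous inhomogeneous 1-cocycles and 1-coboundaries of R_L(delta). *)
Definition Z1 : set (nat * gal k -> robba vL) :=
  [set z : nat * gal k -> robba vL | continuous z /\
     forall g h, z (sg_mul g h) = z g + act g (z h)].

Definition B1 : set (nat * gal k -> robba vL) :=
  [set z : nat * gal k -> robba vL | exists f, forall g, z g = act g f - f].

(* Z^1 / B^1 = 0. *)
Definition H1_eq0 := Z1 `<=` B1.

End Cohomology.
End PhiGamma.

Section RobbaOperators.
Variables (R : realType) (Qp : fieldType) (F : fieldExtType Qp) (L : fieldExtType F).
Variables (vL : complete_abs R L).

(* A power series in u over F, as an element of R_L. *)
Definition robba_mps (f : mps F 1) : robba vL :=
  robba_of vL (fun i : int => if i is Posz n then (coef1 f n)%:A else 0).

(* With h = [pi] this is phi_q, with h = [a] it is sigma_a. *)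
Definition robba_comp (h : mps F 1) (f : robba vL) : robba vL :=
  robba_subst (robba_mps h) f.

End RobbaOperators.
Arguments robba_comp {R Qp F L} vL h f.

(* Qp, with the absolute value v, is the completion of the rational numbers for
   the p-adic absolute value. *)
Record padic_numbers (R : realType) (p : nat) (Qp : fieldType)
    (v : complete_abs R Qp) : Prop := PadicNumbers {
  padic_prime : prime p;
  padic_norm : forall n : nat, (0 < n)%N -> v n%:R = p%:R ^- logn p n;
  padic_dense : forall x eps, 0 < eps -> exists r : rat, v (x - ratr r) < eps }.

(* Main.v *)
Require Import Defs.
From HB Require Import structures.
From mathcomp Require Import all_boot all_order all_algebra all_field.
From mathcomp Require Import finmap all_classical all_reals topology ring lra zify.

Set Implicit Arguments.
Unset Strict Implicit.
Unset Printing Implicit Defensive.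

Import Order.TTheory GRing.Theory Num.Theory.
Local Open Scope classical_set_scope.
Local Open Scope ring_scope.

(* If a = chi(gamma) is close to 1 and z is a 1-cocycle, then
     y_m(a) = z(gamma^(p^m)) / (a^(p^m) - 1)
   converges in the Robba ring, because gamma^(p^m) - 1 has norm O(p^-m) on each
   circle |u| = s < 1: up to the factor log a, the limit y(a) is the derivative of
   z at 1 in the direction of a.  All elements commute, so (g - 1) y(a) is the
   limit of (gamma^(p^m) - 1) / (a^(p^m) - 1) applied to z(g), which is
   nabla z(g) + W(a) z(g), where nabla does not depend on a since the action of
   Gamma on R_L is F-analytic, and W(a) = log delta(a) / log a.  Hence
     (g - 1) (y(a) - y(b)) = (W(a) - W(b)) z(g),
   and z is a coboundary as soon as W(a) <> W(b) for some a, b.  If W were constant,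
   equal to k near 1, then delta(1 + z) = (1 + z)^k would be locally analytic. *)

(** The logarithms and the operator nabla are never constructed. [ppow_ratio] stands in for log
    delta(a) / log a, and [sigma_quotients_close] says only that the quotients for a and b differ by
    a sequence tending to 0, which is all that y(a) - y(b) sees. The bound O(p^-m) comes from the
    congruence [pi](X) = X^q mod pi. On a circle |u| = s < 1, iterating [pi] first brings the series
    below |pi|, and from then on each iteration gains a factor |pi|. The constant depends on s, so
    convergence is stated circle by circle over a common inner radius. The working ball is |x - 1|
    <= p^-2, where |x^p - 1| = p^-1 |x - 1| for every prime p; the radius p^-1 would fail, as x = -1
    shows for p = 2. *)

Lemma bernoulli (R : realFieldType) (x : R) n : 0 <= x -> 1 + n%:R * x <= (1 + x) ^+ n.
Proof.
move=> x0; elim: n => [|n IH]; first by rewrite mul0r addr0 expr0.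
rewrite exprS -natr1; apply: le_trans (ler_wpM2l _ IH); last by lra.
have : 0 <= n%:R * (x * x) by rewrite mulr_ge0 ?ler0n ?mulr_ge0.
nra.
Qed.

Lemma expr_small (R : realType) (th eps : R) : 0 <= th -> th < 1 -> 0 < eps ->
  exists N, forall n, (N <= n)%N -> th ^+ n < eps.
Proof.
move=> t0 t1 e0; have [->|tn0] := eqVneq th 0.
  by exists 1%N => -[//|n] _; rewrite exprS mul0r.
have tp : 0 < th by rewrite lt_def tn0.
have x0 : 0 < th^-1 - 1 by rewrite subr_gt0 invf_gt1.
exists (Num.truncn (eps * (th^-1 - 1))^-1).+1 => n Nn.
have h1 : (eps * (th^-1 - 1))^-1 < n%:R.
  by apply: lt_le_trans (truncnS_gt _) _; rewrite ler_nat.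
have h2 : 1 < n%:R * (eps * (th^-1 - 1)).
  by rewrite -ltr_pdivrMr ?mulr_gt0 // div1r.
have := bernoulli n (ltW x0).
have -> : 1 + (th^-1 - 1) = th^-1 by ring.
rewrite exprVn => h3.
rewrite -[th ^+ n]invrK invf_plt ?posrE ?invr_gt0 ?exprn_gt0 //.
apply: lt_le_trans h3; rewrite -[ltLHS]mulr1.
rewrite -(ltr_pM2l e0) mulrA divff ?gt_eqF // mul1r; lra.
Qed.

(** * Nonarchimedean absolute values and limits of sequences *)

Section Nonarchimedean.
Variables (R : realType) (K : fieldType) (v : nonarch_abs R K).

Lemma nabsX x n : v (x ^+ n) = v x ^+ n.
Proof. by elim: n => [|n IH]; rewrite ?expr0 ?nabs1 // !exprS nabsM IH. Qed.

Lemma nabsV x : v x^-1 = (v x)^-1.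
Proof.
case: (eqVneq x 0) => [->|x0]; first by rewrite invr0 nabs0 invr0.
have vx0 : v x != 0 by rewrite nabs_eq0.
by apply: (mulfI vx0); rewrite -nabsM !divff // nabs1.
Qed.

Lemma nabs_gt0 x : x != 0 -> 0 < v x.
Proof. by rewrite lt_def nabs_ge0 andbT nabs_eq0. Qed.

Lemma nabs_nat n : v n%:R <= 1.
Proof.
elim: n => [|n IH]; first by rewrite nabs0 ler01.
by rewrite -natr1; apply: nabs_leD => //; rewrite nabs1.
Qed.

Lemma nabs_int (i : int) : v i%:~R <= 1.
Proof.
by case: i => n; rewrite ?NegzE ?mulrNz ?nabsN -pmulrn nabs_nat.
Qed.

Lemma nabsB_sym x y : v (x - y) = v (y - x).
Proof. by rewrite -opprB nabsN. Qed.

Lemma nabs_leB x y M : v x <= M -> v y <= M -> v (x - y) <= M.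
Proof. by move=> hx hy; apply: nabs_leD => //; rewrite nabsN. Qed.

Lemma nabs_dom x y : v y < v x -> v (x + y) = v x.
Proof.
move=> h; apply/eqP; rewrite eq_le nabs_leD //=; last exact: ltW.
rewrite leNgt; apply/negP => h2.
have := nabs_ltB h2 h; by rewrite addrK ltxx.
Qed.

Lemma nabs_near1 x : v (x - 1) < 1 -> v x = 1.
Proof. by move=> h; rewrite -[x](subrK 1) addrC nabs_dom ?nabs1. Qed.

Lemma nabs_exp_sub1 x n : v (x - 1) <= 1 -> v (x ^+ n - 1) <= v (x - 1).
Proof.
move=> h; have vx : v x <= 1.
  by rewrite -[x](subrK 1); apply: nabs_leD; rewrite ?nabs1.
rewrite subrX1 nabsM ler_piMr ?nabs_ge0 //.
by apply: nabs_sum_le => // i _; rewrite nabsX exprn_ile1 // nabs_ge0.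
Qed.

Lemma nabs_cvg_unique s l l' : nabs_cvg v s l -> nabs_cvg v s l' -> l = l'.
Proof.
move=> h h'; apply/eqP; rewrite -subr_eq0; apply/eqP.
apply: (@nabs_small _ _ v) => e e0.
have [N hN] := h _ e0; have [N' hN'] := h' _ e0.
have -> : l - l' = (s (maxn N N') - l') - (s (maxn N N') - l) by ring.
by apply: nabs_ltB; [apply: hN'|apply: hN]; rewrite ?leq_maxl ?leq_maxr.
Qed.

Lemma nabs_cvgD s t l m : nabs_cvg v s l -> nabs_cvg v t m ->
  nabs_cvg v (fun n => s n + t n) (l + m).
Proof.
move=> hs ht e e0; have [N hN] := hs _ e0; have [N' hN'] := ht _ e0.
exists (maxn N N') => n; rewrite geq_max => /andP[h h'].
by rewrite opprD addrACA; apply: nabs_ltD; [exact: hN|exact: hN'].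
Qed.

Lemma nabs_cvgZ s l c : nabs_cvg v s l -> nabs_cvg v (fun n => c * s n) (c * l).
Proof.
move=> hs e e0; have c0 := nabs_ge0 v c.
have [N hN] := hs (e / (v c + 1)) ltac:(apply: divr_gt0 => //; lra).
exists N => n /hN; rewrite -mulrBr nabsM ltr_pdivlMr; last by lra.
have := nabs_ge0 v (s n - l); nra.
Qed.

Lemma nabs_cvgB s t l m : nabs_cvg v s l -> nabs_cvg v t m ->
  nabs_cvg v (fun n => s n - t n) (l - m).
Proof.
move=> hs ht; have := nabs_cvgD hs (nabs_cvgZ (-1) ht).
rewrite mulN1r; by congr nabs_cvg; apply: funext => n; rewrite mulN1r.
Qed.

Lemma eq_has_sum (I : choiceType) (f g : I -> K) l m :
  (forall i, f i = g i) -> l = m -> has_sum v f l -> has_sum v g m.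
Proof. by move=> /funext -> ->. Qed.

End Nonarchimedean.

(** By the ultrametric inequality a telescoping sum is no larger than its largest term, so
    consecutive differences control all of them. *)
Lemma nabs_cauchyS (R : realType) (K : fieldType) (v : nonarch_abs R K)
    (s : nat -> K) :
  (forall eps, 0 < eps -> exists N, forall n, (N <= n)%N -> v (s n.+1 - s n) < eps) ->
  nabs_cauchy v s.
Proof.
move=> h eps e0; have [N hN] := h _ e0; exists N.
suff aux n : (N <= n)%N -> v (s n - s N) < eps.
  move=> m n Nm Nn; have -> : s m - s n = (s m - s N) - (s n - s N) by ring.
  by apply: nabs_ltB; apply: aux.
elim: n => [|n IH]; first by rewrite leqn0 => /eqP ->; rewrite subrr nabs0.
rewrite leq_eqVlt => /orP[/eqP ->|]; first by rewrite subrr nabs0.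
rewrite ltnS => Nn; rewrite -[s n.+1](subrK (s n)) -addrA.
by apply: nabs_ltD; [exact: hN|exact: IH].
Qed.

(** * The Robba ring: bounds on circles *)

Section CircleBounds.
Variables (R : realType) (K : fieldType) (v : complete_abs R K).
Implicit Types (f g : robba v) (s rho M : R).

(* |f|_s <= M for the supremum norm on the circle |u| = s; bounds are used instead
   of the norm itself, which may be infinite. *)
Definition circle_le s f M := forall i : int, v (f i) * s ^ i <= M.

Lemma robbaN f i : (- f) i = - f i. Proof. by []. Qed.
Lemma robbaB f g i : (f - g) i = f i - g i. Proof. by []. Qed.
Lemma robbaZ c f i : (c *: f) i = c * f i. Proof. by []. Qed.
Lemma robba1 i : (1 : robba v) i = (i == 0)%:R. Proof. by []. Qed.

Lemma circle_le_ge0 s f M : circle_le s f M -> 0 <= M.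
Proof. by move=> /(_ 0); rewrite expr0z mulr1; apply: le_trans; exact: nabs_ge0. Qed.

Lemma circle_leW s f M N : M <= N -> circle_le s f M -> circle_le s f N.
Proof. by move=> MN h i; apply: le_trans MN. Qed.

Lemma circle_le0 s : circle_le s 0 0.
Proof. by move=> i; rewrite robba0 nabs0 mul0r. Qed.

Lemma circle_leD s f g M : 0 < s -> circle_le s f M -> circle_le s g M ->
  circle_le s (f + g) M.
Proof.
move=> s0 hf hg i; have si : 0 < s ^ i by apply: exprz_gt0.
rewrite -ler_pdivlMr // robbaD; by apply: nabs_leD; rewrite ler_pdivlMr.
Qed.

Lemma circle_leN s f M : circle_le s f M -> circle_le s (- f) M.
Proof. by move=> h i; rewrite robbaN nabsN. Qed.

Lemma circle_leB s f g M : 0 < s -> circle_le s f M -> circle_le s g M ->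
  circle_le s (f - g) M.
Proof. by move=> s0 hf hg; apply: circle_leD => //; apply: circle_leN. Qed.

Lemma circle_leZ s c f M : circle_le s f M -> circle_le s (c *: f) (v c * M).
Proof. by move=> h i; rewrite robbaZ nabsM -mulrA ler_wpM2l ?nabs_ge0. Qed.

Lemma circle_le_sum s (I : Type) (r : seq I) (P : pred I) (F : I -> robba v) M :
  0 < s -> 0 <= M -> (forall k, P k -> circle_le s (F k) M) ->
  circle_le s (\sum_(k <- r | P k) F k) M.
Proof.
move=> s0 M0 h; elim/big_rec: _ => [|k f Pk hf].
  exact: circle_leW M0 (circle_le0 s).
by apply: circle_leD => //; apply: h.
Qed.

(** The weight s^n splits as s^i s^(n-i) along the convolution, so each product is bounded factor by
    factor, and an infinite ultrametric sum obeys the bound of its terms. *)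
Lemma circle_leM s f g M N : 0 < s -> circle_le s f M -> circle_le s g N ->
  circle_le s (f * g) (M * N).
Proof.
move=> s0 hf hg n; have sn : 0 < s ^ n by apply: exprz_gt0.
have M0 := circle_le_ge0 hf; have N0 := circle_le_ge0 hg.
rewrite -ler_pdivlMr //.
apply: has_sum_le (has_laurent_mul f g n); first by rewrite divr_ge0 ?mulr_ge0 // ltW.
move=> i; rewrite (abs_conv v f g n i s0) -invr_expz [leRHS]mulrC.
apply: ler_wpM2l; first by rewrite invr_ge0 ltW.
by apply: ler_pM => //; exact: wt_ge0.
Qed.

Lemma circle_le1 s : circle_le s 1 1.
Proof.
move=> i; rewrite robba1; case: eqVneq => [->|_].
  by rewrite nabs1 mul1r expr0z.
by rewrite nabs0 mul0r ler01.
Qed.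

Lemma circle_leX s f M n : 0 < s -> circle_le s f M -> circle_le s (f ^+ n) (M ^+ n).
Proof.
move=> s0 h; elim: n => [|n IH]; first by rewrite !expr0; exact: circle_le1.
by rewrite !exprS; exact: circle_leM.
Qed.

Lemma circle_le_ex s rho f : 0 < rho -> rho <= s -> s < 1 -> conv_from v rho f ->
  exists2 M, 0 < M & circle_le s f M.
Proof.
by move=> r0 rs s1 hf; have [M M0 hM] := nullfam_bounded (hf _ rs s1); exists M.
Qed.

Lemma circle_le_eq0 s f : 0 < s -> (forall eps, 0 < eps -> circle_le s f eps) -> f = 0.
Proof.
move=> s0 h; apply: robba_eqP => i; rewrite robba0.
have si : 0 < s ^ i by apply: exprz_gt0.
apply: (@nabs_small _ _ v) => eps e0.
have := h (eps * s ^ i / 2) ltac:(by rewrite divr_gt0 // mulr_gt0) i.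
by rewrite mulrAC ler_pM2r // => /le_lt_trans; apply; lra.
Qed.

(** All rows [F i] but finitely many are uniformly small, and the remaining ones decay in n; the two
    together give the decay of the sum. This is how products and substitutions are shown to
    converge. *)
Lemma nullfam_has_sum s (I : choiceType) (F : I -> int -> K) (M : I -> R)
    (c : int -> K) : 0 < s ->
  (forall i n, v (F i n) * s ^ n <= M i) -> nullfam M ->
  (forall i, nullfam (fun n => v (F i n) * s ^ n)) ->
  (forall n, has_sum v (F^~ n) (c n)) -> nullfam (fun n => v (c n) * s ^ n).
Proof.
move=> s0 FM nM nF hc eps e0.
have e2 : 0 < eps / 2 by lra.
have [A hA] := nM _ e2.
have /choice [B hB] : forall i, exists B : {fset int}, forall n, n \notin B ->
   v (F i n) * s ^ n < eps / 2 by move=> i; exact: nF.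
exists (\bigcup_(i <- A) B i)%fset => n nB.
have sn : 0 < s ^ n by apply: exprz_gt0.
apply: (@le_lt_trans _ _ (eps / 2)); last by lra.
rewrite -ler_pdivlMr //; apply: has_sum_le (hc n); first by rewrite divr_ge0 // ltW.
move=> i; rewrite ler_pdivlMr //; case: (boolP (i \in A)) => iA.
  apply: ltW; apply: hB; apply: contraNN nB => nBi.
  by apply/bigfcupP; exists i; rewrite ?iA.
by apply: le_trans (FM _ _) _; apply: ltW; exact: hA.
Qed.

Lemma conv_fromM rho f g : 0 < rho -> conv_from v rho f -> conv_from v rho g ->
  conv_from v rho (f * g).
Proof.
move=> r0 hf hg s rs s1; have s0 : 0 < s by exact: lt_le_trans rs.
have [N N0 hN] := circle_le_ex r0 rs s1 hg.
have bd i n : v (f i * g (n - i)) * s ^ n =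
    v (f i) * s ^ i * (v (g (n - i)) * s ^ (n - i)).
  rewrite (abs_conv v f g n i s0) -invr_expz mulrC mulVKf //.
  by rewrite gt_eqF ?exprz_gt0.
apply: (@nullfam_has_sum _ _ (fun i n => f i * g (n - i))
  (fun i => N * (v (f i) * s ^ i))) => //.
- by move=> i n; rewrite bd [leRHS]mulrC ler_wpM2l ?wt_ge0.
- exact: nullfam_scale (ltW N0) (hf _ rs s1).
- move=> i.
  have hinj : injective (fun n : int => n - i) by move=> m n; exact: addIr.
  have := nullfam_scale (wt_ge0 v f i s0) (nullfam_comp hinj (hg _ rs s1)).
  by congr nullfam; apply: funext => n; rewrite bd.
- exact: has_laurent_mul.
Qed.

Lemma conv_from0 rho : conv_from v rho (0 : robba v).
Proof. by move=> s _ _ eps e0; exists fset0 => i _; rewrite robba0 nabs0 mul0r. Qed.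

Lemma conv_from_finsupp rho (A : {fset int}) (a : int -> K) :
  (forall i, i \notin A -> a i = 0) -> conv_from v rho a.
Proof.
by move=> h s _ _ eps e0; exists A => i /h ->; rewrite nabs0 mul0r.
Qed.

Lemma conv_from1 rho : conv_from v rho (1 : robba v).
Proof.
apply: (@conv_from_finsupp _ [fset 0%R]%fset) => i.
by rewrite inE robba1 => /negbTE ->.
Qed.

Lemma conv_fromN rho f : 0 < rho -> conv_from v rho f -> conv_from v rho (- f).
Proof.
move=> r0 hf; have := conv_fromZ (-1) hf.
by congr conv_from; apply: funext => i; rewrite mulN1r.
Qed.

Lemma conv_fromB rho f g : 0 < rho -> conv_from v rho f -> conv_from v rho g ->
  conv_from v rho (f - g).
Proof. by move=> r0 hf hg; apply: (conv_fromD r0 hf); exact: conv_fromN. Qed.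

Lemma conv_from_sum rho (I : Type) (r : seq I) (P : pred I) (F : I -> robba v) :
  0 < rho -> (forall k, P k -> conv_from v rho (F k)) ->
  conv_from v rho (\sum_(k <- r | P k) F k).
Proof.
move=> r0 h; elim/big_rec: _ => [|k f Pk hf]; first exact: conv_from0.
by apply: (conv_fromD r0 _ hf); exact: h.
Qed.

Lemma conv_fromX rho f n : 0 < rho -> conv_from v rho f -> conv_from v rho (f ^+ n).
Proof.
move=> r0 hf; elim: n => [|n IH]; first by rewrite expr0; exact: conv_from1.
by rewrite exprS; exact: conv_fromM.
Qed.

Lemma robba_scaleAl c f g : (c *: f) * g = c *: (f * g).
Proof.
apply: robba_mulP => n; rewrite robbaZ.
have := has_sumZ c (has_laurent_mul f g n).
by congr has_sum; apply: funext => i; rewrite robbaZ mulrA.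
Qed.

Lemma robba_scaleAr c f g : f * (c *: g) = c *: (f * g).
Proof. by rewrite mulrC robba_scaleAl mulrC. Qed.

(** Convergence in the Fréchet space of series on rho <= |u| < 1: the rank N may depend on the
    circle, while the radius is common to all terms and to the limit. *)
Definition robba_cvg rho (y : nat -> robba v) f :=
  [/\ forall n, conv_from v rho (y n), conv_from v rho f &
      forall s eps, rho <= s -> s < 1 -> 0 < eps ->
        exists N, forall n, (N <= n)%N -> circle_le s (y n - f) eps].

Lemma robba_complete rho (y : nat -> robba v) : 0 < rho -> rho < 1 ->
  (forall n, conv_from v rho (y n)) ->
  (forall s eps, rho <= s -> s < 1 -> 0 < eps ->
    exists N, forall n, (N <= n)%N -> circle_le s (y n.+1 - y n) eps) ->
  exists f, robba_cvg rho y f.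
Proof.
move=> r0 r1 hy hc.
have hl i : exists l, nabs_cvg v (fun n => y n i) l.
  apply: cabs_complete; apply: nabs_cauchyS => eps e0.
  have ri : 0 < rho ^ i by apply: exprz_gt0.
  have [N hN] := hc rho (eps * rho ^ i / 2) (lexx _) r1
    ltac:(by rewrite divr_gt0 // mulr_gt0).
  exists N => n /hN /(_ i); rewrite robbaB mulrAC ler_pM2r // => /le_lt_trans.
  by apply; lra.
have {hl} /choice [a ha] := hl.
have key s eps : rho <= s -> s < 1 -> 0 < eps -> exists N, forall n, (N <= n)%N ->
    forall i, v (y n i - a i) * s ^ i <= eps.
  move=> rs s1 e0; have s0 : 0 < s by exact: lt_le_trans rs.
  have [N hN] := hc _ _ rs s1 e0; exists N => n Nn i.
  (* The bound on consecutive terms telescopes without loss in k, hence passes to the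
     coefficientwise limit. *)
  have aux k : circle_le s (y (n + k)%N - y n) eps.
    elim: k => [|k IH].
      by rewrite addn0 subrr; apply: circle_leW (ltW e0) (circle_le0 _).
    rewrite addnS -[y _](subrK (y (n + k)%N)) -addrA; apply: circle_leD => //.
    by apply: hN; exact: leq_trans (leq_addr _ _).
  have si : 0 < s ^ i by apply: exprz_gt0.
  rewrite -ler_pdivlMr //.
  have [N' hN'] := ha i (eps / s ^ i) ltac:(by rewrite divr_gt0).
  have -> : y n i - a i = (y (n + N')%N i - a i) - (y (n + N')%N i - y n i) by ring.
  apply: nabs_leB; first by apply: ltW; apply: hN'; exact: leq_addl.
  by rewrite ler_pdivlMr //; apply: aux.
have ca : conv_from v rho a.
  move=> s rs s1 eps e0; have s0 : 0 < s by exact: lt_le_trans rs.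
  have e2 : 0 < eps / 2 by lra.
  have [N hN] := key _ _ rs s1 e2.
  have [A hA] := hy N s rs s1 _ e0; exists A => i iA.
  have si : 0 < s ^ i by apply: exprz_gt0.
  rewrite -ltr_pdivlMr //.
  have -> : a i = y N i - (y N i - a i) by ring.
  apply: nabs_ltB; rewrite ltr_pdivlMr //; first exact: hA.
  by apply: le_lt_trans (hN N (leqnn _) i) _; lra.
have aR : a \in robba_pred v by apply/robbaP; exists rho.
by exists (Robba aR); split.
Qed.

Lemma robba_cvg_coef rho (y : nat -> robba v) f i : 0 < rho -> rho < 1 ->
  robba_cvg rho y f -> nabs_cvg v (fun n => y n i) (f i).
Proof.
move=> r0 r1 [_ _ h] eps e0; have ri : 0 < rho ^ i by apply: exprz_gt0.
have [N hN] := h rho (eps * rho ^ i / 2) (lexx _) r1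
    ltac:(by rewrite divr_gt0 // mulr_gt0).
exists N => n /hN /(_ i); rewrite robbaB mulrAC ler_pM2r // => /le_lt_trans.
by apply; lra.
Qed.

Lemma robba_cvgB rho y z f g : 0 < rho -> robba_cvg rho y f -> robba_cvg rho z g ->
  robba_cvg rho (fun n => y n - z n) (f - g).
Proof.
move=> r0 [y1 y2 y3] [z1 z2 z3]; split.
- by move=> n; apply: conv_fromB.
- exact: conv_fromB.
- move=> s eps rs s1 e0; have s0 : 0 < s by exact: lt_le_trans rs.
  have [N hN] := y3 s eps rs s1 e0; have [N' hN'] := z3 s eps rs s1 e0.
  exists (maxn N N') => n; rewrite geq_max => /andP[h h'].
  have -> : y n - z n - (f - g) = (y n - f) - (z n - g) by ring.
  by apply: circle_leB => //; [exact: hN|exact: hN'].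
Qed.

Lemma robba_cvg_le rho rho' y f : rho <= rho' -> robba_cvg rho y f -> robba_cvg rho' y f.
Proof.
move=> rr [y1 y2 y3]; split.
- by move=> n; exact: conv_from_le rr (y1 n).
- exact: conv_from_le rr y2.
- by move=> s eps rs; apply: y3; exact: le_trans rs.
Qed.

End CircleBounds.

(** * Monomials, and integer powers of series close to 1 *)

Section Monomials.
Variables (R : realType) (K : fieldType) (v : complete_abs R K).
Implicit Types (f g eps : robba v) (s rho M th : R).

Lemma mono_subproof (k : int) : (fun i : int => ((i == k)%:R : K)) \in robba_pred v.
Proof.
apply/robbaP; exists (1/2); split; [lra|lra|].
by apply: (@conv_from_finsupp _ _ _ _ [fset k]%fset) => i; rewrite inE => /negbTE ->.
Qed.
Definition mono (k : int) : robba v := Robba (mono_subproof k).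

Lemma monoE k i : mono k i = (i == k)%:R. Proof. by []. Qed.

Lemma monoM_coef k f n : (mono k * f) n = f (n - k).
Proof.
apply: nsumE; rewrite -[f (n - k)]mul1r.
have -> : (1 : K) = mono k k by rewrite monoE eqxx.
apply: (@has_sum1 _ _ _ _ k (fun i => mono k i * f (n - i))) => i /negbTE ik.
by rewrite monoE ik mul0r.
Qed.

Lemma mono0 : mono 0 = 1.
Proof. by apply: robba_eqP. Qed.

Lemma monoM k l : mono k * mono l = mono (k + l).
Proof.
by apply: robba_eqP => n; rewrite monoM_coef !monoE subr_eq addrC.
Qed.

Lemma monoVx k : mono k * mono (- k) = 1.
Proof. by rewrite monoM subrr mono0. Qed.

Lemma mono_unit k : mono k \is a GRing.unit.
Proof. by apply/unitrP; exists (mono (- k)); rewrite mulrC monoVx. Qed.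

Lemma monoX k n : mono k ^+ n = mono (k * n%:Z).
Proof.
elim: n => [|n IH]; first by rewrite expr0 mulr0 mono0.
by rewrite exprS IH monoM; congr mono; lia.
Qed.

Lemma monoXz k (i : int) : mono k ^ i = mono (k * i).
Proof.
case: i => n; first exact: monoX.
rewrite NegzE -invr_expz -exprnP monoX mulrN.
by apply: mulr1_eq; rewrite monoVx.
Qed.

Lemma conv_from_mono rho k : conv_from v rho (mono k).
Proof.
by apply: (@conv_from_finsupp _ _ _ _ [fset k]%fset) => i; rewrite inE monoE => /negbTE ->.
Qed.

Lemma circle_le_mono s k : 0 < s -> circle_le s (mono k) (s ^ k).
Proof.
move=> s0 i; rewrite monoE; case: eqVneq => [->|_]; first by rewrite nabs1 mul1r.
by rewrite nabs0 mul0r exprz_ge0 // ltW.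
Qed.

Lemma circle_le_monoM s k f M : 0 < s -> circle_le s f M ->
  circle_le s (mono k * f) (s ^ k * M).
Proof. by move=> s0; apply: circle_leM => //; exact: circle_le_mono. Qed.

(** The geometric series converges on each circle separately; the ratio [th] may approach 1 together
    with s, as it does for eps = u. *)
Lemma geometric_inverse rho eps : 0 < rho -> rho < 1 -> conv_from v rho eps ->
  (forall s, rho <= s -> s < 1 -> exists2 th, th < 1 & circle_le s eps th) ->
  exists2 g : robba v, conv_from v rho g & (1 + eps) * g = 1.
Proof.
move=> r0 r1 he hth.
pose y n := \sum_(k < n) (- eps) ^+ k.
have hy n : conv_from v rho (y n).
  by apply: conv_from_sum => // k _; apply: conv_fromX => //; apply: conv_fromN.
have [|g [_ hg hc]] := @robba_complete _ _ v rho y r0 r1 hy.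
  move=> s e rs s1 e0; have s0 : 0 < s by exact: lt_le_trans rs.
  have [th th1 hs] := hth _ rs s1.
  have [N hN] := expr_small (circle_le_ge0 hs) th1 e0.
  exists N => n /hN /ltW h.
  have -> : y n.+1 - y n = (- eps) ^+ n by rewrite /y big_ord_recr /= addrAC subrr add0r.
  by apply: circle_leW h _; apply: circle_leX => //; apply: circle_leN.
exists g => //; apply/eqP; rewrite -subr_eq0; apply/eqP.
have [th th1 hs] := hth rho (lexx _) r1.
apply: (@circle_le_eq0 _ _ _ rho) => // e e0.
have [N hN] := hc _ _ (lexx _) r1 e0.
have [N' hN'] := expr_small (circle_le_ge0 hs) th1 e0.
pose n := maxn N N'.
have e1 : (1 + eps) * y n - 1 = - (- eps) ^+ n.
  have e2 := subrX1 (- eps) n; rewrite -/(y n) in e2.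
  have -> : (- eps) ^+ n = 1 + (- eps - 1) * y n by rewrite -e2; ring.
  by ring.
have -> : (1 + eps) * g - 1 = - (- eps) ^+ n - (1 + eps) * (y n - g).
  by rewrite -e1; ring.
apply: circle_leB => //.
  apply: circle_leN; apply: (@circle_leW _ _ _ _ _ (th ^+ n)).
    by apply: ltW; apply: hN'; exact: leq_maxr.
  by apply: circle_leX => //; apply: circle_leN.
rewrite -[e]mul1r; apply: circle_leM => //; last by apply: hN; exact: leq_maxl.
apply: circle_leD => //; first exact: circle_le1.
exact: circle_leW (ltW th1) hs.
Qed.

(** Substituting g = 1 - eps g turns a bound M into max(1, th M); iterating until th^n M <= 1 leaves
    the bound 1. *)
Lemma circle_le_inv1D s eps g th M : 0 < s -> circle_le s eps th -> th < 1 ->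
  (1 + eps) * g = 1 -> circle_le s g M -> circle_le s g 1.
Proof.
move=> s0 he th1 hg hM; have th0 := circle_le_ge0 he; have M0 := circle_le_ge0 hM.
have aux n : circle_le s g (Num.max 1 (th ^+ n * M)).
  elim: n => [|n IH]; first by rewrite expr0 mul1r; apply: circle_leW hM; rewrite le_max lexx orbT.
  have -> : g = 1 - eps * g.
    by rewrite -hg; ring.
  apply: circle_leB => //.
    by apply: circle_leW (@circle_le1 _ _ v s); rewrite le_max lexx.
  apply: circle_leW (circle_leM s0 he IH).
  rewrite exprS -mulrA !maxr_pMr // ge_max le_max mulr1 (ltW th1) /=.
  by rewrite le_max lexx orbT.
have [N hN] := expr_small th0 th1 (eps := (M + 1)^-1) ltac:(rewrite invr_gt0; lra).
apply: circle_leW (aux N); rewrite ge_max lexx /=.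
have := ltW (hN N (leqnn _)).
rewrite -div1r ler_pdivlMr; last by lra.
have := exprn_ge0 N th0; nra.
Qed.

(** The expansion 1 + i eps + O(eps^2) is uniform in i because multiplying or dividing by 1 + eps,
    one step at a time, creates only errors already below th^2. With 1 + eps = [a](u)/u it describes
    sigma_a on u^i to first order. *)
Lemma circle_le_expz1D s eps g th M : 0 < s -> circle_le s eps th -> th < 1 ->
  (1 + eps) * g = 1 -> circle_le s g M -> forall i : int,
  [/\ circle_le s ((1 + eps) ^ i) 1, circle_le s ((1 + eps) ^ i - 1) th &
      circle_le s ((1 + eps) ^ i - 1 - (i%:~R : K) *: eps) (th * th)].
Proof.
move=> s0 he th1 hg hM.
have hg1 := circle_le_inv1D s0 he th1 hg hM.
have th0 := circle_le_ge0 he.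
have h1e : circle_le s (1 + eps) 1.
  by apply: circle_leD => //; [exact: circle_le1|exact: circle_leW (ltW th1) he].
have hX n : circle_le s ((1 + eps) ^+ n) 1 by have := circle_leX n s0 h1e; rewrite expr1n.
have hN n : circle_le s ((1 + eps) ^ (- n%:Z)) 1.
  rewrite -invr_expz -exprnP -exprVn (mulr1_eq hg).
  by have := circle_leX n s0 hg1; rewrite expr1n.
suff H (i : int) : circle_le s ((1 + eps) ^ i) 1 ->
    circle_le s ((1 + eps) ^ i - 1) th /\
    circle_le s ((1 + eps) ^ i - 1 - (i%:~R : K) *: eps) (th * th).
  move=> i; have h1 : circle_le s ((1 + eps) ^ i) 1.
    by case: i => n; rewrite ?NegzE; [exact: hX|exact: hN].
  by have [? ?] := H i h1.
have u1 : 1 + eps \is a GRing.unit by apply/unitrP; exists g; rewrite mulrC.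
move=> _; elim/int_rec: i => [|n [IH1 IH2]|n [IH1 IH2]].
- rewrite expr0z scale0r !subrr; split; apply: circle_leW (circle_le0 _ _) => //.
  by rewrite mulr_ge0.
- have -> : (1 + eps) ^ n.+1 = (1 + eps) ^ n * (1 + eps) :> robba v by rewrite exprSzr.
  set y := _ ^ n in IH1 IH2 *; have hy : circle_le s (y * eps) th.
    by rewrite -[th]mul1r; apply: circle_leM => //; exact: hX.
  split.
    have -> : y * (1 + eps) - 1 = (y - 1) + y * eps by ring.
    exact: circle_leD.
  have -> : y * (1 + eps) - 1 - (n.+1%:~R : K) *: eps =
     (y - 1 - (n%:~R : K) *: eps) + (y - 1) * eps.
    rewrite -[(n.+1)%:~R]/(n.+1%:R : K) -natr1 scalerDl scale1r; ring.
  by apply: circle_leD => //; apply: circle_leM.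
- have e : (1 + eps) ^ (- n%:Z) = (1 + eps) ^ (- n.+1%:Z) * (1 + eps) :> robba v.
    rewrite -[X in _ * X]expr1z -exprzDr //; congr (_ ^ _); lia.
  have h1 : circle_le s ((1 + eps) ^ (- n.+1%:Z)) 1.
    exact: hN.
  rewrite e in IH1 IH2; set y := _ ^ (- n.+1%:Z) in IH1 IH2 h1 *.
  have hy : circle_le s (y * eps) th.
    by rewrite -[th]mul1r; apply: circle_leM.
  have hy1 : circle_le s (y - 1) th.
    have -> : y - 1 = (y * (1 + eps) - 1) - y * eps by ring.
    exact: circle_leB.
  split => //.
  have -> : y - 1 - ((- n.+1%:Z)%:~R : K) *: eps =
     (y * (1 + eps) - 1 - ((- n%:Z)%:~R : K) *: eps) - (y - 1) * eps.
    have -> : (- n.+1%:Z)%:~R = (- n%:Z)%:~R - 1 :> K.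
      by rewrite -[(-1)]/((-1)%:~R) -intrD; congr (_%:~R); lia.
    rewrite scalerBl scale1r; ring.
  by apply: circle_leB => //; apply: circle_leM.
Qed.

End Monomials.

(** * Substitution of a dominated series *)

Section Substitution.
Variables (R : realType) (K : fieldType) (v : complete_abs R K).
Implicit Types (f g h eps : robba v) (s rho M th : R).

(** The monomial a u^e strictly dominates on each circle from rho on, so |h(u)| = s^e when |u| = s,
    and substituting h pulls the circle of radius s^e back to that of radius s. Both sigma_a (e = 1)
    and phi_q (e = q) come from such series. The ratio [th] is chosen per circle since it need not
    stay away from 1. *)
Definition dominated rho (e : nat) h := exists a eps,
  [/\ v a = 1, h = (a *: mono v e) * (1 + eps), conv_from v rho eps &
      forall s, rho <= s -> s < 1 -> exists2 th, th < 1 & circle_le s eps th].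

Lemma dominatedW rho rho' e h : rho <= rho' -> dominated rho e h -> dominated rho' e h.
Proof.
move=> rr [a [eps [va hE heps hth]]]; exists a, eps; split => //.
  exact: conv_from_le heps.
by move=> s rs; apply: hth; exact: le_trans rs.
Qed.

Lemma dominated_inv rho e h : 0 < rho -> rho < 1 -> dominated rho e h ->
  [/\ h * h^-1 = 1, conv_from v rho h, conv_from v rho (h^-1)%R &
      forall s, rho <= s -> s < 1 ->
        circle_le s h (s ^ e) /\ circle_le s h^-1 (s ^ (- e%:Z))].
Proof.
move=> r0 r1 [a [eps [va hE heps hth]]].
have [g hg eg] := geometric_inverse r0 r1 heps hth.
have a0 : a != 0 by rewrite -(nabs_eq0 v) va oner_eq0.
have e1 : h * ((a^-1 *: mono v (- e%:Z)) * g) = 1.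
  rewrite hE mulrACA eg mulr1 robba_scaleAl robba_scaleAr scalerA divff // scale1r.
  exact: monoVx.
rewrite (mulr1_eq e1); split => //.
- rewrite hE; apply: conv_fromM => //; first by apply: conv_fromZ; exact: conv_from_mono.
  by apply: (conv_fromD r0 _ heps); exact: conv_from1.
- by apply: conv_fromM => //; apply: conv_fromZ; exact: conv_from_mono.
move=> s rs s1; have s0 : 0 < s by exact: lt_le_trans rs.
have [th th1 hs] := hth _ rs s1.
have [M M0 hM] := circle_le_ex r0 rs s1 hg.
split.
  rewrite hE -[s ^ e]mulr1; apply: circle_leM => //.
    by rewrite -[s ^ e]mul1r -va; apply: circle_leZ; exact: circle_le_mono.
  by apply: circle_leD => //; [exact: circle_le1|exact: circle_leW (ltW th1) hs].
rewrite -[s ^ _]mulr1; apply: circle_leM => //; last exact: circle_le_inv1D eg hM.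
have -> : s ^ (- e%:Z) = v a^-1 * s ^ (- e%:Z) by rewrite nabsV va invr1 mul1r.
by apply: circle_leZ; exact: circle_le_mono.
Qed.

Lemma dominated_expz rho e h (i : int) : 0 < rho -> rho < 1 -> dominated rho e h ->
  conv_from v rho (h ^ i) /\
  forall s, rho <= s -> s < 1 -> circle_le s (h ^ i) ((s ^+ e) ^ i).
Proof.
move=> r0 r1 /(dominated_inv r0 r1) [_ c1 c2 hs].
case: i => n.
  split; first exact: conv_fromX.
  move=> s rs s1; have s0 : 0 < s by exact: lt_le_trans rs.
  by have [] := hs _ rs s1; move=> + _; apply: circle_leX.
rewrite NegzE -invr_expz -exprnP -exprVn; split; first exact: conv_fromX.
move=> s rs s1; have s0 : 0 < s by exact: lt_le_trans rs.
rewrite -invr_expz -exprnP -exprVn.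
have [_] := hs _ rs s1; rewrite -invr_expz => /(circle_leX n.+1 s0); exact.
Qed.

Section Fixed.
Variables (rho : R) (e : nat) (h : robba v).
Hypotheses (r0 : 0 < rho) (r1 : rho < 1) (e0 : (0 < e)%N) (hd : dominated rho e h).

Lemma subst_coef_le s f i n : rho <= s -> s < 1 ->
  v (f i * (h ^ i) n) * s ^ n <= v (f i) * (s ^+ e) ^ i.
Proof.
move=> rs s1; have [_ /(_ _ rs s1 n) hh] := dominated_expz i r0 r1 hd.
by rewrite nabsM -mulrA ler_wpM2l ?nabs_ge0.
Qed.

(** The default values in [robba_subst] do not occur here: the coefficient sums converge and form an
    element of the Robba ring. The inner radius passes from rho^e to rho. *)
Lemma robba_subst_has_sum f : conv_from v (rho ^+ e) f ->
  (forall n, has_sum v (fun i => f i * (h ^ i) n) (robba_subst h f n)) /\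
  conv_from v rho (robba_subst h f).
Proof.
move=> hf.
have hs n : has_sum v (fun i => f i * (h ^ i) n) (nsum v (fun i => f i * (h ^ i) n)).
  apply: has_nsum.
  have re : rho ^+ e < 1 by rewrite exprn_ilt1 // -?lt0n // ltW.
  have := nullfam_scale (exprz_ge0 (- n) (ltW r0)) (hf _ (lexx _) re).
  apply: nullfam_le => i /=; rewrite [leRHS]mulrC -invr_expz ler_pdivlMr ?exprz_gt0 //.
  exact: subst_coef_le.
have hc : conv_from v rho (fun n => nsum v (fun i => f i * (h ^ i) n)).
  move=> s rs s1; have s0 : 0 < s by exact: lt_le_trans rs.
  apply: (@nullfam_has_sum _ _ v s _ (fun i n => f i * (h ^ i) n)
     (fun i => v (f i) * (s ^+ e) ^ i)) => //.
  - by move=> i n; exact: subst_coef_le.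
  - apply: hf; first by rewrite lerXn2r // nnegrE ltW.
    by rewrite exprn_ilt1 // -?lt0n // ltW.
  - move=> i; have [ci _] := dominated_expz i r0 r1 hd.
    have := nullfam_scale (nabs_ge0 v (f i)) (ci _ rs s1).
    by congr nullfam; apply: funext => n; rewrite nabsM mulrA.
have cE : robba_subst h f = (fun n => nsum v (fun i => f i * (h ^ i) n)) :> (int -> K).
  by rewrite /robba_subst /robba_of; apply: insubdK; apply/robbaP; exists rho.
by split; rewrite cE.
Qed.

Lemma circle_le_subst s f M : conv_from v (rho ^+ e) f -> rho <= s -> s < 1 ->
  circle_le (s ^+ e) f M -> circle_le s (robba_subst h f) M.
Proof.
move=> hf rs s1 hM n; have s0 : 0 < s by exact: lt_le_trans rs.
have [hs _] := robba_subst_has_sum hf.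
rewrite -ler_pdivlMr ?exprz_gt0 //; apply: has_sum_le (hs n).
  by rewrite divr_ge0 ?(circle_le_ge0 hM) ?exprz_ge0 // ltW.
move=> i; rewrite ler_pdivlMr ?exprz_gt0 //.
by apply: le_trans (subst_coef_le _ _ _ rs s1) _.
Qed.

Lemma robba_substD_conv f g : conv_from v (rho ^+ e) f -> conv_from v (rho ^+ e) g ->
  robba_subst h (f + g) = robba_subst h f + robba_subst h g.
Proof.
move=> hf hg; have [sf _] := robba_subst_has_sum hf; have [sg _] := robba_subst_has_sum hg.
have re : 0 < rho ^+ e by rewrite exprn_gt0.
have [sfg _] := robba_subst_has_sum (f := f + g) (conv_fromD re hf hg).
apply: robba_eqP => n; apply: has_sum_unique (sfg n) _; rewrite robbaD.
have := has_sumD (sf n) (sg n); congr has_sum; apply: funext => i.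
by rewrite robbaD mulrDl.
Qed.

Lemma robba_substZ_conv c f : conv_from v (rho ^+ e) f ->
  robba_subst h (c *: f) = c *: robba_subst h f.
Proof.
move=> hf; have [sf _] := robba_subst_has_sum hf.
have [scf _] := robba_subst_has_sum (f := c *: f) (conv_fromZ c hf).
apply: robba_eqP => n; apply: has_sum_unique (scf n) _; rewrite robbaZ.
have := has_sumZ c (sf n); congr has_sum; apply: funext => i.
by rewrite robbaZ mulrA.
Qed.

End Fixed.

(** Pulling back by a series of leading exponent e requires r^e above the given radius; (1 - y)^e >=
    1 - e y provides such an r close to 1. *)
Lemma radius_ex (rho rho' : R) (e : nat) : rho < 1 -> rho' < 1 ->
  exists2 r, rho <= r & r < 1 /\ rho' <= r ^+ e.
Proof.
move=> h h'.
have aux (y : R) n : 0 <= y -> y <= 1 -> 1 - n%:R * y <= (1 - y) ^+ n.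
  move=> y0 y1; elim: n => [|n IH]; first by rewrite mul0r subr0.
  rewrite exprS -natr1; apply: le_trans (ler_wpM2l _ IH); last by lra.
  have : 0 <= n%:R * (y * y) by rewrite mulr_ge0 ?ler0n ?mulr_ge0.
  nra.
have d0 : 0 < Num.min (1 - rho') 1 by rewrite lt_min; lra.
set d := Num.min _ _ in d0.
have dle : d <= 1 - rho' by rewrite ge_min lexx.
have dle1 : d <= 1 by rewrite ge_min lexx orbT.
have ne : 0 < e.+1%:R :> R by rewrite ltr0n.
(* The denominator e + 1 keeps the quotient meaningful for e = 0. *)
pose y := d / e.+1%:R.
have y0 : 0 < y by rewrite divr_gt0.
have y1 : y <= 1.
  by rewrite ler_pdivrMr // mul1r (le_trans dle1) // ler1n.
have yd : e%:R * y <= d.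
  by rewrite mulrC mulrAC ler_pdivrMr // ler_wpM2l ?ler_nat // ltW.
exists (Num.max rho (1 - y)); first by rewrite le_max lexx.
split; first by rewrite gt_max h; lra.
apply: le_trans (_ : (1 - y) ^+ e <= _).
  by apply: le_trans (aux _ _ (ltW y0) y1); lra.
by rewrite lerXn2r ?nnegrE ?le_max ?subr_ge0 ?y1 ?lexx ?orbT.
Qed.

Section Linear.
Variables (rho : R) (e : nat) (h : robba v).
Hypotheses (r0 : 0 < rho) (r1 : rho < 1) (e0 : (0 < e)%N) (hd : dominated rho e h).

Lemma robba_substD : {morph robba_subst h : f g / f + g}.
Proof.
move=> f g; have [r [_ r'1 hf hg]] := robba2P f g.
have [t rt [t1 tr]] := radius_ex e r1 r'1.
apply: (robba_substD_conv (lt_le_trans r0 rt) t1 e0 (dominatedW rt hd));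
  exact: conv_from_le tr _.
Qed.

Lemma robba_substZ c f : robba_subst h (c *: f) = c *: robba_subst h f.
Proof.
have [r [_ r'1 hf _]] := robba2P f f.
have [t rt [t1 tr]] := radius_ex e r1 r'1.
apply: (robba_substZ_conv (lt_le_trans r0 rt) t1 e0 (dominatedW rt hd)).
exact: conv_from_le tr _.
Qed.

Lemma robba_subst_cvg rho' y f : 0 < rho' -> rho' < 1 -> robba_cvg rho' y f ->
  exists rho2, [/\ 0 < rho2, rho2 < 1 &
    robba_cvg rho2 (fun n => robba_subst h (y n)) (robba_subst h f)].
Proof.
move=> r'0 r'1 [y1 y2 y3].
have [t rt [t1 tr]] := radius_ex e r1 r'1.
have t0 : 0 < t by exact: lt_le_trans rt.
have td := dominatedW rt hd.
have c1 n := conv_from_le tr (y1 n); have c2 := conv_from_le tr y2.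
exists t; split => //; split.
- by move=> n; have [] := robba_subst_has_sum t0 t1 e0 td (c1 n).
- by have [] := robba_subst_has_sum t0 t1 e0 td c2.
move=> s eps ts s1 eps0.
have s0 : 0 < s by exact: lt_le_trans ts.
have se1 : s ^+ e < 1 by rewrite exprn_ilt1 // -?lt0n // ltW.
have te : t ^+ e <= s ^+ e by rewrite lerXn2r // nnegrE ltW.
have [N hN] := y3 _ _ (le_trans tr te) se1 eps0.
exists N => n /hN hn.
have -> : robba_subst h (y n) - robba_subst h f = robba_subst h (y n - f).
  by rewrite robba_substD -scaleN1r -[in RHS]scaleN1r robba_substZ.
apply: (circle_le_subst t0 t1 e0 td) => //.
by apply: conv_fromB => //; rewrite exprn_gt0.
Qed.

End Linear.

Lemma robba_subst1 h : robba_subst h 1 = 1.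
Proof.
rewrite /robba_subst.
have -> : (fun n => nsum v (fun i => (1 : robba v) i * (h ^ i) n)) = robba_coef (1 : robba v).
  apply: funext => n; apply: nsumE.
  have -> : (1 : robba v) n = (1 : robba v) 0 * (h ^ 0) n by rewrite mul1r.
  apply: (@has_sum1 _ _ v _ 0 (fun i : int => (1 : robba v) i * (h ^ i) n)).
  by move=> i /negbTE i0; rewrite robba1 i0 mul0r.
by rewrite /robba_of; apply: valKd.
Qed.

Lemma robba_coef_lin c c' f g n : c * f n + - c' * g n = (c *: f - c' *: g) n.
Proof. by rewrite robbaB !robbaZ mulNr. Qed.

(** * First-order expansion of substitutions close to the identity *)

Section NearIdentity.
Variables (rho s : R) (f : robba v) (M : R).
Hypotheses (r0 : 0 < rho) (rs : rho <= s) (s1 : s < 1).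
Hypotheses (cf : conv_from v rho f) (fM : circle_le s f M).

Let r1 : rho < 1. Proof. exact: le_lt_trans s1. Qed.
Let s0 : 0 < s. Proof. exact: lt_le_trans rs. Qed.

Lemma near_id_expz h eps th : dominated rho 1 h -> h = mono v 1 * (1 + eps) ->
  circle_le s eps th -> th < 1 -> forall i : int,
  [/\ h ^ i = mono v i * (1 + eps) ^ i, circle_le s ((1 + eps) ^ i - 1) th &
      circle_le s ((1 + eps) ^ i - 1 - (i%:~R : K) *: eps) (th * th)].
Proof.
move=> hd hE he th1 i.
have [h1 _ h2 h3] := dominated_inv r0 r1 hd.
have e1 : (1 + eps) * (mono v 1 * h^-1) = 1 by rewrite mulrA [_ * mono v 1]mulrC -hE.
have [N N0 hN] := circle_le_ex r0 rs s1 (conv_fromM r0 (@conv_from_mono _ _ v rho 1) h2).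
have [_ a b] := circle_le_expz1D s0 he th1 e1 hN i; split => //.
rewrite {1}hE exprMz_comm ?mono_unit ?monoXz ?mul1r //; last exact: mulrC.
by apply/unitrP; exists (mono v 1 * h^-1); rewrite mulrC.
Qed.

Lemma subst_sub_has_sum h : dominated rho 1 h -> forall n,
  has_sum v (fun i => f i * (h ^ i - mono v i) n) ((robba_subst h f - f) n).
Proof.
move=> hd n.
have [sf _] := robba_subst_has_sum (f := f) r0 r1 (ltn0Sn 0) hd cf.
have sm : has_sum v (fun i => f i * mono v i n) (f n).
  have := @has_sum1 _ _ v _ n (fun i => f i * mono v i n).
  rewrite monoE eqxx mulr1; apply => i; rewrite monoE eq_sym => /negbTE ->.
  by rewrite mulr0.
have := has_sumD (sf n) (has_sumZ (-1) sm); rewrite mulN1r.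
by congr has_sum; apply: funext => i; rewrite robbaB mulrBr mulN1r.
Qed.

Lemma circle_le_of_sum (c : robba v) (g : int -> robba v) N :
  (forall n, has_sum v (fun i => f i * (mono v i * g i) n) (c n)) ->
  (forall i, circle_le s (g i) N) -> circle_le s c (N * M).
Proof.
move=> hc hg n; have sn : 0 < s ^ n by rewrite exprz_gt0.
have M0 := circle_le_ge0 fM; have N0 := circle_le_ge0 (hg 0).
rewrite -ler_pdivlMr //; apply: has_sum_le (hc n); first by rewrite divr_ge0 ?mulr_ge0 // ltW.
move=> i; rewrite ler_pdivlMr // nabsM -mulrA.
have := circle_le_monoM i s0 (hg i) n; move=> h.
apply: le_trans (ler_wpM2l (nabs_ge0 v (f i)) h) _.
by rewrite mulrA [leRHS]mulrC ler_wpM2r.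
Qed.

Lemma circle_le_subst_sub h eps th : dominated rho 1 h -> h = mono v 1 * (1 + eps) ->
  circle_le s eps th -> th < 1 -> circle_le s (robba_subst h f - f) (th * M).
Proof.
move=> hd hE he th1.
apply: (@circle_le_of_sum _ (fun i => (1 + eps) ^ i - 1)).
  move=> n; have := subst_sub_has_sum hd n.
  congr has_sum; apply: funext => i.
  have [-> _ _] := near_id_expz hd hE he th1 i.
  by congr (_ * robba_coef _ _); rewrite [RHS]mulrBr mulr1.
by move=> i; have [] := near_id_expz hd hE he th1 i.
Qed.

(** Meant for c, c' inverse to two increments. To second order, the i-th terms of the two quotients
    differ by i (c eps - c' eps'), up to errors c eps^2 and c' eps'^2; since |i| <= 1 the estimate
    does not depend on i. *)
Lemma circle_le_subst_sub2 h eps th h' eps' th' (c c' : K) N :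
  dominated rho 1 h -> h = mono v 1 * (1 + eps) -> circle_le s eps th -> th < 1 ->
  dominated rho 1 h' -> h' = mono v 1 * (1 + eps') -> circle_le s eps' th' -> th' < 1 ->
  v c * (th * th) <= N -> v c' * (th' * th') <= N ->
  circle_le s (c *: eps - c' *: eps') N ->
  circle_le s (c *: (robba_subst h f - f) - c' *: (robba_subst h' f - f)) (N * M).
Proof.
move=> hd hE he th1 hd' hE' he' th1' hN hN' hee.
apply: (@circle_le_of_sum _
  (fun i => c *: ((1 + eps) ^ i - 1) - c' *: ((1 + eps') ^ i - 1))).
  move=> n; apply: eq_has_sum (has_sumD (has_sumZ c (subst_sub_has_sum hd n))
      (has_sumZ (- c') (subst_sub_has_sum hd' n))) => [i|]; last first.
    exact: robba_coef_lin.
  have [-> _ _] := near_id_expz hd hE he th1 i.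
  have [-> _ _] := near_id_expz hd' hE' he' th1' i.
  move: ((1 + eps) ^ i) ((1 + eps') ^ i) (mono v i) => x y m.
  rewrite mulrCA [- c' * _]mulrCA -mulrDr robba_coef_lin; congr (_ * robba_coef _ _).
  by rewrite mulrBr !robba_scaleAr !mulrBr !mulr1.
move=> i; have [_ _ a] := near_id_expz hd hE he th1 i.
have [_ _ b] := near_id_expz hd' hE' he' th1' i.
set X := (1 + eps) ^ i - 1 in a *; set Y := (1 + eps') ^ i - 1 in b *.
have -> : c *: X - c' *: Y = (c *: (X - (i%:~R : K) *: eps) -
   c' *: (Y - (i%:~R : K) *: eps')) + (i%:~R : K) *: (c *: eps - c' *: eps').
  rewrite !scalerBr !scalerA [i%:~R * c]mulrC [i%:~R * c']mulrC; ring.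
apply: circle_leD => //; first apply: circle_leB => //.
- by apply: circle_leW hN _; exact: circle_leZ.
- by apply: circle_leW hN' _; exact: circle_leZ.
- have N0 := circle_le_ge0 hee.
  apply: circle_leW (circle_leZ i%:~R hee); rewrite -[leRHS]mul1r.
  by rewrite ler_wpM2r // nabs_int.
Qed.

End NearIdentity.
End Substitution.

(** * Lubin-Tate series *)

Section GaussBounds.
Variables (R : realType) (F : fieldType) (v : nonarch_abs R F).
Variable (s : R).
Hypothesis (s0 : 0 < s).

(** A bound for the Gauss norm on the polydisc of radius s, the analogue of [circle_le] for power
    series in k variables. *)
Definition gauss_le k (f : mps F k) (M : R) :=
  forall m, v (f m) * s ^+ mdeg m <= M.

Lemma gauss_le_ge0 k (f : mps F k) M : gauss_le f M -> 0 <= M.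
Proof.
move=> /(_ [ffun=> 0%N]); apply: le_trans.
by rewrite mulr_ge0 ?nabs_ge0 // exprn_ge0 // ltW.
Qed.

Lemma gauss_leW k (f : mps F k) M N : M <= N -> gauss_le f M -> gauss_le f N.
Proof. by move=> MN h m; exact: le_trans MN. Qed.

Lemma gauss_le_sum k (f : mps F k) M (I : Type) (r : seq I) (P : pred I) (m : {ffun 'I_k -> nat})
    (g : I -> F) : 0 <= M ->
  (forall i, P i -> v (g i) * s ^+ mdeg m <= M) ->
  v (\sum_(i <- r | P i) g i) * s ^+ mdeg m <= M.
Proof.
move=> M0 h; have sm : 0 < s ^+ mdeg m by rewrite exprn_gt0.
rewrite -ler_pdivlMr //; apply: nabs_sum_le; first by rewrite divr_ge0 // ltW.
by move=> i /h; rewrite ler_pdivlMr.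
Qed.

Lemma gauss_le_mul k (f g : mps F k) M N : gauss_le f M -> gauss_le g N ->
  gauss_le (mps_mul f g) (M * N).
Proof.
move=> hf hg m; have M0 := gauss_le_ge0 hf; have N0 := gauss_le_ge0 hg.
apply: gauss_le_sum => //; first exact: mulr_ge0.
move=> e /forallP he.
have -> : s ^+ mdeg m = s ^+ (mdeg [ffun i => e i : nat] + mdeg [ffun i => (m i - e i)%N]).
  congr (_ ^+ _).
  rewrite /mdeg -big_split; apply: eq_bigr => i _ /=.
  by rewrite !ffunE subnKC.
rewrite nabsM exprD mulrACA; apply: ler_pM => //;
  by rewrite mulr_ge0 ?nabs_ge0 // exprn_ge0 // ltW.
Qed.

Lemma gauss_le1 k : gauss_le (@mps1 F k) 1.
Proof.
move=> m; rewrite /mps1; case: eqVneq => [->|_]; last by rewrite nabs0 mul0r ler01.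
rewrite nabs1 mul1r /mdeg big1 ?expr0 // => i _; by rewrite ffunE.
Qed.

Lemma gauss_le_exp k (f : mps F k) M n : gauss_le f M -> gauss_le (mps_exp f n) (M ^+ n).
Proof.
move=> hf; elim: n => [|n IH]; first exact: gauss_le1.
by rewrite exprS; apply: gauss_le_mul.
Qed.

Lemma gauss_leX k (i : 'I_k) : gauss_le (@mpsX F k i) s.
Proof.
move=> m; rewrite /mpsX; case: eqVneq => [->|_].
  rewrite nabs1 mul1r /mdeg (bigD1 i) //= ffunE eqxx big1 ?expr1 // => j /negbTE ji.
  by rewrite ffunE ji.
by rewrite nabs0 mul0r ltW.
Qed.

Lemma gauss_leZ k c (f : mps F k) M :
  gauss_le f M -> gauss_le (fun m => c * f m) (v c * M).
Proof. by move=> hf m; rewrite nabsM -mulrA ler_wpM2l ?nabs_ge0. Qed.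

Lemma gauss_leB k (f g : mps F k) M : gauss_le f M -> gauss_le g M ->
  gauss_le (fun m => f m - g m) M.
Proof.
move=> hf hg m; have sm : 0 < s ^+ mdeg m by rewrite exprn_gt0.
by rewrite -ler_pdivlMr //; apply: nabs_leB; rewrite ler_pdivlMr.
Qed.

(** The monomial f^a g^b in a substitution into a series in two variables; the trailing [mps1] is
    what unfolding the iterated product leaves. *)
Definition mps_term k (f g : mps F k) a b :=
  mps_mul (mps_exp f a) (mps_mul (mps_exp g b) (@mps1 F k)).

Lemma mps_comp2E k (h : mps F 2) (f g : mps F k) m : mps_comp2 h f g m =
  \sum_(e : {ffun 'I_2 -> 'I_(mdeg m).+1})
    h [ffun i => e i : nat] * mps_term f g (e ord0) (e (lift ord0 ord0)) m.
Proof.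
apply: eq_bigr => e _; congr (_ * _).
by rewrite !big_ord_recl big_ord0.
Qed.

Lemma mps_comp1E k (h : mps F 1) (f : mps F k) m : mps_comp1 h f m =
  \sum_(e : {ffun 'I_1 -> 'I_(mdeg m).+1})
    Defs.coef1 h (e ord0) * mps_mul (mps_exp f (e ord0)) (@mps1 F k) m.
Proof.
apply: eq_bigr => e _; congr (_ * _); last by rewrite !big_ord_recl big_ord0.
by rewrite /Defs.coef1; congr (h _); apply/ffunP => i; rewrite !ffunE ord1.
Qed.

Lemma gauss_le_comp1 k (h : mps F 1) (f : mps F k) M N : 0 <= N ->
  gauss_le f M -> (forall n, v (Defs.coef1 h n) * M ^+ n <= N) ->
  gauss_le (mps_comp1 h f) N.
Proof.
move=> N0 hf hN m; rewrite mps_comp1E; apply: gauss_le_sum => // e _.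
rewrite nabsM -mulrA; apply: le_trans (hN (e ord0)); rewrite ler_wpM2l ?nabs_ge0 //.
have := gauss_le_mul (gauss_le_exp (e ord0) hf) (@gauss_le1 k).
by rewrite mulr1; apply.
Qed.

Lemma gauss_le_term k (f g : mps F k) a b M : s < 1 -> gauss_le f s -> gauss_le g M ->
  gauss_le (mps_term f g a b) (M ^+ b).
Proof.
move=> s1 hf hg.
have := gauss_le_mul (gauss_le_exp a hf) (gauss_le_mul (gauss_le_exp b hg) (@gauss_le1 k)).
apply: gauss_leW; rewrite mulr1 ler_piMl ?exprn_ge0 ?(gauss_le_ge0 hg) //.
by rewrite exprn_ile1 // ltW.
Qed.

Lemma mps_mulDr k (f g h : mps F k) m :
  mps_mul f (fun m => g m + h m) m = mps_mul f g m + mps_mul f h m.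
Proof. by rewrite /mps_mul -big_split; apply: eq_bigr => e _; rewrite mulrDr. Qed.

Lemma mps_mulDl k (f g h : mps F k) m :
  mps_mul (fun m => g m + h m) f m = mps_mul g f m + mps_mul h f m.
Proof. by rewrite /mps_mul -big_split; apply: eq_bigr => e _; rewrite mulrDl. Qed.

Lemma mps_mulZr k c (f g : mps F k) m :
  mps_mul f (fun m => c * g m) m = c * mps_mul f g m.
Proof. by rewrite /mps_mul big_distrr; apply: eq_bigr => e _ /=; rewrite mulrCA. Qed.

Lemma mps_mulZl k c (f g : mps F k) m :
  mps_mul (fun m => c * g m) f m = c * mps_mul g f m.
Proof. by rewrite /mps_mul big_distrr; apply: eq_bigr => e _ /=; rewrite mulrA. Qed.

(** The terms of degree 1 in the second argument are the part of G(X, [c]) that survives to first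
    order in c; their linearity lets quotients for different c be subtracted inside the monomial. *)
Lemma mps_term1_lin k (f g h : mps F k) a c d m :
  mps_term f (fun m => c * g m + d * h m) a 1 m =
  c * mps_term f g a 1 m + d * mps_term f h a 1 m.
Proof.
rewrite /mps_term /mps_exp /=.
have e1 : mps_mul (fun m => c * g m + d * h m) (@mps1 F k) =
    (fun m => c * mps_mul g (@mps1 F k) m + d * mps_mul h (@mps1 F k) m).
  by apply: funext => n; rewrite (mps_mulDl _ (fun m => c * g m)) !mps_mulZl.
rewrite e1.
have e2 : mps_mul (fun m => c * mps_mul g (@mps1 F k) m + d * mps_mul h (@mps1 F k) m)
   (@mps1 F k) = (fun m => c * mps_mul (mps_mul g (@mps1 F k)) (@mps1 F k) m +
     d * mps_mul (mps_mul h (@mps1 F k)) (@mps1 F k) m).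
  by apply: funext => n; rewrite (mps_mulDl _ (fun m => c * _ m)) !mps_mulZl.
by rewrite e2 (mps_mulDr _ (fun m => c * _ m)) !mps_mulZr.
Qed.

Lemma coef1_mpsX n : Defs.coef1 (@mpsX F 1 ord0) n = (n == 1)%:R.
Proof.
rewrite /Defs.coef1 /mpsX; congr ((_ : bool)%:R).
apply/eqP/eqP => [/ffunP/(_ ord0)|->]; first by rewrite !ffunE eqxx.
by apply/ffunP => i; rewrite !ffunE ord1 eqxx.
Qed.

End GaussBounds.

(** * Growth of the series [c] and [1 + c] in terms of |c| *)

Section LubinTateBounds.
Variables (R : realType) (F : fieldType) (v : nonarch_abs R F).
Variables (pi : F) (q : nat) (FG : mps F 2) (br : F -> mps F 1).
Hypotheses (hpi : uniformizer v pi) (q2 : (1 < q)%N) (hFG : lubin_tate_group v pi q FG br).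

Let X : mps F 1 := mpsX F ord0.

Lemma lt_comp_le s t c M : 0 < s -> v t <= 1 -> v c <= 1 -> M <= 1 ->
  gauss_le v s (br c) M -> gauss_le v s (br (t * c)) M.
Proof.
move=> s0 vt vc M1 hM; have M0 := gauss_le_ge0 s0 hM.
rewrite (lt_M hFG) //; apply: (gauss_le_comp1 s0 M0 hM) => -[|n].
  by rewrite (lt_coef0 hFG) // nabs0 mul0r.
rewrite exprS mulrCA ler_piMr //.
have := lt_integral hFG vt [ffun=> n.+1]; rewrite -/(Defs.coef1 _ _) => h.
by rewrite mulr_ile1 ?nabs_ge0 ?exprn_ge0 ?exprn_ile1.
Qed.

(** Modulo pi the series [pi] is X^q. A coefficient of index other than q is divisible by pi and
    contributes at most |pi| M; the term of index q >= 2 contributes at most M^2. *)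
Lemma lt_pi_step s c M : 0 < s -> v c <= 1 -> M <= 1 ->
  gauss_le v s (br c) M -> gauss_le v s (br (pi * c)) (Num.max (v pi * M) (M * M)).
Proof.
move=> s0 vc M1 hM; have M0 := gauss_le_ge0 s0 hM.
have [_ vpi _] := hpi.
have N0 : 0 <= Num.max (v pi * M) (M * M) by rewrite le_max mulr_ge0 ?nabs_ge0.
rewrite (lt_M hFG) //; last exact: ltW.
apply: (gauss_le_comp1 s0 N0 hM) => -[|n].
  by rewrite (lt_coef0 hFG) ?nabs0 ?mul0r // ltW.
have := lt_frob hFG n.+1; case: eqVneq => [nq|_]; last first.
  rewrite subr0 => h; rewrite le_max exprS; apply/orP; left.
  rewrite mulrCA mulrC ler_wpM2r //.
  by rewrite -[leRHS]mulr1 ler_pM ?nabs_ge0 ?exprn_ge0 ?exprn_ile1.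
move=> _; rewrite le_max; apply/orP; right.
have := lt_integral hFG (ltW vpi) [ffun=> n.+1]; rewrite -/(Defs.coef1 _ _) => h.
case: n nq h => [|n] nq h; first by move: (q2); rewrite -nq.
rewrite 2!exprS mulrA mulrCA -mulrA -[leRHS]mulr1 mulrA.
rewrite [leLHS](_ : _ = (M * M) * (v (Defs.coef1 (br pi) n.+2) * M ^+ n)); last by ring.
by rewrite ler_wpM2l ?mulr_ge0 // mulr_ile1 ?nabs_ge0 ?exprn_ge0 ?exprn_ile1.
Qed.

(** Two regimes: at first a step contracts by at least tau = max(|pi|, s); once the bound M is at
    most |pi|, the maximum in [lt_pi_step] is |pi| M, so each step gains |pi|. The constant |pi|^-N
    repays the N steps of the first regime. *)
Lemma lt_pi_pow s : 0 < s -> s < 1 -> exists2 C, 0 < C &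
  forall n, gauss_le v s (br (pi ^+ n)) (C * v pi ^+ n).
Proof.
move=> s0 s1; have [pi0 vpi _] := hpi; have vp0 : 0 < v pi by exact: nabs_gt0.
pose tau := Num.max (v pi) s.
have tau0 : 0 < tau by rewrite lt_max vp0.
have tau1 : tau < 1 by rewrite gt_max vpi.
have vpn n : v (pi ^+ n) <= 1 by rewrite nabsX exprn_ile1 // ltW.
have h1 n : gauss_le v s (br (pi ^+ n)) (s * tau ^+ n).
  elim: n => [|n IH].
    by rewrite expr0 expr0 mulr1 (lt_1 hFG); exact: gauss_leX.
  have M1 : s * tau ^+ n <= 1 by rewrite mulr_ile1 ?exprn_ge0 ?exprn_ile1 // ltW.
  rewrite exprS; apply: gauss_leW (lt_pi_step s0 (vpn n) M1 IH).
  have T0 : 0 <= s * tau ^+ n by rewrite mulr_ge0 ?exprn_ge0 // ltW.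
  rewrite exprS [s * (_ * _)]mulrCA ge_max; apply/andP; split.
    by rewrite ler_wpM2r // /tau le_max lexx.
  rewrite ler_wpM2r // /tau le_max; apply/orP; right.
  by rewrite ler_piMr ?exprn_ile1 // ltW.
have [N hN] := expr_small (ltW tau0) tau1 vp0.
have hb : s * tau ^+ N <= v pi.
  by apply: le_trans (ltW (hN N (leqnn _))); rewrite ler_piMl ?exprn_ge0 // ltW.
have h2 k : gauss_le v s (br (pi ^+ (k + N))) (v pi * v pi ^+ k).
  elim: k => [|k IH]; first by rewrite expr0 mulr1; exact: gauss_leW hb (h1 N).
  have V0 : 0 <= v pi * v pi ^+ k by rewrite mulr_ge0 ?exprn_ge0 // ltW.
  have M1 : v pi * v pi ^+ k <= 1 by rewrite mulr_ile1 ?exprn_ge0 ?exprn_ile1 // ltW.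
  rewrite addSn exprS; apply: gauss_leW (lt_pi_step s0 (vpn _) M1 IH).
  rewrite exprS ge_max lexx /= ler_wpM2r //.
  by rewrite ler_piMr ?exprn_ile1 // ltW.
exists (v pi ^+ N)^-1; first by rewrite invr_gt0 exprn_gt0.
move=> n; case: (leqP N n) => Nn.
  have := h2 (n - N)%N; rewrite subnK //; apply: gauss_leW.
  rewrite [leRHS]mulrC ler_pdivlMr ?exprn_gt0 // -mulrA -exprD subnK //.
  by rewrite ler_piMl ?exprn_ge0 // ltW.
apply: gauss_leW (h1 n); apply: (@le_trans _ _ 1).
  by rewrite mulr_ile1 ?exprn_ge0 ?exprn_ile1 // ltW.
rewrite mulrC ler_pdivlMr ?exprn_gt0 // mul1r.
by apply: ler_wiXn2l; [exact: nabs_ge0|exact: ltW|exact: ltnW].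
Qed.

Lemma lt_growth s : 0 < s -> s < 1 -> exists2 C, 0 < C &
  forall c, c != 0 -> v c <= 1 -> C * v c <= 1 -> gauss_le v s (br c) (C * v c).
Proof.
move=> s0 s1; have [pi0 vpi hmax] := hpi; have vp0 : 0 < v pi by exact: nabs_gt0.
have [C C0 hC] := lt_pi_pow s0 s1.
exists C => // c c0 vc Cc.
(* The value |c| is a power of |pi|: take the least exponent n + 1 with |pi|^(n+1) < |c|; a value
   strictly between two powers would contradict the maximality of |pi| below 1. *)
have [n [/eqP en]] : exists n, v c == v pi ^+ n /\ True.
  have [N hN] := expr_small (ltW vp0) vpi (nabs_gt0 v c0).
  have ex : exists n, v pi ^+ n < v c by exists N; apply: hN.
  case: (ex_minnP ex) => -[|n] hn hmin; first by rewrite expr0 ltNge vc in hn.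
  exists n; split => //; rewrite eq_le; apply/andP; split.
    by rewrite leNgt; apply/negP => h; have := hmin _ h; rewrite ltnn.
  rewrite leNgt; apply/negP => h.
  have cp : v (c / pi ^+ n) < 1.
    by rewrite nabsM nabsV nabsX ltr_pdivrMr ?exprn_gt0 // mul1r.
  have := hmax _ cp; rewrite nabsM nabsV nabsX ler_pdivrMr ?exprn_gt0 // -exprS.
  by rewrite leNgt hn.
move=> _; have -> : c = (c / pi ^+ n) * pi ^+ n by rewrite divfK // expf_neq0.
have vcp : v (c / pi ^+ n) = 1 by rewrite nabsM nabsV nabsX en divff ?expf_neq0 ?gt_eqF.
rewrite nabsM vcp mul1r nabsX; apply: lt_comp_le => //.
- by rewrite vcp.
- by rewrite nabsX exprn_ile1 // ltW.
- by rewrite -en.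
Qed.

Lemma mps_term_exp0 k (f g h : mps F k) a m : mps_term f g a 0 m = mps_term f h a 0 m.
Proof. by []. Qed.

(** [1 + c] is the formal sum G(X, [c]), and subtracting X = G(X, 0) cancels the terms of degree 0
    in [c]. Every surviving term carries a factor [c]. *)
Lemma lt_sub1E c m : v c <= 1 -> br (1 + c) m - X m =
  \sum_(e : {ffun 'I_2 -> 'I_(mdeg m).+1}) FG [ffun i => e i : nat] *
    (mps_term X (br c) (e ord0) (e (lift ord0 ord0)) m -
     mps_term X (fun=> 0) (e ord0) (e (lift ord0 ord0)) m).
Proof.
move=> vc; have e0 : X m = mps_comp2 FG X (fun=> 0) m.
  by rewrite (fgl_0r (lt_fgl hFG)).
rewrite (lt_D hFG) ?nabs1 // (lt_1 hFG) -/X e0 !mps_comp2E -sumrB.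
by apply: eq_bigr => e _; rewrite mulrBr.
Qed.

Lemma gauss_le_cst0 k s M : 0 <= M -> gauss_le v s ((fun=> 0) : mps F k) M.
Proof. by move=> M0 m; rewrite nabs0 mul0r. Qed.

Lemma lt_near1 s c M : 0 < s -> s < 1 -> v c <= 1 -> M <= 1 ->
  gauss_le v s (br c) M -> gauss_le v s (fun m => br (1 + c) m - X m) M.
Proof.
move=> s0 s1 vc M1 hM m; have M0 := gauss_le_ge0 s0 hM.
rewrite lt_sub1E //; apply: gauss_le_sum => // e _.
set a := nat_of_ord _; set b := nat_of_ord _.
rewrite nabsM -mulrA; apply: le_trans (_ : 1 * M <= _); last by rewrite mul1r.
apply: ler_pM; rewrite ?nabs_ge0 ?mulr_ge0 ?nabs_ge0 ?exprn_ge0 ?(ltW s0) //.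
  exact: (fgl_integral (lt_fgl hFG)).
case: b => [|b]; first by rewrite (mps_term_exp0 X (br c) (fun=> 0)) subrr nabs0 mul0r.
have hX := @gauss_leX _ _ v s s0 1 ord0.
have h1 := gauss_le_term s0 a b.+1 s1 hX hM.
have h2 := gauss_le_term s0 a b.+1 s1 hX (@gauss_le_cst0 1 s 0 (lexx _)).
apply: (gauss_leB s0 (M := M)).
  by apply: gauss_leW h1; rewrite exprS ler_piMr ?exprn_ile1.
by apply: gauss_leW h2; rewrite expr0n.
Qed.

(** [tc] = [t]([c]) has linear part t [c], so only terms of degree at least 2 in [c] remain. *)
Lemma lt_mul_approx s c t M : 0 < s -> v c <= 1 -> v t <= 1 -> M <= 1 ->
  gauss_le v s (br c) M -> gauss_le v s (fun m => br (t * c) m - t * br c m) (M * M).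
Proof.
move=> s0 vc vt M1 hM m; have M0 := gauss_le_ge0 s0 hM.
(* Writing c as 1 * c presents [c] as a composition too, so the two sums are compared term by
   term. *)
rewrite -{2}[c]mul1r !(lt_M hFG) ?nabs1 // !mps_comp1E big_distrr -sumrB /=.
apply: gauss_le_sum => //; first exact: mulr_ge0.
move=> e _; rewrite mulrA -mulrBl (lt_1 hFG) coef1_mpsX.
case: (nat_of_ord (e ord0)) => [|[|n]].
- by rewrite (lt_coef0 hFG) // mulr0 subrr mul0r nabs0 mul0r mulr_ge0.
- by rewrite (lt_coef1 hFG) // mulr1 subrr mul0r nabs0 mul0r mulr_ge0.
rewrite mulr0 subr0 nabsM -mulrA; apply: le_trans (_ : 1 * (M * M) <= _); last by rewrite mul1r.
apply: ler_pM; rewrite ?nabs_ge0 ?mulr_ge0 ?nabs_ge0 ?exprn_ge0 ?(ltW s0) //.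
  exact: (lt_integral hFG vt).
have := gauss_le_mul s0 (gauss_le_exp s0 n.+2 hM) (@gauss_le1 _ _ v s 1) m.
move=> /le_trans; apply; rewrite mulr1 2!exprS mulrA ler_piMr ?mulr_ge0 ?exprn_ile1 //.
Qed.

(* The source of F-analyticity: the derivative of b |-> [b](u) at b = 1 does not
   depend on the direction. *)
Lemma lt_near1_cmp s c t C : 0 < s -> s < 1 -> c != 0 -> v c <= 1 ->
  t != 0 -> v t <= 1 -> C * v c <= 1 ->
  gauss_le v s (br c) (C * v c) -> gauss_le v s (br (t * c)) (C * v (t * c)) ->
  gauss_le v s (fun m => c^-1 * (br (1 + c) m - X m) -
                         (t * c)^-1 * (br (1 + t * c) m - X m)) (C * C * v c / v t).
Proof.
move=> s0 s1 c0 vc t0 vt Cc hc htc m.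
have vt0 : 0 < v t by exact: nabs_gt0.
have vc0 : 0 < v c by exact: nabs_gt0.
have C0 : 0 <= C by have := gauss_le_ge0 s0 hc; rewrite pmulr_lge0.
have vtc : v (t * c) <= 1 by rewrite nabsM mulr_ile1 ?nabs_ge0.
have Ctc : C * v (t * c) <= 1.
  rewrite nabsM mulrCA mulr_ile1 ?nabs_ge0 ?mulr_ge0 ?nabs_ge0 //.
set B := C * C * v c / v t.
have B0 : 0 <= B by rewrite divr_ge0 ?mulr_ge0 ?nabs_ge0.
rewrite !lt_sub1E // !big_distrr -sumrB /=; apply: gauss_le_sum => // e _.
set a := nat_of_ord _; set b := nat_of_ord _; set G := FG _.
rewrite mulrCA [(t * c)^-1 * _]mulrCA -mulrBr nabsM -mulrA.
apply: le_trans (_ : 1 * B <= _); last by rewrite mul1r.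
apply: ler_pM; rewrite ?nabs_ge0 ?mulr_ge0 ?nabs_ge0 ?exprn_ge0 ?(ltW s0) //.
  exact: (fgl_integral (lt_fgl hFG)).
have hX := @gauss_leX _ _ v s s0 1 ord0.
case: b => [|[|b]].
- rewrite (mps_term_exp0 X (br c) (fun=> 0)) (mps_term_exp0 X (br (t * c)) (fun=> 0)).
  by rewrite !subrr !mulr0 subrr nabs0 mul0r.
(* Degree 1 in the second variable: linearity reduces the difference of quotients to [tc] - t [c]
   divided by tc, which is where 1/|t| enters the bound. *)
- have -> : c^-1 * (mps_term X (br c) a 1 m - mps_term X (fun=> 0) a 1 m) -
     (t * c)^-1 * (mps_term X (br (t * c)) a 1 m - mps_term X (fun=> 0) a 1 m) =
     mps_term X (fun m => (- (t * c)^-1) * (br (t * c) m - t * br c m) + 0 * br c m) a 1 m.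
    have z0 : mps_term X (fun=> 0) a 1 m = 0.
      have := mps_term1_lin X (fun=> 0) (fun=> 0) a 0 0 m.
      by rewrite !mul0r !addr0.
    rewrite z0 !subr0 (mps_term1_lin X (fun m => br (t * c) m - t * br c m)).
    have -> : mps_term X (fun m => br (t * c) m - t * br c m) a 1 m =
       1 * mps_term X (br (t * c)) a 1 m + (- t) * mps_term X (br c) a 1 m.
      rewrite -mps_term1_lin; congr mps_term; apply: funext => ?.
      by rewrite mul1r mulNr.
    by field; rewrite c0 t0.
  have h1 := gauss_leZ (- (t * c)^-1) (lt_mul_approx s0 vc vt Cc hc).
  have h2 : gauss_le v s (fun m => (- (t * c)^-1) * (br (t * c) m - t * br c m) + 0 * br c m) B.
    move=> n; rewrite mul0r addr0; apply: le_trans (h1 n) _.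
    rewrite nabsN nabsV nabsM le_eqVlt; apply/orP; left; apply/eqP.
    by rewrite /B; field; rewrite !gt_eqF.
  by have := gauss_le_term s0 a 1 s1 hX h2; rewrite expr1; apply.
(* Degree at least 2: each quotient is small by itself, of size at most C^2 |d| for d = c and d =
   tc. *)
have h1 := gauss_le_term s0 a b.+2 s1 hX hc.
have h2 := gauss_le_term s0 a b.+2 s1 hX htc.
have h3 := gauss_le_term s0 a b.+2 s1 hX (@gauss_le_cst0 1 s 0 (lexx _)).
have aux d (f : mps F 1) : v d <= v c -> v t * v c <= v d -> d != 0 -> C * v d <= 1 ->
   gauss_le v s f ((C * v d) ^+ b.+2) ->
   gauss_le v s (fun m => d^-1 * (f m - mps_term X (fun=> 0) a b.+2 m)) B.
  move=> dc td d0 Cd hf; have vd0 : 0 < v d by exact: nabs_gt0.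
  have Cd0 : 0 <= C * v d by rewrite mulr_ge0 // ltW.
  have h4 : gauss_le v s (fun m => f m - mps_term X (fun=> 0) a b.+2 m) ((C * v d) * (C * v d)).
    apply: (gauss_leB s0).
      apply: gauss_leW hf; rewrite 2!exprS mulrA ler_piMr ?exprn_ile1 //.
      exact: mulr_ge0.
    by apply: gauss_leW h3; rewrite expr0n mulr_ge0.
  apply: gauss_leW (gauss_leZ d^-1 h4); rewrite nabsV.
  have -> : (v d)^-1 * (C * v d * (C * v d)) = C * C * v d by field; rewrite gt_eqF.
  rewrite /B ler_pdivlMr // -[leLHS]mulrA ler_wpM2l ?mulr_ge0 //.
  by rewrite -[leRHS]mulr1 ler_pM ?nabs_ge0.
apply: (gauss_leB s0 (f := fun m => c^-1 * (mps_term X (br c) a b.+2 m - mps_term X (fun=> 0) a b.+2 m))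
   (g := fun m => (t * c)^-1 * (mps_term X (br (t * c)) a b.+2 m - mps_term X (fun=> 0) a b.+2 m))).
  by apply: aux => //; rewrite ler_piMl // nabs_ge0.
apply: aux => //; last by rewrite mulf_neq0.
  by rewrite nabsM ler_piMl ?nabs_ge0.
by rewrite nabsM.
Qed.

End LubinTateBounds.

(** * The operators phi_q and sigma_a on the Robba ring *)

Section LubinTateRobba.
Variables (R : realType) (Qp : fieldType) (F : fieldExtType Qp) (L : fieldExtType F).
Variables (vF : nonarch_abs R F) (vL : complete_abs R L).
Hypothesis hL : forall x : F, vL x%:A = vF x.

Lemma mdeg1 n : @mdeg 1 [ffun=> n] = n.
Proof. by rewrite /mdeg big_ord1 ffunE. Qed.

Lemma robba_mpsE (f : mps F 1) : integral_mps vF f ->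
  (forall i, robba_mps vL f i = if i is Posz n then (Defs.coef1 f n)%:A else 0) /\
  (forall rho, 0 < rho -> conv_from vL rho (robba_mps vL f)).
Proof.
move=> hf.
have hc rho : 0 < rho -> conv_from vL rho
    (fun i : int => if i is Posz n then (Defs.coef1 f n)%:A else 0).
  move=> r0 s rs s1 eps e0; have s0 : 0 < s by exact: lt_le_trans rs.
  have [N hN] := expr_small (ltW s0) s1 e0.
  exists [fset Posz n | n in iota 0 N]%fset => -[n|n] hn; last by rewrite nabs0 mul0r.
  have Nn : (N <= n)%N.
    rewrite leqNgt; apply: contraNN hn => nN; apply/imfsetP; exists n => //=.
    by rewrite mem_iota.
  apply: le_lt_trans (hN _ Nn); rewrite hL -[leRHS]mul1r.
  by rewrite -exprnP ler_wpM2r ?exprn_ge0 ?(ltW s0) //; exact: hf.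
have e : robba_mps vL f = (fun i : int => if i is Posz n then (Defs.coef1 f n)%:A else 0)
    :> (int -> L).
  rewrite /robba_mps /robba_of; apply: insubdK; apply/robbaP.
  by exists (1/2); split; [lra|lra|apply: hc; lra].
by split=> [i|rho r0]; rewrite e //; exact: hc.
Qed.

Lemma circle_le_mps s (f : mps F 1) (g : robba vL) M : 0 <= M -> gauss_le vF s f M ->
  (forall i, g i = if i is Posz n then (Defs.coef1 f n)%:A else 0) -> circle_le s g M.
Proof.
move=> M0 hf hg [n|n]; rewrite hg; last by rewrite nabs0 mul0r.
by rewrite hL; have := hf [ffun=> n]; rewrite mdeg1.
Qed.

Lemma dominated_intro rho (e : nat) (h : robba vL) (a : L) : 0 < rho ->
  vL a = 1 -> conv_from vL rho h ->
  (forall s, rho <= s -> s < 1 -> exists2 th, th < 1 &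
     circle_le s (h - a *: mono vL e) (th * s ^ e)) -> dominated rho e h.
Proof.
move=> r0 va ch hs.
have a0 : a != 0 by rewrite -(nabs_eq0 vL) va oner_eq0.
exists a, (a^-1 *: (mono vL (- e%:Z) * h) - 1); split => //.
- rewrite addrC subrK robba_scaleAl robba_scaleAr scalerA divff // scale1r.
  by rewrite mulrA monoVx mul1r.
- apply: conv_fromB => //; last exact: conv_from1.
  by apply: conv_fromZ; apply: conv_fromM => //; exact: conv_from_mono.
move=> s rs s1; have s0 : 0 < s by exact: lt_le_trans rs.
have [th th1 hh] := hs _ rs s1; exists th => //.
have -> : a^-1 *: (mono vL (- e%:Z) * h) - 1 =
    a^-1 *: (mono vL (- e%:Z) * (h - a *: mono vL e)).
  rewrite mulrBr scalerBr robba_scaleAr scalerA mulVf // scale1r.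
  by rewrite [mono _ _ * mono _ _]mulrC monoVx.
have := circle_leZ a^-1 (circle_le_monoM (- e%:Z) s0 hh).
rewrite nabsV va invr1 mul1r -invr_expz mulrCA mulVf ?mulr1 //.
by rewrite gt_eqF // exprz_gt0.
Qed.

Variables (pi : F) (q : nat) (FG : mps F 2) (br : F -> mps F 1).
Hypotheses (hpi : uniformizer vF pi) (q2 : (1 < q)%N) (hFG : lubin_tate_group vF pi q FG br).

(** The leading coefficient a is a unit and the others are integral, so the higher terms are at most
    s^2, a factor s below the leading one. This holds on every circle inside the unit disc. *)
Lemma sigma_dominated a rho : vF a = 1 -> 0 < rho -> dominated rho 1 (robba_mps vL (br a)).
Proof.
move=> va r0; have va1 : vF a <= 1 by rewrite va.
have [hE hc] := robba_mpsE (lt_integral hFG va1).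
apply: (@dominated_intro _ _ _ a%:A) => //; [by rewrite hL|exact: hc|].
move=> s rs s1; have s0 : 0 < s by exact: lt_le_trans rs.
exists s => // -[n|n]; rewrite robbaB robbaZ monoE hE; last first.
  by rewrite mulr0 subr0 nabs0 mul0r mulr_ge0 // ltW.
case: n => [|[|n]].
- by rewrite (lt_coef0 hFG) // scale0r mulr0 subr0 nabs0 mul0r mulr_ge0 // ltW.
- by rewrite (lt_coef1 hFG) // mulr1 subrr nabs0 mul0r mulr_ge0 // ltW.
rewrite mulr0 subr0 hL -[leRHS]mul1r expr1z -exprnP 2!exprS [s * (s * _)]mulrA.
apply: ler_pM; rewrite ?nabs_ge0 ?mulr_ge0 ?exprn_ge0 ?(ltW s0) //.
  exact: (lt_integral hFG va1).
by rewrite ler_piMr ?mulr_ge0 ?exprn_ile1 // ltW.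
Qed.

(** [pi](u) - u^q is at most |pi| s on the circle, so u^q dominates as soon as s^(q-1) > |pi|, that
    is, near the outer boundary; the radius is chosen with r^(q-1) at least the midpoint of |pi| and
    1. *)
Lemma phi_dominated : exists rho, [/\ 0 < rho, rho < 1 & dominated rho q (robba_mps vL (br pi))].
Proof.
have [pi0 vpi _] := hpi; have vp0 := nabs_gt0 vF pi0.
have [hE hc] := robba_mpsE (lt_integral hFG (ltW vpi)).
have h1 : (vF pi + 1) / 2 < 1 by lra.
have h2 : (1/2 : R) < 1 by lra.
have [r hr [r1 rq]] := radius_ex q.-1 h2 h1.
have r0 : 0 < r by apply: lt_le_trans hr; lra.
exists r; split => //.
apply: (@dominated_intro _ _ _ 1) => //; [by rewrite nabs1|exact: hc|].
move=> s rs s1; have s0 : 0 < s by exact: lt_le_trans rs.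
have sq : vF pi < s ^+ q.-1.
  apply: lt_le_trans (_ : (vF pi + 1) / 2 <= _); first by lra.
  by apply: le_trans rq _; rewrite lerXn2r // nnegrE ltW.
have sq0 : 0 < s ^+ q.-1 by rewrite exprn_gt0.
exists (vF pi / s ^+ q.-1); first by rewrite ltr_pdivrMr // mul1r.
have -> : vF pi / s ^+ q.-1 * s ^ q = vF pi * s.
  rewrite -exprnP -[in s ^+ q](prednK (ltnW q2)) exprS; field.
  by rewrite gt_eqF.
have N0 : 0 <= vF pi * s by rewrite mulr_ge0 // ltW.
move=> [n|n]; rewrite robbaB robbaZ monoE hE mul1r; last first.
  by rewrite subr0 nabs0 mul0r.
have -> : (Defs.coef1 (br pi) n)%:A - (n%:Z == q%:Z)%:R =
    (Defs.coef1 (br pi) n - (n == q)%:R)%:A :> L.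
  rewrite scalerBl -[(n%:Z == q%:Z)]/(n == q)%N.
  by congr (_ - _); case: (n == q)%N; rewrite /= ?scale1r ?scale0r.
rewrite hL; case: n => [|n].
  have -> : (0%N == q) = false by apply/negbTE; rewrite eq_sym -lt0n ltnW.
  by rewrite (lt_coef0 hFG) ?subrr ?nabs0 ?mul0r // ltW.
apply: ler_pM; rewrite ?nabs_ge0 ?exprn_ge0 ?(ltW s0) ?(lt_frob hFG) //.
by rewrite -exprnP exprS ler_piMr ?exprn_ile1 // ltW.
Qed.

Lemma circle_le_sigma_mps s b M : 0 < s -> vF b <= 1 -> 0 <= M ->
  gauss_le vF s (fun m => br b m - mpsX F ord0 m) M ->
  circle_le s (robba_mps vL (br b) - mono vL 1) M.
Proof.
move=> s0 vb M0 hM; have [hE _] := robba_mpsE (lt_integral hFG vb).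
apply: circle_le_mps M0 hM _ => -[n|n]; rewrite robbaB hE monoE ?subr0 //.
have -> : Defs.coef1 (fun m => br b m - mpsX F ord0 m) n =
    Defs.coef1 (br b) n - (n == 1)%:R by rewrite -coef1_mpsX.
rewrite scalerBl -[(n%:Z == 1)]/(n == 1)%N; congr (_ - _).
by case: (n == 1)%N; rewrite /= ?scale1r ?scale0r.
Qed.

(** The relative increment [b](u)/u - 1, to which the near-identity estimates apply. *)
Let eps b := mono vL (- 1) * (robba_mps vL (br b) - mono vL 1).

Lemma sigma_epsE b : robba_mps vL (br b) = mono vL 1 * (1 + eps b).
Proof.
by rewrite /eps mulrDr mulr1 mulrA monoVx mul1r addrC subrK.
Qed.

Lemma circle_le_eps s b M : 0 < s -> vF b <= 1 -> 0 <= M ->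
  gauss_le vF s (fun m => br b m - mpsX F ord0 m) M ->
  circle_le s (eps b) (M / s).
Proof.
move=> s0 vb M0 hM.
have := circle_le_monoM (- 1) s0 (circle_le_sigma_mps s0 vb M0 hM).
by rewrite exprN1 [_ * M]mulrC.
Qed.

(** Through [b](u) = u (1 + eps) the bounds on [1 + c] become operator bounds. The second part
    compares difference quotients of sigma at 1 in the directions c and tc: it is the F-analyticity
    of the action in quantitative form. *)
Lemma sigma_near1 s : 0 < s -> s < 1 -> exists2 C, 0 < C &
  (forall c rho (f : robba vL) M, vF c <= 1 -> C * vF c < 1 -> vF (1 + c) = 1 ->
     0 < rho -> rho <= s -> conv_from vL rho f -> circle_le s f M ->
     circle_le s (robba_comp vL (br (1 + c)) f - f) (C * vF c * M)) /\
  (forall c t rho (f : robba vL) M, c != 0 -> t != 0 -> vF c <= 1 -> vF t <= 1 -> C * vF c < 1 ->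
     vF (1 + c) = 1 -> vF (1 + t * c) = 1 ->
     0 < rho -> rho <= s -> conv_from vL rho f -> circle_le s f M ->
     circle_le s ((c^-1)%:A *: (robba_comp vL (br (1 + c)) f - f) -
                  ((t * c)^-1)%:A *: (robba_comp vL (br (1 + t * c)) f - f))
               (C * vF c / vF t * M)).
Proof.
move=> s0 s1; have [C0 C00 hC0] := lt_growth hpi q2 hFG s0 s1.
(* Dividing by u costs 1/s, hence D; the summand D^2 of C below absorbs the second-order terms. *)
pose D := C0 / s; have D0 : 0 < D by rewrite divr_gt0.
have DD0 : 0 <= D * D by rewrite mulr_ge0 // ltW.
have CD : C0 <= D by rewrite ler_pdivlMr // ler_piMr // ltW.
pose C := D + D * D; have C_0 : 0 < C by rewrite addr_gt0 // mulr_gt0.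
have DC : D <= C by rewrite lerDl mulr_ge0 // ltW.
have DDC : D * D <= C by rewrite lerDr ltW.
have C0C : C0 <= C by exact: le_trans DC.
have small c : C * vF c < 1 -> C0 * vF c <= 1 /\ D * vF c < 1.
  move=> h; split.
    by apply: le_trans (ltW h); rewrite ler_wpM2r ?nabs_ge0.
  by apply: le_lt_trans h; rewrite ler_wpM2r ?nabs_ge0.
have near c : vF c <= 1 -> C * vF c < 1 -> vF (1 + c) = 1 ->
    circle_le s (eps (1 + c)) (D * vF c).
  move=> vc Cc v1c; have [h1 _] := small _ Cc.
  have M0 : 0 <= C0 * vF c by rewrite mulr_ge0 ?nabs_ge0 // ltW.
  have -> : D * vF c = C0 * vF c / s by rewrite /D mulrAC.
  apply: circle_le_eps; rewrite ?v1c //.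
  case: (eqVneq c 0) => [->|c0]; last by apply: (lt_near1 hFG) => //; exact: hC0.
  by move=> m; rewrite addr0 (lt_1 hFG) subrr nabs0 mul0r mulr0.
exists C => //; split.
  move=> c rho f M vc Cc v1c r0 rs cf fM.
  have [_ h2] := small _ Cc.
  have r1 : rho < 1 by exact: le_lt_trans s1.
  have hd := sigma_dominated v1c r0.
  apply: circle_leW (circle_le_subst_sub r0 rs s1 cf fM hd (sigma_epsE _) (near _ vc Cc v1c) h2).
  by rewrite ler_wpM2r ?(circle_le_ge0 fM) // ler_wpM2r ?nabs_ge0.
move=> c t rho f M c0 t0 vc vt Cc v1c v1tc r0 rs cf fM.
have vc0 := nabs_gt0 vF c0; have vt0 := nabs_gt0 vF t0.
have vtc : vF (t * c) <= vF c by rewrite nabsM ler_piMl // ltW.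
have Ctc : C * vF (t * c) < 1 by apply: le_lt_trans Cc; rewrite ler_wpM2l // ltW.
have vtc1 := le_trans vtc vc.
have [h1 h2] := small _ Cc; have [h1' h2'] := small _ Ctc.
have hd := sigma_dominated v1c r0; have hd' := sigma_dominated v1tc r0.
have tc0 : t * c != 0 by rewrite mulf_neq0.
have vct : vF c <= vF c / vF t by rewrite ler_pdivlMr // ler_piMr // ltW.
apply: (circle_le_subst_sub2 r0 rs s1 cf fM hd (sigma_epsE _) (near _ vc Cc v1c) h2
  hd' (sigma_epsE _) (near _ vtc1 Ctc v1tc) h2').
- rewrite hL nabsV.
  have -> : (vF c)^-1 * (D * vF c * (D * vF c)) = D * D * vF c by field; rewrite gt_eqF.
  by rewrite -[leRHS]mulrA; apply: ler_pM => //; exact: nabs_ge0.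
- rewrite hL nabsV.
  have -> : (vF (t * c))^-1 * (D * vF (t * c) * (D * vF (t * c))) = D * D * vF (t * c).
    by field; rewrite nabs_eq0.
  by rewrite -[leRHS]mulrA; apply: ler_pM => //; [exact: nabs_ge0|exact: le_trans vct].
have -> : (c^-1)%:A *: eps (1 + c) - ((t * c)^-1)%:A *: eps (1 + t * c) =
   mono vL (- 1) * ((c^-1)%:A *: (robba_mps vL (br (1 + c)) - mono vL 1) -
     ((t * c)^-1)%:A *: (robba_mps vL (br (1 + t * c)) - mono vL 1)).
  rewrite /eps; move: (robba_mps vL (br (1 + c)) - mono vL 1) (robba_mps vL (br (1 + t * c)) - mono vL 1).
  by move=> x y; rewrite [RHS]mulrBr !robba_scaleAr.
have hg := lt_near1_cmp hFG s0 s1 c0 vc t0 vt h1 (hC0 _ c0 vc h1) (hC0 _ tc0 vtc1 h1').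
have B0 : 0 <= C0 * C0 * vF c / vF t.
  by rewrite divr_ge0 ?mulr_ge0 ?nabs_ge0 // ltW.
have [hE _] := robba_mpsE (lt_integral hFG (a := 1 + c) ltac:(by rewrite v1c)).
have [hE' _] := robba_mpsE (lt_integral hFG (a := 1 + t * c) ltac:(by rewrite v1tc)).
have hin : circle_le s ((c^-1)%:A *: (robba_mps vL (br (1 + c)) - mono vL 1) -
     ((t * c)^-1)%:A *: (robba_mps vL (br (1 + t * c)) - mono vL 1)) (C0 * C0 * vF c / vF t).
  apply: (circle_le_mps B0 hg) => i.
  rewrite -robba_coef_lin !robbaB hE hE' monoE; case: i => [n|n]; last first.
    by rewrite subr0 !mulr0 addr0.
  have -> : Defs.coef1 (fun m => c^-1 * (br (1 + c) m - mpsX F ord0 m) -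
      (t * c)^-1 * (br (1 + t * c) m - mpsX F ord0 m)) n =
    c^-1 * (Defs.coef1 (br (1 + c)) n - (n == 1)%:R) -
    (t * c)^-1 * (Defs.coef1 (br (1 + t * c)) n - (n == 1)%:R) by rewrite -coef1_mpsX.
  have e1 : ((n%:Z == 1)%:R : L) = ((n == 1)%:R : F)%:A.
    by rewrite -[(n%:Z == 1)]/(n == 1)%N; case: (n == 1)%N; rewrite /= ?scale1r ?scale0r.
  rewrite e1 -!scalerBl mulNr !mulr_algl !scalerA -scalerBl.
  by [].
have := circle_le_monoM (- 1) s0 hin; apply: circle_leW.
rewrite exprN1 [_ * _]mulrC ler_pdivrMr //.
have -> : C * vF c / vF t * s = (C * s) * (vF c / vF t) by ring.
have -> : C0 * C0 * vF c / vF t = (C0 * C0) * (vF c / vF t) by ring.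
rewrite ler_wpM2r ?divr_ge0 ?nabs_ge0 //.
apply: le_trans (_ : D * D * s <= _); last by rewrite ler_wpM2r // ltW.
by rewrite /D mulrAC [C0 / s * s]divfK ?gt_eqF // ler_wpM2l // ltW.
Qed.

End LubinTateRobba.

(** * p-power iteration and binomial series *)

Section PPowers.
Variables (R : realType) (K : fieldType) (v : complete_abs R K) (p : nat).
Hypotheses (p1 : (1 < p)%N) (vp : v p%:R = p%:R^-1).

Let P : R := p%:R^-1.
Let P0 : 0 < P. Proof. by rewrite invr_gt0 ltr0n ltnW. Qed.
Let P1 : P < 1. Proof. by rewrite invf_lt1 ?ltr0n ?ltr1n // ltnW. Qed.
Let PP1 : P ^+ 2 < P. Proof. by rewrite expr2 -[ltRHS]mulr1 ltr_pM2l. Qed.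
Let PPle1 : P ^+ 2 <= 1. Proof. by rewrite exprn_ile1 // ltW. Qed.

(** The sum is p plus terms x^i - 1 of absolute value at most p^-2, strictly below |p|. *)
Lemma nabs_geom x : v (x - 1) <= P ^+ 2 -> v (\sum_(i < p) x ^+ i) = P.
Proof.
move=> h.
have -> : \sum_(i < p) x ^+ i = p%:R + \sum_(i < p) (x ^+ i - 1).
  by rewrite sumrB sumr_const card_ord addrC subrK.
rewrite nabs_dom ?vp //; apply: le_lt_trans PP1.
apply: nabs_sum_le => [|i _]; first by rewrite exprn_ge0 // ltW.
apply: le_trans (nabs_exp_sub1 _ _) (h); exact: le_trans h PPle1.
Qed.

Lemma nabs_ppow_sub1 x m : v (x - 1) <= P ^+ 2 -> v (x ^+ (p ^ m) - 1) = P ^+ m * v (x - 1).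
Proof.
move=> h; elim: m => [|m IH]; first by rewrite expr0 mul1r expr1.
rewrite expnSr exprM subrX1 nabsM nabs_geom ?IH; first by rewrite exprSr mulrAC.
by apply: le_trans h; rewrite ler_piMl ?nabs_ge0 // exprn_ile1 // ltW.
Qed.

Lemma nabs_ppow_sub1_le x m : v (x - 1) <= P ^+ 2 -> v (x ^+ (p ^ m) - 1) <= P ^+ 2.
Proof.
move=> h; rewrite nabs_ppow_sub1 //; apply: le_trans h.
by rewrite ler_piMl ?nabs_ge0 // exprn_ile1 // ltW.
Qed.

(** Since p^-m (x^(p^m) - 1) tends to log x, the limit in m is log d / log a. *)
Definition ppow_ratio (d a : K) m := (d ^+ (p ^ m) - 1) / (a ^+ (p ^ m) - 1).

Lemma ppow_ratio_cvg d a : a != 1 -> v (a - 1) <= P ^+ 2 -> v (d - 1) <= P ^+ 2 ->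
  exists l, nabs_cvg v (ppow_ratio d a) l.
Proof.
move=> a1 ha hd; apply: cabs_complete; apply: nabs_cauchyS => e e0.
have va0 : 0 < v (a - 1) by rewrite nabs_gt0 // subr_eq0.
have C0 : 0 <= v (d - 1) / v (a - 1) by rewrite divr_ge0 // nabs_ge0.
set C := _ / _ in C0.
have [N hN] := expr_small (ltW P0) P1 (eps := e / (C + 1)) ltac:(apply: divr_gt0 => //; lra).
exists N => m /hN hm.
have vam : v (a ^+ (p ^ m) - 1) = P ^+ m * v (a - 1) by exact: nabs_ppow_sub1.
have vdm : v (d ^+ (p ^ m) - 1) = P ^+ m * v (d - 1) by exact: nabs_ppow_sub1.
have Pm : 0 < P ^+ m by rewrite exprn_gt0.
have yE : v (ppow_ratio d a m) = C.
  rewrite nabsM nabsV vam vdm /C; field.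
  by rewrite !gt_eqF.
have am := nabs_ppow_sub1_le m ha; have dm := nabs_ppow_sub1_le m hd.
have am0 : a ^+ (p ^ m) - 1 != 0 by rewrite -(nabs_eq0 v) vam gt_eqF // mulr_gt0.
(* A and B are the factors by which denominator and numerator grow from m to m + 1. Both are p up to
   an error of size P^(m+2), so the relative increment (B - A)/A is small. *)
pose A := \sum_(i < p) (a ^+ (p ^ m)) ^+ i; pose B := \sum_(i < p) (d ^+ (p ^ m)) ^+ i.
have vA : v A = P by exact: nabs_geom.
have A0 : A != 0 by rewrite -(nabs_eq0 v) vA gt_eqF.
have -> : ppow_ratio d a m.+1 - ppow_ratio d a m = A^-1 * (B - A) * ppow_ratio d a m.
  rewrite /ppow_ratio expnSr !exprM (subrX1 (d ^+ _)) (subrX1 (a ^+ _)) -/A -/B.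
  by field; rewrite am0.
have vBA : v (B - A) <= P ^+ m * P ^+ 2.
  rewrite -sumrB; apply: nabs_sum_le => [|i _].
    by rewrite mulr_ge0 ?exprn_ge0 // ltW.
  have -> : (d ^+ (p ^ m)) ^+ i - (a ^+ (p ^ m)) ^+ i =
     ((d ^+ (p ^ m)) ^+ i - 1) - ((a ^+ (p ^ m)) ^+ i - 1) by ring.
  apply: nabs_leB; apply: le_trans (nabs_exp_sub1 _ _) _; rewrite ?vam ?vdm.
  - by apply: le_trans PPle1; rewrite -vdm.
  - by rewrite ler_wpM2l // ltW.
  - by apply: le_trans PPle1; rewrite -vam.
  - by rewrite ler_wpM2l // ltW.
rewrite nabsM yE nabsM nabsV vA.
apply: le_lt_trans (_ : P^-1 * (P ^+ m * P ^+ 2) * C < e).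
  by rewrite ler_wpM2r // ler_wpM2l // invr_ge0 ltW.
have -> : P^-1 * (P ^+ m * P ^+ 2) * C = P ^+ m * (P * C) by field; rewrite gt_eqF.
move: hm; rewrite ltr_pdivlMr; last by lra.
move=> hm; apply: le_lt_trans hm; rewrite ler_wpM2l ?(ltW Pm) //.
by apply: le_trans (_ : C <= _); [rewrite ler_piMl // ltW|lra].
Qed.

End PPowers.

(** * Generalized binomial series *)

Lemma nullfam_geom (R : realType) (u : nat -> R) (th : R) : 0 <= th -> th < 1 ->
  (forall n, u n <= th ^+ n) -> nullfam u.
Proof.
move=> t0 t1 h e e0; have [N hN] := expr_small t0 t1 e0.
exists [fset n | n in iota 0 N]%fset => n hn; apply: le_lt_trans (h n) (hN _ _).
rewrite leqNgt; apply: contraNN hn => nN; apply/imfsetP; exists n => //=.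
by rewrite mem_iota.
Qed.

(** In Legendre's sum each quotient is at most half the previous one, as p >= 2; the induction keeps
    the last quotient n / p^m as slack. *)
Lemma logn_fact_le p n : prime p -> (logn p n`! <= n)%N.
Proof.
move=> pp; rewrite logn_fact //.
suff H m : (\sum_(1 <= k < m.+1) n %/ p ^ k + n %/ p ^ m <= n)%N.
  by apply: leq_trans (H n); exact: leq_addr.
elim: m => [|m IH]; first by rewrite big_geq // expn0 divn1.
rewrite big_nat_recr //= -addnA; apply: leq_trans IH; rewrite leq_add2l.
rewrite expnSr divnMA; set k := (n %/ p ^ m)%N.
have : (k %/ p * 2 <= k)%N.
  by apply: leq_trans (leq_trunc_div k p); rewrite leq_mul2l prime_gt1 ?orbT.
lia.
Qed.

Section HasSumShift.
Variables (R : realType) (K : fieldType) (v : nonarch_abs R K).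

Lemma has_sum_shift (f g : nat -> K) l : g 0%N = 0 -> (forall n, g n.+1 = f n) ->
  has_sum v f l -> has_sum v g l.
Proof.
move=> g0 gS hf e e0; have [A hA] := hf e e0.
exists [fset n.+1 | n in A]%fset => B AB.
have sub : (A `<=` [fset n.-1 | n in (B `\ 0)%fset])%fset.
  apply/fsubsetP => n nA; apply/imfsetP; exists n.+1 => //.
  rewrite !inE /=; apply: (fsubsetP AB); apply/imfsetP; by exists n.
have := hA _ sub.
rewrite big_imfset /=; last first.
  move=> [|x] [|y]; rewrite !inE //= => _ _ -> //.
have -> : \sum_(i <- (B `\ 0)%fset) f i.-1 = \sum_(i <- B) g i; last by [].
transitivity (\sum_(i <- (B `\ 0)%fset) g i).
  rewrite big_seq [RHS]big_seq; apply: eq_bigr => -[|i]; rewrite !inE //.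
apply: big_fset_incl; first by apply/fsubsetP => x; rewrite !inE => /andP[].
by move=> x xB; rewrite !inE xB andbT negbK => /eqP ->.
Qed.

Lemma has_sum_shiftn (f g : nat -> K) l i : (forall n, (n < i)%N -> g n = 0) ->
  (forall m, g (i + m)%N = f m) -> has_sum v f l -> has_sum v g l.
Proof.
elim: i f g => [|i IH] f g gz gS hf.
  by apply: eq_has_sum hf => // n; rewrite -gS.
have h : has_sum v (fun n => g n.+1) l.
  by apply: (IH f) hf => [n ni|m]; [exact: gz|rewrite -gS].
by apply: has_sum_shift h => //; exact: gz.
Qed.

Lemma has_sum_ord (f : nat -> K) n : (forall i, (n <= i)%N -> f i = 0) ->
  has_sum v f (\sum_(i < n) f i).
Proof.
elim: n f => [|n IH] f f0.
  rewrite big_ord0 -(big_seq_fset0 +%R f); apply: has_sum_fin => i _; exact: f0.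
rewrite big_ord_recl.
have h1 := @has_sum1 _ _ v _ 0%N (fun i => if i is 0%N then f 0%N else 0).
have h2 : has_sum v (fun i => if i is m.+1 then f m.+1 else 0) (\sum_(i < n) f i.+1).
  by apply: has_sum_shift (IH (fun i => f i.+1) _) => // i ni; exact: f0.
apply: eq_has_sum (has_sumD (h1 _) h2) => // -[|i] //=; by rewrite ?addr0 ?add0r.
Qed.

End HasSumShift.

Section BinomialSeries.
Variables (R : realType) (K : fieldType) (v : complete_abs R K) (p : nat).
Hypotheses (pp : prime p) (vn : forall n : nat, (0 < n)%N -> v n%:R = p%:R ^- logn p n).

Let P : R := p%:R^-1.
Let p0 : 0 < (p%:R : R). Proof. by rewrite ltr0n prime_gt0. Qed.
Let P0 : 0 < P. Proof. by rewrite invr_gt0. Qed.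
Let P1 : P < 1. Proof. by rewrite invf_lt1 // ltr1n prime_gt1. Qed.

Lemma padic_natr_neq0 n : n.+1%:R != 0 :> K.
Proof.
by rewrite -(nabs_eq0 v) vn // gt_eqF // invr_gt0 exprn_gt0.
Qed.

Lemma nabs_padic_prime : v p%:R = P.
Proof. by rewrite vn ?prime_gt0 // logn_prime // eqxx expr1. Qed.

Definition gbinom (k : K) (n : nat) := \prod_(i < n) ((k - i%:R) / i.+1%:R).

Lemma gbinom0 k : gbinom k 0 = 1. Proof. by rewrite /gbinom big_ord0. Qed.

Lemma gbinomS k n : gbinom k n.+1 = gbinom k n * ((k - n%:R) / n.+1%:R).
Proof. by rewrite /gbinom big_ord_recr. Qed.

Lemma gbinom_absorb k n : gbinom k n.+1 = k / n.+1%:R * gbinom (k - 1) n.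
Proof.
elim: n => [|n IH]; first by rewrite gbinomS !gbinom0 mul1r subr0 mulr1.
rewrite gbinomS IH [gbinom (k - 1) n.+1]gbinomS.
have n1 := padic_natr_neq0 n; have n2 := padic_natr_neq0 n.+1.
have -> : k - n.+1%:R = k - 1 - n%:R by rewrite -natr1; ring.
move: (k - 1 - n%:R) n1 n2 => w; move: (n.+1%:R) (n.+2%:R) => x y x0 y0.
by field; rewrite x0.
Qed.

Lemma gbinom_pascal k n : gbinom k n.+1 = gbinom (k - 1) n.+1 + gbinom (k - 1) n.
Proof.
rewrite gbinom_absorb gbinomS.
have n1 := padic_natr_neq0 n.
apply: (mulIf n1); rewrite mulrDl mulrAC -(mulrA (gbinom _ _)) !divfK //.
rewrite -natr1; ring.
Qed.

(** In the double expansion of a product of two series, this identity lets the terms with i fixed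
    sum to a series of exponent k - i. *)
Lemma gbinom_mul_bin k i m :
  gbinom k (i + m) * 'C(i + m, i)%:R = gbinom k i * gbinom (k - i%:R) m.
Proof.
elim: m => [|m IH]; first by rewrite addn0 binn gbinom0.
have n1 := padic_natr_neq0 m; have n2 := padic_natr_neq0 (i + m).
rewrite addnS gbinomS [gbinom (k - _) m.+1]gbinomS [RHS]mulrA -IH.
have e : 'C((i + m).+1, i)%:R * m.+1%:R = 'C(i + m, i)%:R * (i + m).+1%:R :> K.
  rewrite -!natrM; congr _%:R; rewrite mulnC [RHS]mulnC mul_bin_down.
  by congr (_ * _)%N; lia.
have -> : 'C((i + m).+1, i)%:R = 'C(i + m, i)%:R * (i + m).+1%:R / m.+1%:R :> K.
  by rewrite -e mulfK.
have -> : k - (i + m)%:R = k - i%:R - m%:R by rewrite natrD; ring.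
move: ('C(i + m, i)%:R : K) (k - i%:R - m%:R) (gbinom k (i + m)) n1 n2 => c w g.
move: (m.+1%:R) ((i + m).+1%:R) => x y x0 y0.
by field; rewrite x0.
Qed.

(** Each factor k - j is at most M because M >= 1, and 1/|n!| <= p^n by Legendre's formula. *)
Lemma nabs_gbinom (k : K) (M : R) n : 1 <= M -> v k <= M -> v (gbinom k n) <= (M / P) ^+ n.
Proof.
move=> M1 kM.
have -> : gbinom k n = (\prod_(i < n) (k - i%:R)) / n`!%:R.
  elim: n => [|n IH]; first by rewrite gbinom0 big_ord0 fact0 divr1.
  by rewrite gbinomS IH big_ord_recr /= factS natrM invfM; ring.
rewrite nabsM nabsV vn ?fact_gt0 // invrK expr_div_n.
apply: ler_pM; rewrite ?nabs_ge0 ?exprn_ge0 ?(ltW p0) //.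
  elim: n => [|n IH]; first by rewrite big_ord0 nabs1.
  rewrite big_ord_recr nabsM exprSr; apply: ler_pM; rewrite ?nabs_ge0 //.
  by apply: nabs_leB => //; apply: le_trans M1; exact: nabs_nat.
rewrite /P exprVn invrK ler_eXn2l ?ltr1n ?prime_gt1 //.
exact: logn_fact_le.
Qed.

Section Convergence.
Variables (M : R) (M1 : 1 <= M).
(** The growth rate of the coefficients given by [nabs_gbinom]: the series converges where Q |z| <
    1. *)
Let Q := M / P.
Let Q0 : 0 < Q. Proof. by apply: divr_gt0 P0; apply: lt_le_trans M1. Qed.
Implicit Types (k z : K).

Definition binom_series k z := nsum v (fun n : nat => gbinom k n * z ^+ n).

Lemma gbinom_term_le k z n : v k <= M -> v (gbinom k n * z ^+ n) <= (Q * v z) ^+ n.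
Proof.
move=> kM; rewrite nabsM nabsX exprMn ler_wpM2r ?exprn_ge0 ?nabs_ge0 //.
exact: nabs_gbinom.
Qed.

Lemma has_binom_series k z : v k <= M -> Q * v z < 1 ->
  has_sum v (fun n : nat => gbinom k n * z ^+ n) (binom_series k z).
Proof.
move=> kM z1; apply: has_nsum; apply: nullfam_geom z1 _.
  by rewrite mulr_ge0 ?nabs_ge0 // ltW.
by move=> n; exact: gbinom_term_le.
Qed.

Lemma binom_series_pascal k z : v k <= M -> Q * v z < 1 ->
  (1 + z) * binom_series (k - 1) z = binom_series k z.
Proof.
move=> kM z1; have k1M : v (k - 1) <= M by apply: nabs_leB; rewrite ?nabs1.
have h := has_binom_series k1M z1.
apply: has_sum_unique (has_binom_series kM z1).
have hs : has_sum v (fun n => if n is m.+1 then z * (gbinom (k - 1) m * z ^+ m) else 0)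
    (z * binom_series (k - 1) z).
  by apply: has_sum_shift (has_sumZ z h).
apply: eq_has_sum (has_sumD h hs) => [[|n]|]; last by ring.
  by rewrite /= addr0 !gbinom0.
by rewrite /= [gbinom k _]gbinom_pascal exprS; ring.
Qed.

Lemma binom_series_pascaln k z i : v k <= M -> Q * v z < 1 ->
  (1 + z) ^+ i * binom_series (k - i%:R) z = binom_series k z.
Proof.
move=> kM z1; elim: i => [|i IH]; first by rewrite subr0 mul1r.
have kiM : v (k - i%:R) <= M.
  by apply: nabs_leB => //; apply: le_trans M1; exact: nabs_nat.
have -> : k - i.+1%:R = k - i%:R - 1 by rewrite -natr1; ring.
by rewrite -IH -(binom_series_pascal kiM z1) exprSr mulrA.
Qed.

(* Expand (1 + z' + z (1 + z'))^k in powers of z (1 + z') and use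
   (1 + z')^i (1 + z')^(k - i) = (1 + z')^k. *)
Lemma binom_seriesM k z z' : v k <= M -> Q * v z <= P * P -> Q * v z' <= P * P ->
  binom_series k z * binom_series k z' = binom_series k (z' + z * (1 + z')).
Proof.
move=> kM hz hz'.
have PP1 : P * P < 1 by rewrite -expr2 exprn_ilt1 // ltW.
have z1 := le_lt_trans hz PP1; have z1' := le_lt_trans hz' PP1.
have Q1 : 1 <= Q.
  by rewrite ler_pdivlMr // mul1r (le_trans (ltW P1)).
have vle1 x : Q * v x < 1 -> v x <= 1.
  move=> h; apply: le_trans (ltW h); rewrite ler_peMl ?nabs_ge0 //.
have vz'1 : v (1 + z') <= 1 by apply: nabs_leD; rewrite ?nabs1 // vle1.
have vw : v (z * (1 + z')) <= v z by rewrite nabsM ler_piMr ?nabs_ge0.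
pose r := Num.max (v z) (v z').
have r0 : 0 <= r by rewrite le_max nabs_ge0.
have Qr : Q * r <= P * P by rewrite /r maxr_pMr ?(ltW Q0) // ge_max hz hz'.
pose w := z * (1 + z').
have wr : v w <= r by apply: le_trans vw _; rewrite le_max lexx.
have z'r : v z' <= r by rewrite le_max lexx orbT.
pose T (x : nat * nat) := gbinom k x.1 * ('C(x.1, x.2)%:R * (z' ^+ (x.1 - x.2) * w ^+ x.2)).
have nP : nullfam (fun n : nat => P ^+ n) by apply: (nullfam_geom (ltW P0) P1).
have nT : nullfam (v \o T).
  apply: (nullfam_le _ (nullfam_prod _ _ nP nP)) => [[n i]|n|n] /=; try by rewrite exprn_ge0 // ltW.
  rewrite /T /=; case: (leqP i n) => ni; last first.
    by rewrite bin_small // mul0r mulr0 nabs0 mulr_ge0 // exprn_ge0 // ltW.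
  (* Here Q r <= P^2 matters, beyond Q r < 1: one factor P^n handles the index n, the other is at
     most P^i since i <= n, so the double family lies below a product of two null families. *)
  apply: (@le_trans _ _ ((P * P) ^+ n)); last first.
    rewrite exprMn ler_wpM2l ?exprn_ge0 ?(ltW P0) //.
    by apply: ler_wiXn2l => //; exact: ltW.
  apply: (@le_trans _ _ ((Q * r) ^+ n)); last first.
    by apply: lerXn2r => //; rewrite nnegrE mulr_ge0 // ltW.
  rewrite nabsM [leRHS]exprMn; apply: ler_pM; rewrite ?nabs_ge0 //; first exact: nabs_gbinom.
  rewrite nabsM -[leRHS]mul1r; apply: ler_pM; rewrite ?nabs_ge0 //; first exact: nabs_nat.
  rewrite nabsM !nabsX -{2}(subnK ni) exprD; apply: ler_pM; rewrite ?exprn_ge0 ?nabs_ge0 //.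
    by apply: lerXn2r; rewrite ?nnegrE ?nabs_ge0.
  by apply: lerXn2r; rewrite ?nnegrE ?nabs_ge0.
have hT := has_nsum nT; set l := nsum v T in hT.
have h1 : has_sum v (fun n => gbinom k n * (z' + w) ^+ n) l.
  apply: has_sum_fubini nT _ hT => n; rewrite /T /=; apply: has_sumZ.
  have := @has_sum_ord _ _ v (fun i => 'C(n, i)%:R * (z' ^+ (n - i) * w ^+ i)) n.+1.
  have -> : \sum_(i < n.+1) ('C(n, i)%:R * (z' ^+ (n - i) * w ^+ i)) = (z' + w) ^+ n.
    by rewrite exprDn; apply: eq_bigr => i _; rewrite mulr_natl.
  by apply => i ni; rewrite bin_small // mul0r.
have e1 : binom_series k (z' + w) = l.
  apply: has_sum_unique (has_binom_series kM _) h1.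
  apply: le_lt_trans PP1; apply: le_trans Qr; rewrite ler_wpM2l ?(ltW Q0) //.
  exact: nabs_leD.
rewrite -/w e1.
have hswap : bijective (fun x : nat * nat => (x.2, x.1)).
  by exists (fun x => (x.2, x.1)) => -[].
have swinj : injective (fun x : nat * nat => (x.2, x.1)).
  exact: bij_inj.
have h2 : has_sum v (fun i => binom_series k z' * (gbinom k i * z ^+ i)) l.
  apply: has_sum_fubini (nullfam_comp swinj nT) _ (has_sum_reindex hswap hT) => i.
  have kiM : v (k - i%:R) <= M.
    by apply: nabs_leB => //; apply: le_trans M1; exact: nabs_nat.
  apply: (@has_sum_shiftn _ _ _ (fun m => (gbinom k i * w ^+ i) * (gbinom (k - i%:R) m * z' ^+ m)) _ _ i).
  - by move=> n ni; rewrite /T /= bin_small // mul0r mulr0.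
  - move=> m; rewrite /T /= addKn mulrA gbinom_mul_bin; ring.
  rewrite -(binom_series_pascaln i kM z1').
  have -> : (1 + z') ^+ i * binom_series (k - i%:R) z' * (gbinom k i * z ^+ i) =
     (gbinom k i * w ^+ i) * binom_series (k - i%:R) z' by rewrite /w exprMn; ring.
  exact: has_sumZ (has_binom_series kiM z1').
rewrite mulrC; apply: has_sum_unique h2.
exact: has_sumZ (has_binom_series kM z1).
Qed.

Lemma binom_seriesX k z n : v k <= M -> Q * v z <= P * P ->
  binom_series k z ^+ n = binom_series k ((1 + z) ^+ n - 1).
Proof.
move=> kM hz.
have Q1 : 1 <= Q by rewrite ler_pdivlMr // mul1r (le_trans (ltW P1)).
have vz1 : v z <= 1.
  have PP1 : P * P < 1 by rewrite -expr2 exprn_ilt1 // ltW.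
  by apply: le_trans (ltW (le_lt_trans hz PP1)); rewrite ler_peMl ?nabs_ge0.
elim: n => [|n IH].
  rewrite !expr0 subrr /binom_series; symmetry; apply: nsumE.
  have := @has_sum1 _ _ v _ 0%N (fun n => gbinom k n * 0 ^+ n).
  rewrite gbinom0 mul1r expr0; apply => i i0; by rewrite expr0n (negbTE i0) mulr0.
rewrite exprS IH binom_seriesM //.
  by congr binom_series; rewrite exprS; ring.
apply: le_trans hz; rewrite ler_wpM2l ?(ltW Q0) //.
have := @nabs_exp_sub1 _ _ v (1 + z) n; rewrite addrAC subrr add0r; exact.
Qed.

Lemma binom_series_approx k z : v k <= M -> Q * v z <= P * P ->
  v (binom_series k z - 1) <= Q * v z /\
  v (binom_series k z - 1 - k * z) <= (Q * v z) ^+ 2.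
Proof.
move=> kM hz.
have PP1 : P * P < 1 by rewrite -expr2 exprn_ilt1 // ltW.
have z1 := le_lt_trans hz PP1.
have z0 : 0 <= Q * v z by rewrite mulr_ge0 ?nabs_ge0 // ltW.
have h := has_binom_series kM z1.
have hm (n0 : nat) (c : K) : has_sum v (fun n : nat => - (if n == n0 then c else 0)) (- c).
  have := @has_sum1 _ _ v _ n0 (fun n => - (if n == n0 then c else 0)).
  by rewrite eqxx; apply => n /negbTE ->; rewrite oppr0.
have g1 : gbinom k 1 * z ^+ 1 = k * z by rewrite gbinomS gbinom0 mul1r subr0 divr1 expr1.
have h1 := has_sumD h (hm 0%N 1); split.
  apply: (has_sum_le z0 _ h1) => -[|n] /=.
    by rewrite gbinom0 mul1r expr0 subrr nabs0.
  rewrite subr0; apply: le_trans (gbinom_term_le _ _ kM) _.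
  by rewrite exprS ler_piMr // exprn_ile1 // ltW.
have h2 := has_sumD h1 (hm 1%N (k * z)).
apply: (has_sum_le (exprn_ge0 2 z0) _ h2) => -[|[|n]] /=.
- by rewrite gbinom0 mul1r expr0 subrr subr0 nabs0 exprn_ge0.
- by rewrite g1 subr0 subrr nabs0 exprn_ge0.
rewrite !subr0; apply: le_trans (gbinom_term_le _ _ kM) _.
by rewrite -addn2 addnC exprD ler_piMr ?exprn_ge0 // exprn_ile1 // ltW.
Qed.

(** Let B be the value of the series and z_m = (1 + z)^(p^m) - 1. Both d^(p^m) and B^(p^m) equal 1 +
    k z_m up to o(p^-m): the first because k is the limit of the ratios, the second by the series.
    Raising to the power p^m shrinks |B - d| by exactly p^-m, so |B - d| is arbitrarily small. *)
Lemma binom_series_unique k d z : z != 0 -> v k <= M -> Q * v z <= P * P -> v (d - 1) <= P ^+ 2 ->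
  nabs_cvg v (ppow_ratio p d (1 + z)) k -> d = binom_series k z.
Proof.
move=> z0 kM hz hd hk.
have vp := nabs_padic_prime; have p1 := prime_gt1 pp.
have PP1 : P * P < 1 by rewrite -expr2 exprn_ilt1 // ltW.
have Q1 : 1 <= Q by rewrite ler_pdivlMr // mul1r (le_trans (ltW P1)).
have vz0 := nabs_gt0 v z0.
have vzQ : v z <= Q * v z by rewrite ler_peMl // ltW.
have vz : v (1 + z - 1) <= P ^+ 2.
  by rewrite addrAC subrr add0r expr2 (le_trans vzQ).
have [hB1 _] := binom_series_approx kM hz.
set B := binom_series k z in hB1 *.
have hB : v (B - 1) <= P ^+ 2 by rewrite expr2 (le_trans hB1).
have vd : v d = 1 by apply: nabs_near1; apply: le_lt_trans hd _; rewrite expr2.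
have d0 : d != 0 by rewrite -(nabs_eq0 v) vd oner_eq0.
(* The exact contraction is known near 1, so it is applied to the quotient. *)
pose x := B / d.
have vx : v (x - 1) = v (B - d).
  by rewrite -[LHS]mulr1 -vd -nabsM mulrBl mul1r /x divfK.
have vx2 : v (x - 1) <= P ^+ 2.
  by rewrite vx; have -> : B - d = (B - 1) - (d - 1) by [ring]; exact: nabs_leB.
apply/eqP; rewrite eq_sym -subr_eq0; apply/eqP; apply: (@nabs_small _ _ v) => e e0.
have [N hN] := hk (e / v z) ltac:(exact: divr_gt0).
have C0 : 0 < Q ^+ 2 * v z + 1 by rewrite ltr_wpDl // mulr_ge0 ?exprn_ge0 // ltW.
have [N' hN'] := expr_small (ltW P0) P1 (eps := e / (v z * (Q ^+ 2 * v z + 1)))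
  ltac:(by rewrite divr_gt0 // mulr_gt0).
pose m := maxn N N'.
have h1 := hN m (leq_maxl _ _); have h2 := hN' m (leq_maxr _ _).
pose zm := (1 + z) ^+ (p ^ m) - 1.
have vzm : v zm = P ^+ m * v z.
  have := @nabs_ppow_sub1 _ _ v p p1 vp (1 + z) m vz.
  by rewrite [1 + z - 1]addrAC subrr add0r.
have Pm : 0 < P ^+ m by rewrite exprn_gt0.
have zm0 : zm != 0 by rewrite -(nabs_eq0 v) vzm gt_eqF // mulr_gt0.
have vzm0 := nabs_gt0 v zm0.
have vzmle : v zm <= v z by rewrite vzm ler_piMl ?(ltW vz0) // exprn_ile1 // ltW.
have [_ hBm] := binom_series_approx (z := zm) kM ltac:(by apply: le_trans hz; rewrite ler_wpM2l // ltW).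
rewrite -(binom_seriesX _ kM hz) -/B in hBm.
have hx := @nabs_ppow_sub1 _ _ v p p1 vp x m vx2.
have e1 : v (B ^+ (p ^ m) - d ^+ (p ^ m)) = P ^+ m * v (B - d).
  have -> : B ^+ (p ^ m) - d ^+ (p ^ m) = (x ^+ (p ^ m) - 1) * d ^+ (p ^ m).
    by rewrite mulrBl mul1r -exprMn /x divfK.
  by rewrite nabsM nabsX vd expr1n mulr1 hx vx.
have e2 : v (B ^+ (p ^ m) - d ^+ (p ^ m)) < P ^+ m * e.
  have -> : B ^+ (p ^ m) - d ^+ (p ^ m) = (B ^+ (p ^ m) - 1 - k * zm) -
      (ppow_ratio p d (1 + z) m - k) * zm.
    by rewrite mulrBl /ppow_ratio -/zm divfK //; ring.
  apply: nabs_ltB.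
    apply: le_lt_trans hBm _; rewrite vzm.
    move: h2; rewrite ltr_pdivlMr ?mulr_gt0 // => h2.
    have -> : (Q * (P ^+ m * v z)) ^+ 2 = P ^+ m * (P ^+ m * (v z * (Q ^+ 2 * v z))) by ring.
    rewrite ltr_pM2l //; apply: le_lt_trans h2.
    by rewrite ler_wpM2l ?(ltW Pm) // ler_wpM2l ?(ltW vz0) //; lra.
  rewrite nabsM vzm mulrCA ltr_pM2l //.
  by rewrite -ltr_pdivlMr.
by move: e2; rewrite e1 ltr_pM2l.
Qed.

End Convergence.
End BinomialSeries.

(** * Non-analytic characters *)

Section NonAnalyticCharacter.
Variables (R : realType) (Qp : fieldType) (F : fieldExtType Qp) (L : fieldExtType F).
Variables (vF : nonarch_abs R F) (vL : complete_abs R L) (p : nat).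
Hypotheses (hL : forall x : F, vL x%:A = vF x) (pp : prime p).
Hypothesis vn : forall n : nat, (0 < n)%N -> vF n%:R = p%:R ^- logn p n.
Variables (delta : F -> L) (hd : continuous_char vF vL delta).

Let P : R := p%:R^-1.
Let p0 : 0 < (p%:R : R). Proof. by rewrite ltr0n prime_gt0. Qed.
Let P0 : 0 < P. Proof. by rewrite invr_gt0. Qed.
Let P1 : P < 1. Proof. by rewrite invf_lt1 // ltr1n prime_gt1. Qed.

Lemma nabs_ext_natr n : (0 < n)%N -> vL n%:R = p%:R ^- logn p n.
Proof. by move=> n0; rewrite -vn // -hL scaler_nat. Qed.

Lemma char1 : delta 1 = 1.
Proof.
have d0 := char_neq0 hd (oner_neq0 F).
by apply: (mulfI d0); rewrite -(char_mul hd) ?oner_neq0 // !mulr1.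
Qed.

Lemma charX a n : a != 0 -> delta (a ^+ n) = delta a ^+ n.
Proof.
move=> a0; elim: n => [|n IH]; first by rewrite !expr0 char1.
by rewrite !exprS (char_mul hd) ?expf_neq0 // IH.
Qed.

Lemma algX (a : F) n : (a ^+ n)%:A = a%:A ^+ n :> L.
Proof. by rewrite -!in_algE rmorphXn. Qed.

Lemma algM (a b : F) : (a * b)%:A = a%:A * b%:A :> L.
Proof. by rewrite -!in_algE rmorphM. Qed.

Lemma algB (a b : F) : (a - b)%:A = a%:A - b%:A :> L.
Proof. by rewrite -!in_algE rmorphB. Qed.

Lemma algV (a : F) : (a^-1)%:A = (a%:A)^-1 :> L.
Proof. by rewrite -!in_algE fmorphV. Qed.

Lemma alg_neq1 (a : F) : a != 1 -> a%:A != 1 :> L.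
Proof. by rewrite -subr_eq0 -(nabs_eq0 vF) -hL algB scale1r nabs_eq0 subr_eq0. Qed.

(** [l] and [l'] are the slopes log delta / log at a and at b; that they differ is what the division
    in the coboundary formula requires. *)
Definition generic_pair (r : R) (a b : F) := exists l l' : L,
  [/\ l != l', a != 1 /\ b != 1, vF (a - 1) <= r /\ vF (b - 1) <= r,
      vL (delta a - 1) <= P ^+ 2 /\ vL (delta b - 1) <= P ^+ 2 &
      nabs_cvg vL (ppow_ratio p (delta a) a%:A) l /\
      nabs_cvg vL (ppow_ratio p (delta b) b%:A) l'].

(* If the slopes log delta(a) / log a all equal k near 1, then
   delta(1 + z) = (1 + z)^k there. *)
Lemma generic_pair_ex r : ~ locally_analytic vF vL delta -> 0 < r ->
  exists a b, generic_pair r a b.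
Proof.
move=> hna r0; apply/not_existsP => hno; apply: hna.
have PP0 : 0 < P ^+ 2 by rewrite exprn_gt0.
have [d d0 hdd] := char_cont hd (oner_neq0 F) PP0.
pose r1 := Num.min (Num.min r (d / 2)) (P ^+ 2).
have r1_0 : 0 < r1 by rewrite !lt_min r0 PP0 divr_gt0.
have r1r : r1 <= r by rewrite !ge_min lexx.
have r1d : r1 < d by rewrite !gt_min; apply/orP; left; apply/orP; right; lra.
have r1P : r1 <= P ^+ 2 by rewrite !ge_min lexx orbT.
have near1 a : vF (a - 1) <= r1 -> a != 0.
  move=> h; rewrite -(nabs_eq0 vF) nabs_near1 ?oner_neq0 //.
  by apply: le_lt_trans h _; apply: le_lt_trans r1P _; rewrite exprn_ilt1 // ltW.
have near1d a : vF (a - 1) <= r1 -> vL (delta a - 1) <= P ^+ 2.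
  move=> h; have := hdd a (near1 _ h) (le_lt_trans h r1d).
  by rewrite char1 => /ltW.
have vLp := nabs_padic_prime pp nabs_ext_natr.
have near1A (a : F) : vF (a - 1) <= r1 -> vL (a%:A - 1) <= P ^+ 2.
  by move=> h; rewrite -[X in _ - X](scale1r 1) -algB hL (le_trans h).
have hl a : a != 1 -> vF (a - 1) <= r1 ->
    exists l, nabs_cvg vL (ppow_ratio p (delta a) a%:A) l.
  move=> a1 ha; apply: (ppow_ratio_cvg (prime_gt1 pp) vLp) => //.
  - exact: alg_neq1.
  - exact: near1A.
  - exact: near1d.
have [N hN] := expr_small (ltW P0) P1 r1_0.
(* A point of the ball other than 1; its slope k becomes the common exponent. *)
pose a0 : F := 1 + p%:R ^+ N.
have va0 : vF (a0 - 1) = P ^+ N.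
  by rewrite /a0 addrAC subrr add0r nabsX vn ?prime_gt0 // logn_prime // eqxx expr1.
have a01 : a0 != 1 by rewrite -subr_eq0 -(nabs_eq0 vF) va0 gt_eqF // exprn_gt0.
have ha0 : vF (a0 - 1) <= r1 by rewrite va0; apply/ltW/hN.
have [k hk] := hl _ a01 ha0.
have hall a : a != 1 -> vF (a - 1) <= r1 -> nabs_cvg vL (ppow_ratio p (delta a) a%:A) k.
  move=> a1 ha; have [l hla] := hl _ a1 ha.
  have [-> //|kl] := eqVneq k l.
  case: (hno a0); exists a; exists k, l; split => //; split; try exact: near1d.
    exact: le_trans r1r.
  exact: le_trans r1r.
pose M := Num.max 1 (vL k).
have M1 : 1 <= M by rewrite le_max lexx.
have kM : vL k <= M by rewrite le_max lexx orbT.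
pose Q := M / P; have Q0 : 0 < Q by apply: divr_gt0 P0; apply: lt_le_trans M1.
pose r2 := Num.min r1 (P * P / Q).
have r2_0 : 0 < r2 by rewrite lt_min r1_0 divr_gt0 // mulr_gt0.
have hbin z : vF z <= r2 -> delta (1 + z) = binom_series vL k z%:A.
  move=> hz.
  have Qz : M / P * vL z%:A <= P * P.
    by rewrite hL mulrC -ler_pdivlMr //; apply: le_trans hz _; rewrite ge_min lexx orbT.
  have hz1 : vF (1 + z - 1) <= r1.
    by rewrite addrAC subrr add0r; apply: le_trans hz _; rewrite ge_min lexx.
  (* At z = 0 the slope ratio is 0/0; the value 1 of the series there is read off from the case n =
     0 of [binom_seriesX]. *)
  case: (eqVneq z 0) => [->|z0].
    rewrite addr0 scale0r char1.
    have := binom_seriesX pp nabs_ext_natr M1 0 kM Qz.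
    by rewrite !expr0 subrr.
  have z1 : 1 + z != 1 by rewrite -subr_eq0 addrAC subrr add0r.
  apply: (binom_series_unique pp nabs_ext_natr M1) Qz _ _ => //.
  - by rewrite -(nabs_eq0 vL) hL nabs_eq0.
  - exact: near1d.
  - by have := hall _ z1 hz1; rewrite scalerDl scale1r.
move=> x x0; have vx0 := nabs_gt0 vF x0.
(* Multiplicativity moves the expansion from 1 to x: delta(y) = delta(x) delta(1 + (y - x)/x). *)
exists (r2 * vF x); first exact: mulr_gt0.
exists (fun n => delta x * (gbinom k n * (x^-1)%:A ^+ n)) => y y0 hy.
pose z := (y - x) / x.
have hz : vF z <= r2.
  by rewrite nabsM nabsV ler_pdivrMr // ltW.
have yE : y = x * (1 + z) by rewrite /z mulrDr mulr1 mulrC divfK // addrC subrK.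
have z10 : 1 + z != 0 by apply: contraNneq y0 => z10; rewrite yE z10 mulr0.
rewrite [in X in has_sum _ _ X]yE (char_mul hd) // hbin //.
have Qz : M / P * vL z%:A < 1.
  apply: (@le_lt_trans _ _ (P * P)); last by rewrite -expr2 exprn_ilt1 // ltW.
  by rewrite hL mulrC -ler_pdivlMr //; apply: le_trans hz _; rewrite ge_min lexx orbT.
have := has_sumZ (delta x) (has_binom_series pp nabs_ext_natr M1 kM Qz).
apply: eq_has_sum => // n; rewrite -mulrA; congr (_ * _); rewrite -mulrA; congr (_ * _).
by rewrite -exprMn -algM mulrC.
Qed.

End NonAnalyticCharacter.

(** * Continuous linear operators on the Robba ring *)

Section Operators.
Variables (R : realType) (K : fieldType) (v : complete_abs R K).

(** Sequential continuity with a change of annulus: a substitution moves the inner radius, so the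
    images of a convergent sequence may converge only on a thinner annulus. *)
Record cont_op (T : robba v -> robba v) : Prop := ContOp {
  cont_opD : {morph T : f g / f + g};
  cont_opZ : forall c f, T (c *: f) = c *: T f;
  cont_op_cvg : forall rho y f, 0 < rho -> rho < 1 -> robba_cvg rho y f ->
    exists rho', [/\ 0 < rho', rho' < 1 & robba_cvg rho' (T \o y) (T f)] }.

Lemma cont_opB T : cont_op T -> {morph T : f g / f - g}.
Proof. by move=> hT f g; rewrite (cont_opD hT) -scaleN1r (cont_opZ hT) scaleN1r. Qed.

Lemma cont_op_comp S T : cont_op S -> cont_op T -> cont_op (S \o T).
Proof.
move=> hS hT; split.
- by move=> f g /=; rewrite (cont_opD hT) (cont_opD hS).
- by move=> c f /=; rewrite (cont_opZ hT) (cont_opZ hS).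
move=> rho y f r0 r1 hy; have [rho' [r0' r1' hy']] := cont_op_cvg hT r0 r1 hy.
by have [r [? ? ?]] := cont_op_cvg hS r0' r1' hy'; exists r.
Qed.

Lemma cont_op_id : cont_op id.
Proof. by split => // rho y f r0 r1 hy; exists rho. Qed.

Lemma cont_op_iter T n : cont_op T -> cont_op (iter n T).
Proof.
move=> hT; elim: n => [|n IH]; first exact: cont_op_id.
exact: cont_op_comp hT IH.
Qed.

Lemma cont_op_scale c : cont_op (fun f => c *: f).
Proof.
split.
- by move=> f g; rewrite scalerDr.
- by move=> d f; rewrite !scalerA mulrC.
move=> rho y f r0 r1 [y1 y2 y3]; exists rho; split => //; split.
- by move=> n; apply: conv_fromZ; exact: y1.
- exact: conv_fromZ.
move=> s eps rs s1 e0; have vc := nabs_ge0 v c.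
have [N hN] := y3 s (eps / (v c + 1)) rs s1 ltac:(apply: divr_gt0 => //; lra).
exists N => n /hN h; rewrite /= -scalerBr; apply: circle_leW (circle_leZ c h).
rewrite mulrA ler_pdivrMr; last by lra.
nra.
Qed.

Lemma cont_op_subst rho e h : 0 < rho -> rho < 1 -> (0 < e)%N -> dominated rho e h ->
  cont_op (@robba_subst _ _ v h).
Proof.
move=> r0 r1 e0 hd; split.
- exact: robba_substD r0 r1 e0 hd.
- exact: robba_substZ r0 r1 e0 hd.
- by move=> rho' y f r0' r1' hy; apply: (robba_subst_cvg r0 r1 e0 hd r0' r1' hy).
Qed.

Lemma cont_op_sub_lin T c c' f g : cont_op T ->
  T (c *: f - c' *: g) - (c *: f - c' *: g) = c *: (T f - f) - c' *: (T g - g).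
Proof.
move=> hT; rewrite (cont_opB hT) !(cont_opZ hT) !scalerBr !opprB addrACA.
by rewrite [RHS]addrACA [- _ + _]addrC.
Qed.

Lemma robba_coef_sub_lin c c' (f g h : robba v) n :
  (f + c *: h - (g + c' *: h)) n = (f - g) n + h n * (c - c').
Proof. by rewrite opprD addrACA -scalerBl [LHS]robbaD [h n * _]mulrC. Qed.

Lemma circle_le_cvg0 (E : nat -> robba v) s (th C : R) N n : 0 < s -> 0 <= th -> th < 1 -> 0 <= C ->
  (forall m, (N <= m)%N -> circle_le s (E m) (C * th ^+ m)) ->
  nabs_cvg v (fun m => E m n) 0.
Proof.
move=> s0 t0 t1 C0 hE e e0; have sn : 0 < s ^ n by rewrite exprz_gt0.
have [N' hN'] := expr_small t0 t1 (eps := e * s ^ n / (C + 1))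
  ltac:(apply: divr_gt0; [exact: mulr_gt0|lra]).
exists (maxn N N') => m; rewrite geq_max => /andP[/hE h /hN'].
rewrite subr0 ltr_pdivlMr; last by lra.
move=> h'; rewrite -(ltr_pM2r sn); apply: le_lt_trans (h n) _.
have := exprn_ge0 m t0; lra.
Qed.

End Operators.

(** * Cocycles of the twisted action *)

Section Cocycles.
Variables (R : realType) (Qp : fieldType) (F : fieldExtType Qp) (L : fieldExtType F).
Variables (vF : complete_abs R F) (vL : complete_abs R L) (p : nat).
Hypotheses (hL : forall x : F, vL x%:A = vF x) (pp : prime p).
Hypothesis vn : forall n : nat, (0 < n)%N -> vF n%:R = p%:R ^- logn p n.
Variables (pi : F) (q : nat) (FG : mps F 2) (br : F -> mps F 1).
Hypotheses (hpi : uniformizer vF pi) (q2 : (1 < q)%N) (hFG : lubin_tate_group vF pi q FG br).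

Let P : R := p%:R^-1.
Let p0 : 0 < (p%:R : R). Proof. by rewrite ltr0n prime_gt0. Qed.
Let P0 : 0 < P. Proof. by rewrite invr_gt0. Qed.
Let P1 : P < 1. Proof. by rewrite invf_lt1 // ltr1n prime_gt1. Qed.
Let vFp : vF p%:R = P. Proof. by rewrite vn ?prime_gt0 // logn_prime // eqxx expr1. Qed.
Let PPle1 : P ^+ 2 <= 1. Proof. by rewrite exprn_ile1 // ltW. Qed.
Let PPlt1 : P ^+ 2 < 1. Proof. by rewrite exprn_ilt1 // ltW. Qed.
Let vLp : vL p%:R = P. Proof. exact: nabs_padic_prime pp (nabs_ext_natr hL vn). Qed.
Let p1 : (1 < p)%N. Proof. exact: prime_gt1. Qed.

Let sigma a : robba vL -> robba vL := robba_comp vL (br a).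

Lemma sigma_cont_op a : vF a = 1 -> cont_op (sigma a).
Proof.
move=> va; have h2 : (1/2 : R) < 1 by lra.
have h0 : 0 < (1/2 : R) by lra.
by apply: (cont_op_subst h0 h2 (ltn0Sn 0)); apply: sigma_dominated hFG _ _ _ _.
Qed.

Lemma phi_cont_op : cont_op (robba_comp vL (br pi)).
Proof.
have [rho [r0 r1 hd]] := phi_dominated hL hpi q2 hFG.
exact: cont_op_subst r0 r1 (ltnW q2) hd.
Qed.

Lemma conv_from_sigma a rho (f : robba vL) : vF a = 1 -> 0 < rho -> rho < 1 ->
  conv_from vL rho f -> conv_from vL rho (sigma a f).
Proof.
move=> va r0 r1 hf.
by have [] := robba_subst_has_sum (f := f) r0 r1 (ltn0Sn 0) (sigma_dominated hL hFG va r0) hf.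
Qed.

Lemma sigma1 f : sigma 1 f = f.
Proof.
have [rho [r0 r1 hf _]] := robba2P f f.
have [C C0 [h _]] := sigma_near1 hL hpi q2 hFG r0 r1.
have [M M0 hM] := circle_le_ex r0 (lexx _) r1 hf.
have := h 0 rho f M; rewrite nabs0 addr0 nabs1 mulr0 mul0r => h1.
apply/eqP; rewrite -subr_eq0; apply/eqP; apply: (@circle_le_eq0 _ _ _ rho) => // e e0.
by apply: circle_leW (ltW e0) (h1 _ _ _ _ _ _ _); rewrite ?ler01 ?ltr01.
Qed.

(** [z k] plays the cocycle at gamma^k, with a = chi(gamma) and d = delta(a). The next term y_(m+1)
    is the sum over i < p of (d^i sigma_(a^i))^(p^m) y_m, divided by the sum of the a^(i p^m). All
    these operators and scalars are 1 + O(p^-m), and the divisor has absolute value 1/p, so the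
    increment is O(p^-m) relative to y_m. *)
Lemma cocycle_limit (a : F) (d : L) (z : nat -> robba vL) :
  a != 1 -> vF (a - 1) <= P ^+ 2 -> vL (d - 1) <= P ^+ 2 ->
  (forall i k, z (i + k)%N = z i + d ^+ i *: sigma (a ^+ i) (z k)) ->
  exists rho f, [/\ 0 < rho, rho < 1 &
    robba_cvg rho (fun m => ((a ^+ (p ^ m) - 1)^-1)%:A *: z (p ^ m)%N) f].
Proof.
move=> a1 ha hd hz.
have va : vF a = 1 by apply: nabs_near1; exact: le_lt_trans ha PPlt1.
have vd : vL d = 1 by apply: nabs_near1; exact: le_lt_trans hd PPlt1.
have vai i : vF (a ^+ i) = 1 by rewrite nabsX va expr1n.
have z0 : z 0%N = 0.
  have := hz 0%N 0%N; rewrite !expr0 scale1r sigma1 => h.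
  by apply: (addrI (z 0%N)); rewrite -h addr0.
have zM n k : z (k * n)%N = \sum_(i < n) (d ^+ k) ^+ i *: sigma ((a ^+ k) ^+ i) (z k).
  elim: n => [|n IH]; first by rewrite muln0 big_ord0.
  by rewrite mulnSr hz IH big_ord_recr /= !exprM.
have [rho [r0 r1 hz1 _]] := robba2P (z 1%N) (z 1%N).
have cz n : conv_from vL rho (z n).
  rewrite -[n]mul1n zM; apply: conv_from_sum => // i _; apply: conv_fromZ.
  by apply: conv_from_sigma => //; rewrite expr1 vai.
pose y m := ((a ^+ (p ^ m) - 1)^-1)%:A *: z (p ^ m)%N.
have cy m : conv_from vL rho (y m) by apply: conv_fromZ; exact: cz.
exists rho; suff [f hf] : exists f, robba_cvg rho y f by exists f.
apply: robba_complete => // s e rs s1 e0.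
have s0 : 0 < s by exact: lt_le_trans rs.
have [C C0 [hC _]] := sigma_near1 hL hpi q2 hFG s0 s1.
have vam m : vF (a ^+ (p ^ m) - 1) = P ^+ m * vF (a - 1).
  exact: (nabs_ppow_sub1 p1 vFp m ha).
have vdm m : vL (d ^+ (p ^ m) - 1) = P ^+ m * vL (d - 1).
  exact: (nabs_ppow_sub1 p1 vLp m hd).
have Pm m : 0 < P ^+ m by rewrite exprn_gt0.
have vami m i : vF ((a ^+ (p ^ m)) ^+ i - 1) <= P ^+ m.
  have h : vF (a ^+ (p ^ m) - 1) <= P ^+ m.
    by rewrite vam ler_piMr ?(ltW (Pm m)) // (le_trans ha).
  by apply: le_trans (nabs_exp_sub1 _ _) (h); apply: le_trans h _; rewrite exprn_ile1 // ltW.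
have vdmi m i : vL ((d ^+ (p ^ m)) ^+ i - 1) <= P ^+ m.
  have h : vL (d ^+ (p ^ m) - 1) <= P ^+ m.
    by rewrite vdm ler_piMr ?(ltW (Pm m)) // (le_trans hd).
  by apply: le_trans (nabs_exp_sub1 _ _) (h); apply: le_trans h _; rewrite exprn_ile1 // ltW.
pose G m := \sum_(i < p) (a ^+ (p ^ m)) ^+ i.
have vG m : vF (G m) = P by apply: (nabs_geom p1 vFp); exact: nabs_ppow_sub1_le.
have G0 m : G m != 0 by rewrite -(nabs_eq0 vF) vG gt_eqF.
have am0 m : a ^+ (p ^ m) - 1 != 0.
  by rewrite -(nabs_eq0 vF) vam gt_eqF // mulr_gt0 // nabs_gt0 // subr_eq0.
have ystep m : y m.+1 - y m = ((G m)^-1)%:A *: (\sum_(i < p)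
   ((d ^+ (p ^ m)) ^+ i *: sigma ((a ^+ (p ^ m)) ^+ i) (y m) -
    ((a ^+ (p ^ m)) ^+ i)%:A *: y m)).
  rewrite sumrB -scaler_suml -scaler_suml -/(G m) scalerBr scalerA -algM mulVf // !scale1r.
  congr (_ - _); rewrite /y expnSr exprM subrX1 -/(G m) invfM algM zM.
  rewrite [X in X *: _]mulrC -scalerA; congr (_ *: _).
  rewrite scaler_sumr; apply: eq_bigr => i _.
  have hs : cont_op (sigma ((a ^+ (p ^ m)) ^+ i)) by apply: sigma_cont_op; rewrite -exprM.
  by rewrite (cont_opZ hs) !scalerA mulrC.
have step m B : C * P ^+ m < 1 -> circle_le s (y m) B ->
    circle_le s (y m.+1 - y m) (P^-1 * ((C + 1) * P ^+ m * B)).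
  move=> Cm hB; have B0 := circle_le_ge0 hB.
  have N0 : 0 <= (C + 1) * P ^+ m * B.
    by rewrite !mulr_ge0 // ?(ltW (Pm m)) // addr_ge0 // ltW.
  have vG' : P^-1 = vL ((G m)^-1)%:A by rewrite hL nabsV vG.
  rewrite ystep vG'; apply: circle_leZ.
  apply: circle_le_sum => // i _.
  set x := (a ^+ (p ^ m)) ^+ i; set u := (d ^+ (p ^ m)) ^+ i.
  have -> : u *: sigma x (y m) - x%:A *: y m =
     u *: (sigma x (y m) - y m) + (u - x%:A) *: y m.
    by rewrite scalerBr scalerBl addrA subrK.
  have xE : x = 1 + (x - 1) by rewrite addrC subrK.
  have vx1 := vami m i; rewrite -/x in vx1.
  have vu1 := vdmi m i; rewrite -/u in vu1.
  have Cx : C * vF (x - 1) < 1 by apply: le_lt_trans Cm; rewrite ler_wpM2l // ltW.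
  have vx11 : vF (x - 1) <= 1 by apply: le_trans vx1 _; rewrite exprn_ile1 // ltW.
  apply: circle_leD => //.
    have vu : vL u = 1 by rewrite !nabsX vd !expr1n.
    have vx : vF (1 + (x - 1)) = 1 by rewrite -xE /x -exprM vai.
    have := circle_leZ u (hC _ rho _ _ vx11 Cx vx r0 rs (cy m) hB).
    rewrite vu mul1r -xE; apply: circle_leW; rewrite ler_wpM2r //.
    apply: le_trans (_ : C * P ^+ m <= _); first by rewrite ler_wpM2l // ltW.
    by rewrite ler_wpM2r ?(ltW (Pm m)) // lerDl.
  apply: circle_leW (circle_leZ _ hB); rewrite ler_wpM2r //.
  apply: le_trans (_ : 1 * P ^+ m <= _); last first.
    by rewrite ler_wpM2r ?(ltW (Pm m)) // lerDr ltW.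
  rewrite mul1r; have -> : u - x%:A = (u - 1) - (x - 1)%:A.
    rewrite algB scale1r; ring.
  by apply: nabs_leB => //; rewrite hL.
have P'0 : 0 < P^-1 by rewrite invr_gt0.
have D0 : 0 < P^-1 * (C + 1) by rewrite mulr_gt0 // addr_gt0.
set D := P^-1 * (C + 1) in D0.
have CD : C <= D.
  rewrite /D mulrC ler_pdivlMr //; apply: le_trans (_ : C <= _); last by rewrite lerDl.
  by rewrite ler_piMr // ltW.
have [N hN] := expr_small (ltW P0) P1 (eps := D^-1) ltac:(by rewrite invr_gt0).
have hDN m : (N <= m)%N -> D * P ^+ m < 1.
  by move=> /hN; rewrite -[D^-1]mul1r ltr_pdivlMr // mulrC.
have hCN m : (N <= m)%N -> C * P ^+ m < 1.
  by move=> /hDN; apply: le_lt_trans; rewrite ler_wpM2r // ltW.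
have DE m B : P^-1 * ((C + 1) * P ^+ m * B) = D * P ^+ m * B by rewrite /D; ring.
have [B B0 hB] := circle_le_ex r0 rs s1 (cy N).
(* The increment is estimated relative to y_m; it first yields a bound common to all y_m from rank N
   on, and only then geometric decay. *)
have hyB m : (N <= m)%N -> circle_le s (y m) B.
  elim: m => [|m IH]; first by rewrite leqn0 => /eqP <-.
  rewrite leq_eqVlt => /orP[/eqP <- //|]; rewrite ltnS => Nm.
  rewrite -[y m.+1](subrK (y m)); apply: circle_leD => //; last exact: IH.
  apply: circle_leW (step m B (hCN _ Nm) (IH Nm)).
  by rewrite DE ler_piMl ?(ltW B0) // ltW // hDN.
have [N' hN'] := expr_small (ltW P0) P1 (eps := e / (D * B)) ltac:(by rewrite divr_gt0 // mulr_gt0).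
exists (maxn N N') => m; rewrite geq_max => /andP[Nm Nm'].
apply: circle_leW (step m B (hCN _ Nm) (hyB _ Nm)).
have DB : 0 < D * B by rewrite mulr_gt0.
have h := hN' m Nm'; rewrite ltr_pdivlMr // in h.
by rewrite DE; have -> : D * P ^+ m * B = P ^+ m * (D * B) by [ring]; exact: ltW.
Qed.

Variables (delta : F -> L) (hd : continuous_char vF vL delta).
Hypothesis hnan : ~ locally_analytic vF vL delta.
Variables (G : Type) (mul : G -> G -> G) (chi : G -> F).
Hypotheses (chi_unit : forall s, vF (chi s) = 1)
  (chi_mul : forall s t, chi (mul s t) = chi s * chi t)
  (chi_inj : injective chi) (chi_surj : forall a, vF a = 1 -> exists s, chi s = a).

(** Unfolds to [sg_act] on [pg_twist] once [G] is the Galois group, so that the results below apply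
    there by conversion. *)
Definition twisted_act (g : nat * G) (f : robba vL) : robba vL :=
  iter g.1 (fun f => delta pi *: robba_comp vL (br pi) f) (delta (chi g.2) *: sigma (chi g.2) f).

Lemma twisted_act_cont_op g : cont_op (twisted_act g).
Proof.
apply: (@cont_op_comp _ _ _ (iter g.1 (fun f => delta pi *: robba_comp vL (br pi) f))
   (fun f => delta (chi g.2) *: sigma (chi g.2) f)).
  apply: cont_op_iter; exact: cont_op_comp (cont_op_scale _ _) phi_cont_op.
exact: cont_op_comp (cont_op_scale _ _) (sigma_cont_op (chi_unit _)).
Qed.

(** |a^(p^m) - 1| and |b^(p^m) - 1| shrink in a fixed ratio, so the parameter t of [sigma_near1] has
    constant absolute value and the comparison gains P^m. The powers of [da] and [db] are 1 + O(P^m)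
    and multiply bounded quotients. The ordering of a and b makes t integral. *)
Lemma sigma_quotients_close (a b : F) (da db : L) (f : robba vL) n : a != 1 -> b != 1 ->
  vF (b - 1) <= vF (a - 1) -> vF (a - 1) <= P ^+ 2 ->
  vL (da - 1) <= P ^+ 2 -> vL (db - 1) <= P ^+ 2 ->
  nabs_cvg vL (fun m =>
     ((da ^+ (p ^ m) * ((a ^+ (p ^ m) - 1)^-1)%:A) *: (sigma (a ^+ (p ^ m)) f - f) -
      (db ^+ (p ^ m) * ((b ^+ (p ^ m) - 1)^-1)%:A) *: (sigma (b ^+ (p ^ m)) f - f)) n) 0.
Proof.
move=> a1 b1 ba ha hda hdb.
have hb := le_trans ba ha.
have [s [s0 s1 cf _]] := robba2P f f.
have [C C0 [hC hC2]] := sigma_near1 hL hpi q2 hFG s0 s1.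
have [M M0 hM] := circle_le_ex s0 (lexx _) s1 cf.
have va0 : 0 < vF (a - 1) by rewrite nabs_gt0 // subr_eq0.
have vb0 : 0 < vF (b - 1) by rewrite nabs_gt0 // subr_eq0.
have Pm m : 0 < P ^+ m by rewrite exprn_gt0.
have Pm1 m : P ^+ m <= 1 by rewrite exprn_ile1 // ltW.
have vam m : vF (a ^+ (p ^ m) - 1) = P ^+ m * vF (a - 1) by exact: (nabs_ppow_sub1 p1 vFp m ha).
have vbm m : vF (b ^+ (p ^ m) - 1) = P ^+ m * vF (b - 1) by exact: (nabs_ppow_sub1 p1 vFp m hb).
have va : vF a = 1 by apply: nabs_near1; exact: le_lt_trans ha PPlt1.
have vb : vF b = 1 by apply: nabs_near1; exact: le_lt_trans hb PPlt1.
have CM0 : 0 <= C * M by rewrite mulr_ge0 // ltW.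
have K1 : 0 <= C * vF (a - 1) / (vF (b - 1) / vF (a - 1)) * M.
  by rewrite ltW // mulr_gt0 // divr_gt0 ?divr_gt0 // mulr_gt0.
(* The first summand comes from comparing the quotients, the second from replacing the powers of
   [da] and [db] by 1. *)
pose K := C * vF (a - 1) / (vF (b - 1) / vF (a - 1)) * M + C * M.
have [N hN] := expr_small (ltW P0) P1 (eps := C^-1) ltac:(by rewrite invr_gt0).
apply: (@circle_le_cvg0 _ _ vL _ s P K N) => //; first exact: ltW.
  exact: addr_ge0.
move=> m Nm.
pose c := a ^+ (p ^ m) - 1; pose c' := b ^+ (p ^ m) - 1; pose t := c' / c.
have vc : vF c = P ^+ m * vF (a - 1) := vam m.
have vc' : vF c' = P ^+ m * vF (b - 1) := vbm m.
have c0 : c != 0 by rewrite -(nabs_eq0 vF) vc gt_eqF // mulr_gt0.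
have c'0 : c' != 0 by rewrite -(nabs_eq0 vF) vc' gt_eqF // mulr_gt0.
have t0 : t != 0 by rewrite mulf_neq0 // invr_eq0.
have tcE : t * c = c' by rewrite /t divfK.
have vt : vF t = vF (b - 1) / vF (a - 1).
  by rewrite nabsM nabsV vc vc'; field; rewrite !gt_eqF.
have vt1 : vF t <= 1 by rewrite vt ler_pdivrMr // mul1r.
have aE : a ^+ (p ^ m) = 1 + c by rewrite /c addrC subrK.
have bE : b ^+ (p ^ m) = 1 + c' by rewrite /c' addrC subrK.
have v1c : vF (1 + c) = 1 by rewrite -aE nabsX va expr1n.
have v1c' : vF (1 + c') = 1 by rewrite -bE nabsX vb expr1n.
have vcm : vF c <= P ^+ m by rewrite vc ler_piMr ?(ltW (Pm m)) // (le_trans ha).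
have vc'm : vF c' <= P ^+ m by rewrite vc' ler_piMr ?(ltW (Pm m)) // (le_trans hb).
have Cm : C * P ^+ m < 1.
  by have := hN m Nm; rewrite -[C^-1]mul1r ltr_pdivlMr // mulrC.
have Cc : C * vF c < 1 by apply: le_lt_trans Cm; rewrite ler_wpM2l // ltW.
have Cc' : C * vF c' < 1 by apply: le_lt_trans Cm; rewrite ler_wpM2l // ltW.
have vc1 := le_trans vcm (Pm1 m); have vc'1 := le_trans vc'm (Pm1 m).
have vd (d : L) : vL (d - 1) <= P ^+ 2 -> vL (d ^+ (p ^ m) - 1) <= P ^+ m.
  move=> h; rewrite (nabs_ppow_sub1 p1 vLp) // ler_piMr ?(ltW (Pm m)) //.
  exact: le_trans h PPle1.
have KP1 : C * vF (a - 1) / (vF (b - 1) / vF (a - 1)) * M * P ^+ m <= K * P ^+ m.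
  by rewrite ler_wpM2r ?(ltW (Pm m)) // /K lerDl.
have KP2 : P ^+ m * (C * M) <= K * P ^+ m.
  by rewrite mulrC ler_wpM2r ?(ltW (Pm m)) // /K lerDr.
have key (X Y : robba vL) : circle_le s ((c^-1)%:A *: X - (c'^-1)%:A *: Y)
    (C * vF (a - 1) / (vF (b - 1) / vF (a - 1)) * M * P ^+ m) ->
    circle_le s ((c^-1)%:A *: X) (C * M) -> circle_le s ((c'^-1)%:A *: Y) (C * M) ->
    circle_le s ((da ^+ (p ^ m) * (c^-1)%:A) *: X - (db ^+ (p ^ m) * (c'^-1)%:A) *: Y)
      (K * P ^+ m).
  rewrite -!scalerA; move: (_ *: X) (_ *: Y) => {}X {}Y hXY hX hY.
  have -> : da ^+ (p ^ m) *: X - db ^+ (p ^ m) *: Y =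
     (X - Y) + ((da ^+ (p ^ m) - 1) *: X - (db ^+ (p ^ m) - 1) *: Y).
    rewrite !scalerBl !scale1r; move: (_ *: X) (_ *: Y) => x y; ring.
  apply: circle_leD => //; first exact: circle_leW hXY.
  apply: circle_leB => //.
    by apply: circle_leW (circle_leZ _ hX); apply: le_trans KP2; apply: ler_wpM2r => //; exact: (vd da hda).
  by apply: circle_leW (circle_leZ _ hY); apply: le_trans KP2; apply: ler_wpM2r => //; exact: (vd db hdb).
have hC1 x : x != 0 -> vF x <= 1 -> C * vF x < 1 -> vF (1 + x) = 1 ->
    circle_le s ((x^-1)%:A *: (sigma (1 + x) f - f)) (C * M).
  move=> x0 vx Cx v1x.
  apply: circle_leW (circle_leZ (x^-1)%:A (hC x s f M vx Cx v1x s0 (lexx _) cf hM)).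
  have vx0 : vF x != 0 by rewrite nabs_eq0.
  by rewrite hL nabsV [C * _]mulrC -!mulrA mulKf.
apply: key; rewrite ?aE ?bE.
- have := hC2 c t s f M c0 t0 vc1 vt1 Cc v1c; rewrite tcE => /(_ v1c' s0 (lexx _) cf hM).
  apply: circle_leW; rewrite vt vc; rewrite le_eqVlt; apply/orP; left; apply/eqP.
  by field; rewrite !gt_eqF.
- exact: hC1.
- exact: hC1.
Qed.

Lemma mul_comm s t : mul s t = mul t s.
Proof. by apply: chi_inj; rewrite !chi_mul mulrC. Qed.

(* The cocycle relation for commuting g, h reads (g - 1) z(h) = (h - 1) z(g). *)
Lemma cocycle_coboundary (z : nat * G -> robba vL) :
  (forall g h, z ((g.1 + h.1)%N, mul g.2 h.2) = z g + twisted_act g (z h)) ->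
  exists f, forall g, z g = twisted_act g f - f.
Proof.
move=> hz.
have PP0 : 0 < P ^+ 2 by rewrite exprn_gt0.
(* The pair is ordered as [sigma_quotients_close] requires; exchanging the points exchanges the
   slopes. *)
have [a [b [l [l' [ll [a1 b1] [ha hb] [hda hdb] [hl hl' ba]]]]]] :
    exists a b l l', [/\ l != l', a != 1 /\ b != 1,
      vF (a - 1) <= P ^+ 2 /\ vF (b - 1) <= P ^+ 2,
      vL (delta a - 1) <= P ^+ 2 /\ vL (delta b - 1) <= P ^+ 2 &
      [/\ nabs_cvg vL (ppow_ratio p (delta a) a%:A) l,
      nabs_cvg vL (ppow_ratio p (delta b) b%:A) l' & vF (b - 1) <= vF (a - 1)]].
  have [a [b [l [l' [h1 [h2 h2'] [h3 h3'] [h4 h4'] [h5 h5']]]]]] :=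
    generic_pair_ex hL pp vn hd hnan PP0.
  case: (leP (vF (b - 1)) (vF (a - 1))) => ba; first by exists a, b, l, l'.
  by exists b, a, l', l; split=> //; [rewrite eq_sym|split=> //; exact: ltW].
have lim x : x != 1 -> vF (x - 1) <= P ^+ 2 -> vL (delta x - 1) <= P ^+ 2 ->
    exists s : nat -> G, (forall k, chi (s k) = x ^+ k) /\
    exists rho f, [/\ 0 < rho, rho < 1 &
    robba_cvg rho (fun m => ((x ^+ (p ^ m) - 1)^-1)%:A *: z (0%N, s (p ^ m)%N)) f].
  move=> x1 hx hdx.
  have vx : vF x = 1 by apply: nabs_near1; exact: le_lt_trans hx PPlt1.
  have x0 : x != 0 by rewrite -(nabs_eq0 vF) vx oner_eq0.
  have /choice [s hs] : forall k : nat, exists s, chi s = x ^+ k.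
    by move=> k; apply: chi_surj; rewrite nabsX vx expr1n.
  exists s; split => //; apply: (cocycle_limit (z := fun k => z (0%N, s k)) x1 hx hdx).
  move=> i k; have -> : s (i + k)%N = mul (s i) (s k).
    by apply: chi_inj; rewrite chi_mul !hs exprD.
  have := hz (0%N, s i) (0%N, s k); rewrite /= addn0 => ->.
  by rewrite /twisted_act /= hs (charX hd).
have [s [hs [rho [fa [r0 r1 cva]]]]] := lim _ a1 ha hda.
have [t [ht [rho' [fb [r0' r1' cvb]]]]] := lim _ b1 hb hdb.
pose r := Num.max rho rho'.
have rr0 : 0 < r by rewrite lt_max r0.
have rr1 : r < 1 by rewrite gt_max r1.
have le1 : rho <= r by rewrite /r le_max lexx.
have le2 : rho' <= r by rewrite /r le_max lexx orbT.
have cva' := robba_cvg_le le1 cva; have cvb' := robba_cvg_le le2 cvb.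
have cv := robba_cvgB rr0 cva' cvb'.
set y := (fun m => _ - _) in cv; set f := fa - fb in cv.
(* (g - 1) f will turn out to be (l - l') z(g), whence the factor. *)
exists ((l - l')^-1 *: f) => g.
have hT := twisted_act_cont_op g; set T := twisted_act g in hT *.
have comm u : T (z (0%N, u)) - z (0%N, u) = twisted_act (0%N, u) (z g) - z g.
  apply/eqP; rewrite subr_eq addrAC eq_sym subr_eq; apply/eqP.
  have h1 := hz (0%N, u) g; have h2 := hz g (0%N, u).
  rewrite /= add0n in h1; rewrite /= addn0 mul_comm h1 in h2.
  by rewrite [RHS]addrC -h2 addrC.
(* Split delta sigma - 1 as delta (sigma - 1) + (delta - 1): after division the first part is the
   quotient approximating the derivative, the second is the slope ratio. *)
have step x u m (hu : chi u = x ^+ (p ^ m)) : x != 0 ->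
    ((x ^+ (p ^ m) - 1)^-1)%:A *: (T (z (0%N, u)) - z (0%N, u)) =
    (delta x ^+ (p ^ m) * ((x ^+ (p ^ m) - 1)^-1)%:A) *: (sigma (x ^+ (p ^ m)) (z g) - z g)
    + ppow_ratio p (delta x) x%:A m *: z g.
  move=> x0; rewrite comm /twisted_act /= hu (charX hd) //.
  have -> : ppow_ratio p (delta x) x%:A m =
      (delta x ^+ (p ^ m) - 1) * ((x ^+ (p ^ m) - 1)^-1)%:A.
    by rewrite /ppow_ratio -algX algV algB scale1r.
  move: (sigma _ _) (delta x ^+ _) (_ %:A) => w d c.
  rewrite !scalerBr scalerA [d * c]mulrC [(d - 1) * c]mulrC mulrBr mulr1.
  by rewrite scalerBl addrA subrK.
have x0 x : vF (x - 1) <= P ^+ 2 -> x != 0.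
  move=> hx; rewrite -(nabs_eq0 vF) nabs_near1 ?oner_eq0 //.
  exact: le_lt_trans hx PPlt1.
apply: robba_eqP => n.
(* One coefficient of (T - 1) y_m has its limit computed twice, here by continuity of T and then by
   the cocycle relation. *)
have c1 : nabs_cvg vL (fun m => (T (y m) - y m) n) ((T f - f) n).
  have [r2 [r20 r21 cvT]] := cont_op_cvg hT rr0 rr1 cv.
  rewrite robbaB; have := nabs_cvgB (robba_cvg_coef n r20 r21 cvT) (robba_cvg_coef n rr0 rr1 cv).
  by congr nabs_cvg.
have c2 : nabs_cvg vL (fun m => (T (y m) - y m) n) ((l - l') * z g n).
  have h0 := sigma_quotients_close (z g) n a1 b1 ba ha hda hdb.
  have h1 := nabs_cvgD h0 (nabs_cvgZ (z g n) (nabs_cvgB hl hl')).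
  rewrite add0r [_ * (l - l')]mulrC in h1.
  move: h1; congr nabs_cvg; apply: funext => m.
  have -> : T (y m) - y m =
     ((a ^+ (p ^ m) - 1)^-1)%:A *: (T (z (0%N, s (p ^ m)%N)) - z (0%N, s (p ^ m)%N)) -
     ((b ^+ (p ^ m) - 1)^-1)%:A *: (T (z (0%N, t (p ^ m)%N)) - z (0%N, t (p ^ m)%N)).
    exact: cont_op_sub_lin.
  rewrite (step a _ m (hs _)) ?x0 // (step b _ m (ht _)) ?x0 //.
  by rewrite robba_coef_sub_lin.
have e := nabs_cvg_unique c1 c2.
have ll0 : l - l' != 0 by rewrite subr_eq0.
rewrite (cont_opZ hT) -scalerBr robbaZ e mulKf //.
Qed.

End Cocycles.

(** * Extensions *)

Section Extensions.
Variables (R : realType) (L : fieldType) (vL : complete_abs R L).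
Variables (F E : fieldType) (k : F -> E).
Variables (phiR : robba vL -> robba vL) (actR : Defs.gal k -> robba vL -> robba vL).

Lemma sg_actD (D : pg_data vL k) g : phi_gamma_module phiR actR D ->
  {morph @sg_act _ _ _ _ _ _ D g : x y / x + y}.
Proof.
move=> hD x y; rewrite /sg_act (pg_actD hD).
by elim: g.1 => //= n ->; rewrite (pg_phiD hD).
Qed.

Lemma sg_actM (D : pg_data vL k) g h (x : D) : phi_gamma_module phiR actR D ->
  sg_act (sg_mul g h) x = sg_act g (sg_act h x).
Proof.
move=> hD; rewrite /sg_act /= iterD (pg_actM hD); congr (iter _ _ _).
elim: h.1 => //= n ->; by rewrite (pg_comm hD).
Qed.

Lemma pg_morphism_sg_act (D D' : pg_data vL k) (f : {linear D -> D'}) g x :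
  pg_morphism f -> f (sg_act g x) = sg_act g (f x).
Proof.
move=> [fphi fact]; rewrite /sg_act -fact.
by elim: g.1 => //= n IH; rewrite fphi IH.
Qed.

(* A lift x of 1 gives the cocycle g x - x; a primitive f of it makes x - f a
   fixed lift of 1. *)
Lemma extension_split (c : L) (d : Defs.gal k -> L) (D : pg_data vL k)
    (i : {linear pg_twist phiR actR c d -> D}) (pr : {linear D -> pg_unit phiR actR}) :
  phiR 1 = 1 -> (forall s, actR s 1 = 1) ->
  (forall z : nat * Defs.gal k -> robba vL,
     (forall g h, z (sg_mul g h) = z g + @sg_act _ _ _ _ _ _ (pg_twist phiR actR c d) g (z h)) ->
     exists f, forall g, z g = @sg_act _ _ _ _ _ _ (pg_twist phiR actR c d) g f - f) ->
  pg_extension phiR actR i pr -> pg_split pr.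
Proof.
move=> phi1 act1 H [hD hi hpr [injI surjP exact]].
have [x hx] := surjP (1 : robba vL).
have fix1 g : @sg_act _ _ _ _ _ _ (pg_unit phiR actR) g (1 : robba vL) = (1 : robba vL).
  rewrite /sg_act /= act1; elim: g.1 => //= n ->; exact: phi1.
have /choice [z hz] : forall g, exists y : robba vL, i y = sg_act g x - x.
  move=> g; apply/exact; rewrite raddfB /= (pg_morphism_sg_act _ _ hpr) hx fix1.
  exact: subrr.
have [f hf] : exists f, forall g, z g = @sg_act _ _ _ _ _ _ (pg_twist phiR actR c d) g f - f.
  apply: H => g h; apply: injI.
  rewrite hz raddfD /= (pg_morphism_sg_act _ _ hi) !hz (sg_actM _ _ _ hD).
  have e : sg_act g (sg_act h x - x) = sg_act g (sg_act h x) - sg_act g x.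
    apply/eqP; rewrite eq_sym subr_eq -(sg_actD _ hD) subrK //.
  by rewrite e [RHS]addrC addrA subrK.
pose x' := x - i f.
have fix2 g : sg_act g x' = x'.
  have e : sg_act g x' = sg_act g x - sg_act g (i f).
    by apply/eqP; rewrite eq_sym subr_eq -(sg_actD _ hD) subrK.
  rewrite e -(pg_morphism_sg_act _ _ hi).
  have := hz g; rewrite hf raddfB /= => /eqP; rewrite subr_eq => /eqP ->.
  rewrite /x'; set a := sg_act g x; set b := i f.
  by rewrite opprD opprB addrA; congr (_ - _); rewrite addrC subrK.
(* The semigroup elements (1, 1) and (0, s) recover phi and the action of Gamma separately. *)
have phix : pg_phi x' = x'.
  by have := fix2 (1%N, 1%g); rewrite /sg_act /= (pg_act1 hD).
have actx s : pg_act s x' = x' by exact: (fix2 (0%N, s)).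
have prx : pr x' = (1 : robba vL).
  rewrite raddfB /= hx; have -> : pr (i f) = 0 by apply/exact; exists f.
  exact: subr0.
pose sec (r : (robba vL)^o) : D := (r : robba vL) *: x'.
have secl : linear sec.
  by move=> a u w; rewrite /sec scalerDl scalerA.
pose secL : {linear pg_unit phiR actR -> D} :=
  HB.pack sec (GRing.isLinear.Build _ _ _ _ sec secl).
exists secL; split.
  split.
    by move=> r /=; rewrite /sec (pg_phiZ hD) phix.
  by move=> s r /=; rewrite /sec (pg_actZ hD) actx.
move=> r /=; rewrite /sec linearZ /= prx; exact: mulr1.
Qed.

End Extensions.

(** 0 and 1 lie in different residue classes. The inequality q >= 2 is what makes the X^q term of
    [pi] contract. *)
Lemma residue_card_gt1 (R : realType) (F : fieldType) (v : nonarch_abs R F) q :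
  residue_card v q -> (1 < q)%N.
Proof.
move=> [s [_ _ hs]].
have [i hi] := hs 0 ltac:(by rewrite nabs0).
have [k hk] := hs 1 ltac:(by rewrite nabs1).
have ik : i != k.
  apply: contraTneq hi => ->; rewrite -leNgt.
  have : v (s k) = 1.
    rewrite -[s k](subrK 1) addrC nabs_dom nabs1 // nabsB_sym.
    exact: hk.
  by rewrite sub0r nabsN => ->.
case: q s hs i k hi hk ik => [|[|q]] // s hs i k _ _; first by case: i.
by rewrite (ord1 i) (ord1 k).
Qed.

Theorem mainTheorem5
    (R : realType) (p : nat)
    (Qp : fieldType) (vp : complete_abs R Qp) (hQp : padic_numbers p vp)
    (F : fieldExtType Qp) (vF : complete_abs R F)
    (hF : forall x : Qp, vF x%:A = vp x)
    (L : fieldExtType F) (vL : complete_abs R L)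
    (hL : forall x : F, vL x%:A = vF x)
    (pi : F) (hpi : uniformizer vF pi) (q : nat) (hq : residue_card vF q)
    (FG : mps F 2) (br : F -> mps F 1) (hFG : lubin_tate_group vF pi q FG br)
    (Fbar : closedFieldType) (j : {rmorphism F -> Fbar})
    (hj : forall x : Fbar, algebraicOver j x)
    (w : nonarch_abs R Fbar) (hw : forall x : F, w (j x) = vF x)
    (chi : Gamma w j pi br -> F) (hchi : lubin_tate_char vF chi)
    (delta : F -> L) (hdelta : continuous_char vF vL delta)
    (hnan : ~ locally_analytic vF vL delta) :
  let phi_q := robba_comp vL (br pi) in
  let sigma (s : Gamma w j pi br) := robba_comp vL (br (chi s)) in
  let delta_chi (s : Gamma w j pi br) := delta (chi s) in
  let R_L := pg_unit phi_q sigma in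
  let R_L_delta := pg_twist phi_q sigma (delta pi) delta_chi in
  H1_eq0 phi_q sigma (delta pi) delta_chi /\
  (forall (D : pg_data vL (@adjoin_base F Fbar j (torsion w j pi br)))
     (i : {linear R_L_delta -> D}) (pr : {linear D -> R_L}),
     pg_extension phi_q sigma i pr -> pg_split pr).
Proof.
move=> phi_q sigma delta_chi R_L R_L_delta.
have q2 := residue_card_gt1 hq.
have [pp pn _] := hQp.
have vn (n : nat) : (0 < n)%N -> vF n%:R = p%:R ^- logn p n.
  by move=> n0; rewrite -pn // -hF scaler_nat.
have H : forall z : nat * Gamma w j pi br -> robba vL,
    (forall g h, z (sg_mul g h) = z g + @sg_act _ _ _ _ _ _ R_L_delta g (z h)) ->
    exists f, forall g, z g = @sg_act _ _ _ _ _ _ R_L_delta g f - f.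
  move=> z hz.
  exact: (cocycle_coboundary hL pp vn hpi q2 hFG hdelta hnan (ltc_unit hchi)
    (ltc_mul hchi) (ltc_inj hchi) (ltc_surj hchi) hz).
split; first by move=> z [_ hz]; exact: H.
(* Any substitution fixes the constant 1, so 1 is invariant in the quotient module. *)
move=> D i pr; apply: extension_split => // [|s]; exact: robba_subst1.
Qed.
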